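(* Let $(Z,d,\nu)$ be a complete doubling metric measure space with uniformized hyperbolic filling $X_\rho$ (parameters $\alpha,\tau$). Let $p\ge1$, $0<\beta<p$, $\theta=1-\beta/p$, and equip $\bar X_\rho$ with $\mu_\beta$. There is a constant $C=C(\alpha,\tau)\ge1$ such that if $B\subset Z$ is any ball of radius $r>0$ and $f\in\tilde B^\theta_p(Z)$, then for any $p$-integrable upper gradient $g$ of the extension $Pf$ on $C\hat B$ we have $$\frac1{\nu(B)}\int_B|f-(Pf)_{\hat B}|^p\,d\nu\le C_1\,r^p\,\frac1{\mu_\beta(C\hat B)}\int_{C\hat B}g^p\,d\mu_\beta,$$ where $(Pf)_{\hat B}$ is the mean value of $Pf$ over $\hat B$ with respect to $\mu_\beta$ and $C_1$ depends only on $\alpha,\tau,C_\nu,\beta,p$.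
   Context: **Metric measure spaces.** A metric measure space is a metric space with a Borel regular measure giving every ball positive finite measure. Balls are open and carry a specified center and radius; $cB$ is the concentric ball with radius multiplied by $c$. $(Z,d,\nu)$ is doubling: $\nu(2B)\le C_\nu\,\nu(B)$ for all balls $B$. **Hyperbolic filling.** Fix $\alpha>1$ and $\tau>\max\{3,\alpha/(\alpha-1)\}$. For each $n\in\mathbb Z$ choose a maximal $\alpha^{-n}$-separated set $S_n\subset Z$ (distinct points at distance $\ge\alpha^{-n}$). Put $V_n=\{(z,n):z\in S_n\}$, $V=\bigcup_n V_n$, $\pi(z,n)=z$, $h(z,n)=n$, and $B(v)=B_Z(\pi(v),\tau\alpha^{-h(v)})$. Distinct vertices $v,w$ are joined by an edge ($v\sim w$) iff $|h(v)-h(w)|\le 1$ and $B(v)\cap B(w)\ne\emptyset$. $X$ is the resulting (connected) metric graph with unit-length edges; $h$ is extended linearly to edges. **Uniformization.** $\rho(x)=\alpha^{-h(x)}$, $d_\rho(x,y)=\inf_\gamma\int_\gamma\rho\,ds$ over curves in $X$ from $x$ to $y$; $X_\rho=(X,d_\rho)$, $\bar X_\rho$ its completion, $\partial X_\rho=\bar X_\rho\setminus X_\rho$. There is a canonical biLipschitz identification (constant depending on $\alpha,\tau$) of $Z$ with $\partial X_\rho$: $z\in Z$ corresponds to $\lim_{n\to\infty}v_n$ in $\bar X_\rho$ for any $v_n\in V_n$ with $d(\pi(v_n),z)<\alpha^{-n}$. After this construction the metric of $Z$ is replaced by the biLipschitz equivalent metric induced by $d_\rho$, so that $Z=\partial X_\rho$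 isometrically ($S_n$ and $B(v)$ are those coming from the original metric). For a ball $B=B_Z(z,r)$ in $Z$, $\hat B=B_\rho(z,r)$ is the $d_\rho$-ball in $\bar X_\rho$ with the same center and radius. **Measures.** Let $\mathcal L$ be Lebesgue measure on the unit edges of $X$, $\mu(A)=\sum_{v\in V}\sum_{w\sim v}(\nu(B(v))+\nu(B(w)))\,\mathcal L(A\cap vw)$ where $vw$ is the edge from $v$ to $w$, and $d\mu_\beta=\alpha^{-\beta h}\,d\mu$ on $X_\rho$, extended by $\mu_\beta(\partial X_\rho)=0$. **Upper gradients.** A Borel $g:Y\to[0,\infty]$ is an upper gradient of $u$ on a metric space $Y$ if $|u(x)-u(y)|\le\int_\gamma g\,ds$ for every nonconstant compact rectifiable curve $\gamma$ in $Y$ joining $x,y$ (with $\int_\gamma g\,ds=\infty$ required if $u(x)$ or $u(y)$ is infinite). **Besov space.** $\|u\|_{B^\theta_p(Z)}^p=\int_Z\int_Z\frac{|u(x)-u(y)|^p}{d(x,y)^{p\theta}}\frac{d\nu(x)\,d\nu(y)}{\nu(B(x,d(x,y)))}$; $\tilde B^\theta_p(Z)$ is the set of $u$ that are $p$-integrable on every ball with $\|u\|_{B^\theta_p(Z)}<\infty$. **Extension.** For $f$ integrable on balls, $Pf(v)=\frac1{\nu(B(v))}\int_{B(v)}f\,d\nu$ for $v\in V$, extended to each edge by linear interpolation with respect to $d_\rho$-arclength, and $Pf(z)=\limsup_{r\to0^+}\frac{1}{\mu_\beta(X_\rho\cap B_\rho(z,r))}\int_{X_\rho\cap B_\rho(z,r)}Pf\,d\mu_\beta$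 for $z\in Z$. *)

(* Defs.v *)
From HB Require Import structures.
From mathcomp Require Import all_boot all_order all_algebra.
From mathcomp Require Import all_classical all_reals all_analysis.
From mathcomp Require Import measurable_realfun.

Set Implicit Arguments.
Unset Strict Implicit.
Unset Printing Implicit Defensive.

Import Order.TTheory GRing.Theory Num.Theory.
Import numFieldTopology.Exports numFieldNormedType.Exports.

Local Open Scope classical_set_scope.
Local Open Scope ring_scope.

(* Pointed because the measurable types of the library are; a space that
   contains a ball is nonempty anyway. *)
#[short(type="completeMetricType")]
HB.structure Definition CompleteMetric (R : numFieldType) :=
  { T of Pointed T & CompletePseudoMetric R T & Metric R T }.

Notation borel_type T := (g_sigma_algebraType (@open T)).

Definition mean {d} {T : measurableType d} {R : realType}
    (mu : set T -> \bar R) (A : set T) (u : T -> \bar R) : \bar R :=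
  ((mu A)^-1 * \int[mu]_(x in A) u x)%E.

(* Distances are extended-real valued: path (pseudo)distances below are infima
   of possibly empty sets. A curve is a map on `[a, b]; its values outside of
   `[a, b] are irrelevant. *)
Section curves.
Context {R : realType} {T : Type} (d : T -> T -> \bar R).
Local Open Scope ereal_scope.

Definition curve_continuous (c : R -> T) (a b : R) :=
  forall t, t \in `[a, b] -> forall e : R, (0 < e)%R ->
    exists2 k : R, (0 < k)%R &
      forall s, s \in `[a, b] -> (`|s - t| < k)%R -> d (c t) (c s) < e%:E.

Definition curve_length (c : R -> T) (a b : R) : \bar R :=
  ereal_sup [set \sum_(0 <= i < size s)
                   d (c (nth b (a :: s) i)) (c (nth b (a :: s) i.+1))
            | s in itv_partition a b].

Definition rectifiable_curve (D : set T) (c : R -> T) (a b : R) :=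
  [/\ (a <= b)%R, (forall t, t \in `[a, b] -> D (c t)),
      curve_continuous c a b & curve_length c a b < +oo].

(* A time at which the arc length from the starting point is [l]; the value of
   the curve does not depend on the choice, so that [c \o arclength_inv c a b]
   is the arc-length parametrization of [c]. *)
Definition arclength_inv (c : R -> T) (a b l : R) : R :=
  xget a [set t | t \in `[a, b] /\ curve_length c a t = l%:E].

Definition line_integral (c : R -> T) (a b : R) (F : T -> \bar R) : \bar R :=
  \int[@lebesgue_measure R]_(l in `[0%R, fine (curve_length c a b)])
    F (c (arclength_inv c a b l)).

End curves.

Section upper_gradient.
Context {R : realType} (Y : completeMetricType R).
Local Open Scope ereal_scope.

Definition upper_gradient (D : set Y) (g u : Y -> \bar R) :=
  [/\ measurable_fun (D : set (borel_type Y)) g,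
      (forall y, D y -> 0 <= g y) &
      forall (c : R -> Y) (a b : R),
        rectifiable_curve (fun x y => (mdist x y)%:E) D c a b ->
        (exists s t, [/\ s \in `[a, b], t \in `[a, b] & c s <> c t]) ->
        let I := line_integral (fun x y => (mdist x y)%:E) c a b g in
        let finite_ends := (u (c a) \is a fin_num) && (u (c b) \is a fin_num) in
        (finite_ends -> `|u (c a) - u (c b)| <= I) /\
        (~~ finite_ends -> I = +oo)].

End upper_gradient.

Section metric_measure_space.
Context {R : realType} {Z : completeMetricType R}.
Variable nu : {outer_measure set Z -> \bar R}.
Local Open Scope ereal_scope.

Definition borel_regular :=
  (forall A : set Z, open A -> nu.-cara.-measurable A) /\
  (forall A : set Z, exists B : set Z,
     [/\ measurable (B : set (borel_type Z)), A `<=` B & nu B = nu A]).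

Definition metric_measure :=
  borel_regular /\ forall (z : Z) (r : R), (0 < r)%R ->
    0 < nu (ball z r) < +oo.

Definition doubling (Cnu : R) :=
  forall (z : Z) (r : R), (0 < r)%R ->
    nu (ball z (2 * r)) <= Cnu%:E * nu (ball z r).

End metric_measure_space.

Section separated.
Context {R : realType} {Z : metricType R}.

Definition separated (e : R) (A : set Z) :=
  forall x y, A x -> A y -> x != y -> e <= mdist x y.

Definition maximal_separated (e : R) (A : set Z) :=
  separated e A /\ forall B, A `<=` B -> separated e B -> B = A.

End separated.

Section hyperbolic_filling.
Context {R : realType} {Z : completeMetricType R}.
Variables (alpha tau : R) (S : int -> set Z).

Notation vertex := (Z * int)%type.

Definition vertices : set vertex := [set v | S v.2 v.1].

Definition vball (v : vertex) : set Z := ball v.1 (tau * alpha ^ (- v.2)).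

Definition filling_edge (v w : vertex) :=
  [/\ vertices v, vertices w, v <> w, `|v.2 - w.2| <= 1 &
      vball v `&` vball w !=set0].

(* A point of the metric graph X is given by its barycentric coordinates with
   respect to the vertices (geometric realization): [edge_pt v w t] is the point
   at distance [t] from [v] on the edge [vw]. *)
Notation point := (vertex -> R).

Definition edge_pt (v w : vertex) (t : R) : point :=
  fun u => (1 - t) * (u == v)%:R + t * (u == w)%:R.

Definition filling : set point :=
  [set x | (exists2 v, vertices v & x = edge_pt v v 0) \/
           (exists v w t, [/\ filling_edge v w, t \in `[0, 1] & x = edge_pt v w t])].

Definition height (x : point) : R := \sum_(u \in [set: vertex]) x u * u.2%:~R.

(* +oo for points that do not lie on a common edge *)
Definition edge_dist (x y : point) : \bar R :=
  ereal_inf [set l | exists v w s t,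
    [/\ filling_edge v w, s \in `[0, 1] /\ t \in `[0, 1],
        x = edge_pt v w s, y = edge_pt v w t & l = `|s - t|%:E]].

Definition graph_dist (x y : point) : \bar R :=
  ereal_inf [set \sum_(0 <= i < size p)
                   edge_dist (nth y (x :: p) i) (nth y (x :: p) i.+1)
            | p in [set p | last x p = y]]%E.

Definition rho (x : point) : R := alpha `^ (- height x).

Definition d_rho (x y : point) : \bar R :=
  ereal_inf [set l | exists (c : R -> point) (a b : R),
    [/\ rectifiable_curve graph_dist filling c a b, c a = x, c b = y &
        l = line_integral graph_dist c a b (EFin \o rho)]].

End hyperbolic_filling.

Section uniformized_filling.
Context {R : realType} {Z : completeMetricType R}.
Variables (alpha tau : R) (S : int -> set Z).
Variables (Y : completeMetricType R) (iota : (Z * int -> R) -> Y).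

Local Notation X := (filling alpha tau S).
Local Notation drho := (d_rho alpha tau S).

(* The completion of (X, d_rho) is characterized up to isometry: a complete
   metric space in which (X, d_rho) embeds isometrically as a dense subset;
   [iota] is irrelevant outside of [X]. *)
Definition uniformized_completion :=
  (forall x y, X x -> X y -> (mdist (iota x) (iota y))%:E = drho x y) /\
  dense (iota @` X).

Definition boundary_identification (j : Z -> Y) :=
  forall (z : Z) (s : nat -> Z),
    (forall n, S n%:Z (s n) /\ mdist (s n) z < alpha ^ (- n%:Z)) ->
    (fun n => iota (edge_pt (s n, n%:Z) (s n, n%:Z) 0)) @ \oo --> j z.

Definition Xpart : set Y := iota @` X.

Definition iota_inv (y : Y) : Z * int -> R :=
  xget (fun=> 0) [set x | X x /\ iota x = y].

Variable nu : {outer_measure set Z -> \bar R}.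
Local Open Scope ereal_scope.

(* The sum is over ordered pairs of adjacent vertices. This and [mu_beta] are
   plain set functions, which is what [integral] takes; they are measures on the
   Borel sets as soon as the edges are continuous in [Y]. *)
Definition filling_measure (A : set (borel_type Y)) : \bar R :=
  \esum_(v in vertices S) \esum_(w in filling_edge alpha tau S v)
    (nu (vball alpha tau v) + nu (vball alpha tau w)) *
    lebesgue_measure
      [set t : R | t \in `[0%R, 1%R] /\ A (iota (edge_pt v w t))].

(* The restriction to [Xpart] makes the boundary a null set. *)
Definition mu_beta (beta : R) (A : set (borel_type Y)) : \bar R :=
  \int[filling_measure]_(y in A `&` Xpart)
    (alpha `^ (- beta * height (iota_inv y)))%:E.

Variables (beta : R) (f : Z -> R).

Definition extension_vertex (v : Z * int) : R :=
  fine (mean (nu : set (caratheodory_type nu) -> _) (vball alpha tau v)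
         (EFin \o f)).

(* The value does not depend on the edge [vw] that is chosen. *)
Definition extension_filling (x : Z * int -> R) : R :=
  xget 0%R [set l | exists v w t,
    [/\ filling_edge alpha tau S v w, t \in `[0%R, 1%R], x = edge_pt v w t &
        l = (extension_vertex v + (extension_vertex w - extension_vertex v) *
             (fine (curve_length drho (edge_pt v w) 0 t) /
              fine (curve_length drho (edge_pt v w) 0 1)))%R]].

Definition extension (y : Y) : \bar R :=
  if y \in Xpart then (extension_filling (iota_inv y))%:E
  else limf_esup (fun r : R => mean (mu_beta beta) (Xpart `&` ball y r)
                    (fun y' => (extension_filling (iota_inv y'))%:E)) 0^'+.

End uniformized_filling.

(* Here [d] is the distance on [Z] induced by d_rho, and not the given one. *)
Section besov.
Context {R : realType} {Z : completeMetricType R}.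
Variables (nu : {outer_measure set Z -> \bar R}) (d : Z -> Z -> R) (p theta : R).
Local Open Scope ereal_scope.

Definition dball (z : Z) (r : R) : set Z := [set x | (d z x < r)%R].

(* On the diagonal the integrand is 0, since 0 * +oo = 0 in \bar R. *)
Definition besov_energy (f : Z -> R) : \bar R :=
  \int[nu : set (caratheodory_type nu) -> _]_y
  \int[nu : set (caratheodory_type nu) -> _]_x
    ((`|f x - f y| `^ p / d x y `^ (p * theta))%:E
     * (nu (dball x (d x y)))^-1).

Definition besov_space : set (Z -> R) :=
  [set f : Z -> R | [/\
      measurable_fun [set: caratheodory_type nu] (f : caratheodory_type nu -> R),
      (forall z r, (0 < r)%R ->
         \int[nu : set (caratheodory_type nu) -> _]_(x in dball z r)
           (`|f x| `^ p)%:E < +oo) &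
      besov_energy f < +oo]].

End besov.

(* Main.v *)
(** Let [c] be the value of [Pf] at a vertex near the center of the ball and at
    the scale of its radius [r]. A vertex [v] at a lower scale is joined to that
    vertex by a chain with one edge per level. Across an edge [Pf] changes by at
    most the integral of [g], so by Jensen's inequality the p-th power of the
    change is bounded by the integral of [g^p] over the edge; since [beta < p],
    Hölder's inequality with geometric weights along the chains gives
      sum of nu(B(v)) |Pf(v) - c|^p over the vertices v of level n near the ball
        <= C r^(p - beta) * (integral of g^p over the dilated ball),
    uniformly in n. On the one hand, the finite Besov energy makes the sum of the
    integrals of |f - Pf(v)|^p over the balls B(v) of level n tend to 0, whence
    the same bound for the integral of |f - c|^p. On the other hand, summing over
    the levels with the weights alpha^(-beta n) bounds the integral of
    |Pf - c|^p with respect to mu_beta, so that c may be replaced by the mean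
    of [Pf]. Finally mu_beta of a ball of radius [r] centered on the boundary is
    comparable to r^beta times its nu-measure. *)

(* [Y] is only known to contain [X] densely and isometrically, so lower bounds on its distance come
   from test functions: a function of the vertices whose increment along every edge is at most a
   multiple of the smallest value of [rho] there extends affinely to a function that is Lipschitz
   for [d_rho]. Such functions compare the two metrics of [Z] and locate the edges that meet a ball
   centered on the boundary. Both [g] and [mu_beta] are handled edge by edge. The upper gradient
   inequality is applied to single edges only, and since [height] varies by at most 1 along an edge,
   integrals against [mu_beta] are, up to powers of [alpha], weighted sums of Lebesgue integrals
   over edges. The dilation [C] is what the chains require: with a level [m] such that
   [alpha ^ (- m)] is comparable to the radius, all their edges stay within a fixed multiple of
   [alpha ^ (- m)] of the center, and all factors depend on [alpha] and [tau] only. That [tau]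
   exceeds 3 makes the vertex above the center adjacent to the tops of the other chains. The Besov
   energy enters by its finiteness alone and leaves no trace in [C1]. *)
Require Import Defs.
From HB Require Import structures.
From mathcomp Require Import all_boot all_order all_algebra.
From mathcomp Require Import all_classical all_reals all_analysis.
From mathcomp Require Import measurable_realfun.
From mathcomp Require Import ring lra.

Set Implicit Arguments.
Unset Strict Implicit.
Unset Printing Implicit Defensive.

Import Order.TTheory GRing.Theory Num.Theory.
Import numFieldTopology.Exports numFieldNormedType.Exports.

Local Open Scope classical_set_scope.
Local Open Scope ring_scope.

(** * Integrals of nonnegative functions *)

(* The integral of a nonnegative function, measurable or not, is the supremum of
   the integrals of the simple functions below it. *)
Section integral_nonmeasurable.
Local Open Scope ereal_scope.
Context d (T : measurableType d) (R : realType).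
Implicit Types (D : set T) (f g : T -> \bar R).
Import HBNNSimple.

Lemma ge0_le_integral_nm (mu : {measure set T -> \bar R}) D f g :
  (forall x, D x -> 0 <= f x) -> (forall x, D x -> f x <= g x) ->
  \int[mu]_(x in D) f x <= \int[mu]_(x in D) g x.
Proof.
move=> f0 fg; rewrite !ge0_integralE//; last first.
  by move=> x Dx; exact: le_trans (f0 _ Dx) (fg _ Dx).
apply: ereal_sup_le => _ [h /= hf <-]; exists h => //= x.
apply: le_trans (hf x) _; rewrite /patch; case: ifPn => //.
by rewrite inE => /fg.
Qed.

Lemma ge0_integral_patch (mu : {measure set T -> \bar R}) D E f :
  (forall x, D x -> 0 <= f x) ->
  \int[mu]_(x in E) (f \_ D) x = \int[mu]_(x in E `&` D) f x.
Proof.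
move=> f0; have p0 x : 0 <= (f \_ D) x.
  by rewrite /patch; case: ifPn => //; rewrite inE => /f0.
rewrite !ge0_integralE//; last by move=> x [_ /f0].
suff -> : (f \_ D) \_ E = f \_ (E `&` D) by [].
by apply/funext => x; rewrite /patch in_setI; case: (x \in E).
Qed.

Lemma ge0_subset_integral_nm (mu : {measure set T -> \bar R}) D E f :
  (forall x, E x -> 0 <= f x) -> D `<=` E ->
  \int[mu]_(x in D) f x <= \int[mu]_(x in E) f x.
Proof.
move=> f0 DE; rewrite !ge0_integralE//; last by move=> x /DE/f0.
apply: ereal_sup_le => _ [h /= hf <-]; exists h => //= x.
apply: le_trans (hf x) _; rewrite /patch; case: ifPn => //.
  by rewrite inE => /DE Ex; rewrite mem_set.
by move=> _; case: ifPn => //; rewrite inE => /f0.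
Qed.

(** The comparison holds for each simple function below [f], and the integral is the supremum over
    these for either measure. It serves to compare [mu_beta] with sums over edges, and the
    distribution of an arc-length parametrization with Lebesgue measure. *)
Lemma ge0_le_measure_integral (m1 m2 : {measure set T -> \bar R}) D f :
  (forall A, measurable A -> m1 A <= m2 A) ->
  (forall x, D x -> 0 <= f x) ->
  \int[m1]_(x in D) f x <= \int[m2]_(x in D) f x.
Proof.
move=> m12 f0; rewrite !ge0_integralE//.
apply: ge_ereal_sup => _ [h /= hf <-].
have : sintegral m2 h <= ereal_sup [set sintegral m2 h | h in
  [set h : {nnsfun T >-> R} | forall x, (h x)%:E <= (f \_ D) x]].
  by apply: ereal_sup_ubound; exists h.
apply: le_trans; rewrite /sintegral.
(* The two sums are finitely supported, but the supports depend on the measure; the range of [h]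
   serves for both. *)
rewrite !(fsbigTE (fset_set (range h)))//=.
- by apply: lee_sum => x _; case: (ltP x 0%R) => [x0|x0];
    [rewrite !preimage_nnfun0// !measure0|rewrite lee_wpmul2l ?lee_fin// m12].
- move=> x; rewrite in_fset_set// notin_setE => hx.
  by rewrite preimage10 ?measure0 ?mule0// => -[y _ hy]; apply: hx; exists y.
- move=> x; rewrite in_fset_set// notin_setE => hx.
  by rewrite preimage10 ?measure0 ?mule0// => -[y _ hy]; apply: hx; exists y.
Qed.

(** A simple function below [f] can be cut off outside [X] without changing its integral. This is
    how the boundary, where the extension is an upper limit, disappears from the mean of the
    extension. *)
Lemma integral_full_measure (mu : {measure set T -> \bar R}) D X f :
  measurable X -> mu (~` X) = 0 ->
  \int[mu]_(x in D) f x = \int[mu]_(x in D `&` X) f x.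
Proof.
move=> mX mu0.
have ge0 D' g : (forall x, D' x -> 0 <= g x) ->
    \int[mu]_(x in D') g x = \int[mu]_(x in D' `&` X) g x.
  move=> g0; apply/eqP; rewrite eq_le; apply/andP; split; last first.
    exact: ge0_subset_integral_nm.
  rewrite [leLHS]ge0_integralE//; apply: ge_ereal_sup => _ [h /= hg <-].
  have -> : sintegral mu h = \int[mu]_(x in setT) (h x)%:E.
    by rewrite integral_nnsfun// patch_setT.
  rewrite (ge0_negligible_integral (N := ~` X))//; first last.
  - by move=> x _; rewrite lee_fin.
  - exact: measurableT_comp.
  - exact: measurableC.
  rewrite setTD setCK setIC -ge0_integral_patch//.
  by apply: ge0_le_integral_nm => x _; rewrite ?lee_fin.
rewrite [LHS]integralE [RHS]integralE ge0; last by move=> ? _; exact: funepos_ge0.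
by rewrite (ge0 _ f^\-)//; move=> ? _; exact: funeneg_ge0.
Qed.

(** The step function with value [c i] on [D i] lies below [f]. This one fact gives the packing
    bound for nets, the lower Riemann sums of line integrals and the lower bound on the Besov
    energy. *)
Lemma sum_cst_le_integral (mu : {measure set T -> \bar R}) (I : eqType)
    (s : seq I) (D : I -> set T) (c : I -> \bar R) D0 f :
  uniq s -> (forall i, i \in s -> measurable (D i)) ->
  (forall i, i \in s -> D i `<=` D0) ->
  (forall i j x, i \in s -> j \in s -> D i x -> D j x -> i = j) ->
  (forall i, i \in s -> 0 <= c i) ->
  (forall x, D0 x -> 0 <= f x) ->
  (forall i x, i \in s -> D i x -> c i <= f x) ->
  \sum_(i <- s) c i * mu (D i) <= \int[mu]_(x in D0) f x.
Proof.
move=> us mD DD0 dD c0 f0 cf.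
(* Nothing is known of [c] and [D] off [s]; the replacements are nonnegative and measurable at every
   index. *)
pose c' i := if i \in s then c i else 0.
pose D' i := if i \in s then D i else set0.
have c'0 i : 0 <= c' i by rewrite /c'; case: ifPn => // /c0.
have mD' i : measurable (D' i) by rewrite /D'; case: ifPn => // /mD.
have -> : \sum_(i <- s) c i * mu (D i) =
    \int[mu]_x \sum_(i <- s) c' i * (\1_(D' i) x)%:E.
  rewrite ge0_integral_sum//; last first.
  - by move=> i x _; rewrite mule_ge0// lee_fin.
  - move=> i; apply: measurable_funeM.
    by apply/measurable_EFinP; exact: measurable_indic.
  apply: eq_big_seq => i si.
  rewrite ge0_integralZl//; last exact/measurable_EFinP/measurable_indic.
  by rewrite integral_indic// setIT /c' /D' si.
rewrite -(setTI D0) -ge0_integral_patch//; apply: ge0_le_integral_nm => x _.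
  by apply: sume_ge0 => i _; rewrite mule_ge0// lee_fin.
have p0 : 0 <= (f \_ D0) x.
  by rewrite /patch; case: ifPn => //; rewrite inE => /f0.
have [[i si Dix]|nD] := pselect (exists2 i, i \in s & D i x); last first.
  rewrite big_seq big1// => i si; rewrite /D' si indicE memNset ?mule0// => Dix.
  by apply: nD; exists i.
rewrite (bigD1_seq i)//= big1_seq ?adde0; last first.
  move=> j /andP[ji sj]; rewrite /D' sj indicE memNset ?mule0// => Djx.
  by rewrite (dD _ _ _ sj si Djx Dix) eqxx in ji.
rewrite /c' /D' si indicE mem_set// mule1 /patch mem_set; last exact: DD0 Dix.
exact: cf.
Qed.

End integral_nonmeasurable.

Lemma lee_poweR (R : realType) (r : R) (x y : \bar R) :
  0 <= r -> (0 <= x -> x <= y -> x `^ r <= y `^ r)%E.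
Proof.
move=> r0 x0 xy; apply: gt0_ler_poweR => //; rewrite ?in_itv/= ?leey ?andbT//.
exact: le_trans xy.
Qed.

Section weak_jensen.
Local Open Scope ereal_scope.
Context d (T : measurableType d) (R : realType).
Variable mu : {measure set T -> \bar R}.

(* Jensen's inequality up to the factor [2 `^ p]: integrate
   [u <= s + s `^ (1 - p) * u `^ p] with [V * s `^ p] the integral of [u `^ p]. *)
Lemma weak_jensen (D : set T) (u : T -> \bar R) (p V : R) : (1 <= p)%R ->
  measurable D -> mu D = V%:E -> (0 < V)%R ->
  measurable_fun D u -> (forall x, D x -> 0 <= u x) ->
  (\int[mu]_(x in D) u x) `^ p <=
  (2 `^ p * V `^ (p - 1))%:E * \int[mu]_(x in D) u x `^ p.
Proof.
move=> p1 mD muD V0 mu_u u0.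
have p0 : (0 < p)%R by rewrite (lt_le_trans _ p1).
have K0 : (0 < 2 `^ p * V `^ (p - 1))%R by rewrite mulr_gt0// powR_gt0.
have mup : measurable_fun D (fun x => u x `^ p) 
  by exact: (measurableT_comp (measurable_poweR _)).
have W0 : 0 <= \int[mu]_(x in D) u x `^ p.
  by apply: integral_ge0 => x _; exact: poweR_ge0.
case W : (\int[mu]_(x in D) u x `^ p) W0 => [w| |]; last by [].
- rewrite lee_fin => w0.
  apply/lee_addgt0Pr => e e0.
  (* The perturbation keeps [s] positive even when the integral of the p-th power vanishes. *)
  pose w' := (w + e / (2 `^ p * V `^ (p - 1)))%R.
  have w'0 : (0 < w')%R by rewrite ltr_wpDl// divr_gt0.
  have -> : (2 `^ p * V `^ (p - 1))%:E * w%:E + e%:E =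
      (2 `^ p * V `^ (p - 1) * w')%:E.
    by rewrite -EFinM -EFinD /w' mulrDr mulrCA divff ?mulr1// gt_eqF.
  pose s := ((w' / V) `^ p^-1)%R.
  have s0 : (0 < s)%R by rewrite powR_gt0// divr_gt0.
  have sp : (s `^ p = w' / V)%R.
    by rewrite /s -powRrM mulVf ?gt_eqF// powRr1// ltW// divr_gt0.
  have : \int[mu]_(x in D) u x <=
      \int[mu]_(x in D) (s%:E + (s `^ (1 - p))%:E * u x `^ p).
    apply: ge0_le_integral_nm => // x Dx.
    have := u0 _ Dx; case: (u x) => [y| |]//.
      rewrite lee_fin => y0; rewrite poweR_EFin -EFinM -EFinD lee_fin.
      have [ys|sy] := leP y s; first by rewrite (le_trans ys)// lerDl mulr_ge0 ?powR_ge0.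
      have yp0 : (0 < y)%R by exact: lt_trans sy.
      rewrite -[leLHS]add0r lerD ?(ltW s0)//.
      rewrite -[leLHS](powRr1 y0) -{1}(subrK p 1%R) powRD; last first.
        by rewrite subrK oner_eq0.
      rewrite ler_wpM2r ?powR_ge0//.
      rewrite -[(1 - p)%R]opprB !powRN lef_pV2 ?posrE ?powR_gt0 ?divr_gt0//.
      by rewrite ge0_ler_powR ?nnegrE ?subr_ge0 ?(ltW s0) ?(ltW yp0) ?(ltW sy).
    by move=> _; rewrite poweRyr ?gt_eqF// gt0_muley ?lte_fin ?powR_gt0 ?divr_gt0// addey.
  move/le_trans => /(_ (2 * s * V)%:E) H.
  have {}H : \int[mu]_(x in D) u x <= (2 * s * V)%:E.
    apply: H; rewrite ge0_integralD//; last first.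
    - by apply: measurable_funeM.
    - by move=> x _; rewrite mule_ge0// ?poweR_ge0// lee_fin powR_ge0.
    - by move=> x _; rewrite lee_fin ltW.
    rewrite integral_cst// muD ge0_integralZl_EFin ?powR_ge0//; last first.
      by move=> x _; rewrite poweR_ge0.
    rewrite W -!EFinM -EFinD lee_fin.
    rewrite -mulrA mulr_natl mulr2n lerD2l.
    have -> : (s `^ (1 - p) = s * (V / w'))%R.
      rewrite powRB; last by rewrite (gt_eqF s0) implybT.
      by rewrite sp invf_div powRr1 ?(ltW s0).
    rewrite -mulrA ler_wpM2l ?(ltW s0)//.
    by rewrite mulrAC ler_pdivrMr// ler_wpM2l ?(ltW V0)// /w' lerDl ltW// divr_gt0.
  apply: (@le_trans _ _ ((2 * s * V)%:E `^ p)).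
    by apply: lee_poweR => //; [exact: ltW|exact: integral_ge0].
  rewrite poweR_EFin lee_fin !powRM ?mulr_ge0 ?(ltW s0) ?(ltW V0)// sp.
  rewrite -(mulr_powRB1 (ltW V0) p0) le_eqVlt; apply/orP; left; apply/eqP.
  by field; rewrite gt_eqF.
- by move=> _; rewrite gt0_muley ?lte_fin// leey.
Qed.

End weak_jensen.

Lemma esumZl (R : realType) (I : choiceType) (E : set I) (k : R)
    (a : I -> \bar R) : ((0 <= k)%R -> (forall i, E i -> 0 <= a i) ->
  \esum_(i in E) (k%:E * a i) = k%:E * \esum_(i in E) a i)%E.
Proof.
move=> k0 a0.
have le_esumZl (c : R) (b : I -> \bar R) : (0 <= c)%R ->
    (forall i, E i -> 0 <= b i)%E ->
    (\esum_(i in E) (c%:E * b i) <= c%:E * \esum_(i in E) b i)%E.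
  move=> c0 b0; apply: ge_ereal_sup => _ [F [finF FE] <-].
  rewrite !fsbig_finite//= big_seq -ge0_sume_distrr; last first.
    by move=> i; rewrite in_fset_set// inE => /FE/b0.
  rewrite -big_seq lee_wpmul2l ?lee_fin//.
  by apply: ereal_sup_ubound; exists F => //; rewrite fsbig_finite.
apply/eqP; rewrite eq_le le_esumZl//=.
have [->|kn0] := eqVneq k 0%R.
  by rewrite mul0e; apply: esum_ge0 => i _; rewrite mul0e.
have {}k0 : (0 < k)%R by rewrite lt_neqAle eq_sym kn0.
have {1}-> : \esum_(i in E) a i = \esum_(i in E) (k^-1%:E * (k%:E * a i))%E.
  by apply: eq_esum => i _; rewrite muleA -EFinM mulVf ?gt_eqF// mul1e.
apply: (@le_trans _ _ (k%:E * (k^-1%:E * \esum_(i in E) (k%:E * a i))))%E.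
  rewrite lee_wpmul2l ?lee_fin ?(ltW k0)// le_esumZl ?invr_ge0 ?(ltW k0)//.
  by move=> i Ei; rewrite mule_ge0 ?lee_fin ?(ltW k0)// a0.
by rewrite muleA -EFinM divff ?gt_eqF// mul1e.
Qed.

(** * Sums of families of measures *)

Section esum_measure.
Local Open Scope ereal_scope.
Context d (T : measurableType d) (R : realType) (I : choiceType).
Import HBNNSimple.
Variables (E : set I) (m : I -> {measure set T -> \bar R}).

Definition esum_measure (A : set T) : \bar R := \esum_(i in E) m i A.

Let esum_measure0 : esum_measure set0 = 0.
Proof. by rewrite /esum_measure esum1// => i _; rewrite measure0. Qed.

Let esum_measure_ge0 A : 0 <= esum_measure A.
Proof. by apply: esum_ge0 => i _; exact: measure_ge0. Qed.

Let esum_measure_sigma_additive : semi_sigma_additive esum_measure.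
Proof.
move=> F mF tF mUF; have -> : esum_measure (\bigcup_n F n) =
    \sum_(0 <= n <oo) esum_measure (F n).
  rewrite nneseries_esumT; last by move=> n; exact: esum_measure_ge0.
  rewrite esum_esum; last by move=> n i _ _; exact: measure_ge0.
  rewrite (reindex_esum (E `*` [set: nat]) _ (fun x => (x.2, x.1))); last first.
    split=> [[i n] [/= Ei _]//|[i n] [j k] _ _ [-> ->]//|[n i] [/= _ Ei]].
    by exists (i, n).
  rewrite /= -(esum_esum (J := fun=> setT) (a := fun i n => m i (F n)))//.
  apply: eq_esum => i _; rewrite -nneseries_esumT//.
  by rewrite measure_bigcup//; apply: eq_eseriesl => k; rewrite in_setT.
apply: is_cvg_nneseries => n _ _; exact: esum_measure_ge0.
Qed.

HB.instance Definition _ := isMeasure.Build d T R esum_measure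
  esum_measure0 esum_measure_ge0 esum_measure_sigma_additive.

(** For the upper bound, the sum over the family is exchanged with the finite sum that integrates a
    simple function. For the lower bound, every finite subfamily sums to a measure below
    [esum_measure]. *)
Lemma ge0_integral_esum_measure (D : set T) (f : T -> \bar R) :
  measurable D -> measurable_fun D f -> (forall x, D x -> 0 <= f x) ->
  \int[esum_measure]_(x in D) f x = \esum_(i in E) \int[m i]_(x in D) f x.
Proof.
move=> mD mf f0; apply/eqP; rewrite eq_le; apply/andP; split.
  rewrite ge0_integralE//; apply: ge_ereal_sup => _ [h /= hf <-].
  have -> : sintegral esum_measure h = \esum_(i in E) sintegral (m i) h.
    rewrite sintegralE fsbig_finite//=.
    under eq_esum do rewrite sintegralE fsbig_finite//=.
    rewrite esum_sum; last first.
      move=> i x Ei _; case: (ltP x 0%R) => x0.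
        by rewrite preimage_nnfun0// measure0 mule0.
      by rewrite mule_ge0.
    apply: eq_bigr => x _; case: (ltP x 0%R) => x0.
      rewrite preimage_nnfun0// measure0 mule0 esum1// => i _.
      by rewrite measure0 mule0.
    by rewrite esumZl// lee_fin.
  apply: le_esum => i _; rewrite ge0_integralE//.
  by apply: ereal_sup_ubound; exists h.
apply: ge_ereal_sup => _ [/= F [finF FE] <-].
rewrite fsbig_finite//=; set s : seq I := finmap.enum_fset _.
have us : uniq s by exact: finmap.fset_uniq.
have sE i : i \in s -> E i by rewrite in_fset_set// inE => /FE.
case: s us sE => [|i0 s]; first by rewrite big_nil integral_ge0.
move=> us sE; rewrite (big_nth i0) big_mkord.
rewrite -(ge0_integral_measure_sum (fun k => m (nth i0 (i0 :: s) k)))//.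
apply: ge0_le_measure_integral => // A mA; rewrite /msum/=.
apply: esum_ge; exists [set` i0 :: s].
  by split => [|i /= /sE//]; exact: finite_seq.
rewrite -fsbig_seq// [leRHS](big_nth i0) big_mkord.
done.
Qed.

End esum_measure.

(** * Length of curves *)

Section curve_length_theory.
Context {R : realType} {T : Type} (d : T -> T -> \bar R).
Local Open Scope ereal_scope.

(** An extended pseudometric: the common ground of [graph_dist], which may be infinite, and of the
    distance of [Y]. *)
Definition edist := [/\ forall x, d x x = 0, forall x y, 0 <= d x y,
  forall x y, d x y = d y x & forall x y z, d x z <= d x y + d y z].

Fixpoint polygon_length (c : R -> T) (x : R) (s : seq R) : \bar R :=
  if s is y :: s' then d (c x) (c y) + polygon_length c y s' else 0.

Lemma polygon_lengthE c b x s :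
  \sum_(0 <= i < size s) d (c (nth b (x :: s) i)) (c (nth b (x :: s) i.+1))
  = polygon_length c x s.
Proof.
elim: s x => [|y s ih] x; first by rewrite big_nil.
by rewrite big_nat_recl//= ih.
Qed.

Lemma curve_lengthE c a b :
  curve_length d c a b =
  ereal_sup [set polygon_length c a s | s in itv_partition a b].
Proof.
congr ereal_sup; apply: eq_imagel => s _; exact: polygon_lengthE.
Qed.

Lemma eq_polygon_length c c' x s :
  (forall y, y \in x :: s -> c y = c' y) ->
  polygon_length c x s = polygon_length c' x s.
Proof.
elim: s x => [//|y s ih] x cc' /=.
rewrite !cc' ?mem_head//; last by rewrite !inE eqxx orbT.
by rewrite ih// => z zs; rewrite cc'// inE zs orbT.
Qed.

Lemma polygon_length_cat c x s1 s2 :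
  polygon_length c x (s1 ++ s2) =
  polygon_length c x s1 + polygon_length c (last x s1) s2.
Proof. by elim: s1 x => [|y s1 ih] x; rewrite ?add0e//= ih addeA. Qed.

Lemma itv_partition_mem (a b y : R) s :
  itv_partition a b s -> y \in a :: s -> y \in `[a, b].
Proof.
move=> abs /(nthP b)[i il <-]; rewrite in_itv/= (itv_partition_nth_ge _ abs)//.
exact: (itv_partition_nth_le _ abs).
Qed.

Lemma itv_partition_ex (a b : R) : (a <= b)%R -> exists s, itv_partition a b s.
Proof.
rewrite le_eqVlt => /predU1P[->|ab]; first by exists [::]; split => /=.
by exists [:: b]; exact: itv_partition1.
Qed.

Hypothesis hd : edist.
Let d_ge0 : forall x y, 0 <= d x y. Proof. by case: hd. Qed.
Let dxx : forall x, d x x = 0. Proof. by case: hd. Qed.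
Let d_sym : forall x y, d x y = d y x. Proof. by case: hd. Qed.
Let d_tri : forall x y z, d x z <= d x y + d y z. Proof. by case: hd. Qed.

Lemma polygon_length_ge0 c x s : 0 <= polygon_length c x s.
Proof. by elim: s x => //= y s ih x; rewrite adde_ge0. Qed.

Lemma polygon_length_le_curve_length c a b s : itv_partition a b s ->
  polygon_length c a s <= curve_length d c a b.
Proof. by move=> abs; rewrite curve_lengthE; apply: ereal_sup_ubound; exists s. Qed.

Lemma curve_length_ge0 c a b : (a <= b)%R -> 0 <= curve_length d c a b.
Proof.
move=> /itv_partition_ex[s abs].
exact: le_trans (polygon_length_ge0 c a s) (polygon_length_le_curve_length _ abs).
Qed.

Lemma dist_le_curve_length c a b : (a <= b)%R ->
  d (c a) (c b) <= curve_length d c a b.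
Proof.
move=> ab; have := ab; rewrite le_eqVlt => /predU1P[<-|{}ab'].
  by rewrite dxx curve_length_ge0.
have := polygon_length_le_curve_length c (itv_partition1 ab').
by rewrite /= adde0.
Qed.

(** Inserting [t] in the partition does not shorten the polygon, by the triangle inequality. *)
Lemma polygon_length_split c a b t s : itv_partition a b s ->
  (a <= t <= b)%R -> exists s1 s2, [/\ itv_partition a t s1,
    itv_partition t b s2 &
    polygon_length c a s <= polygon_length c a s1 + polygon_length c t s2].
Proof.
elim: s a => [|y s ih] a.
  move=> /itv_partition_nil <- /andP[at_ ta].
  have <- : a = t by apply/eqP; rewrite eq_le at_.
  by exists [::], [::]; split => //; rewrite adde0.
move=> abs /andP[+ tb]; rewrite le_eqVlt => /predU1P[<-|at_].
  by exists [::], (y :: s); split => //; rewrite add0e.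
have ybs := itv_partition_cons abs.
have ay : (a < y)%R by case: abs => /=/andP[].
have [yt|ty] := leP y t.
  have [s1 [s2 [ys1 s2b le12]]] := ih _ ybs (introT andP (conj yt tb)).
  exists (y :: s1), s2; split => //.
    by case: ys1 => p1 l1; split => //=; rewrite ay.
  by rewrite /= -addeA leeD2l.
exists [:: t], (y :: s); split => //.
- exact: itv_partition1.
- by case: abs => /= /andP[_ p1] l1; split => //=; rewrite ty.
- by rewrite /= adde0 addeA leeD2r.
Qed.

Lemma curve_lengthD c a t b : (a <= t <= b)%R ->
  curve_length d c a b = curve_length d c a t + curve_length d c t b.
Proof.
move=> /[dup] atb /andP[at_ tb]; apply/eqP; rewrite eq_le; apply/andP; split.
  rewrite [leLHS]curve_lengthE; apply: ge_ereal_sup => _ [s abs <-].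
  have [s1 [s2 [p1 p2 /le_trans]]] := polygon_length_split c abs atb; apply.
  by rewrite leeD// polygon_length_le_curve_length.
have [->|Loo] := eqVneq (curve_length d c a b) +oo; first exact: leey.
have Lfin : curve_length d c a b \is a fin_num.
  by rewrite ge0_fin_numE ?lt_neqAle ?Loo ?leey// curve_length_ge0// (le_trans at_).
have cat_le s1 s2 : itv_partition a t s1 -> itv_partition t b s2 ->
    polygon_length c a s1 + polygon_length c t s2 <= curve_length d c a b.
  move=> p1 p2; have -> : t = last a s1 by case: p1 => _ /eqP.
  rewrite -polygon_length_cat polygon_length_le_curve_length//.
  exact: itv_partition_cat p1 p2.
have [s20 p20] := itv_partition_ex tb.
have fin1 s1 : itv_partition a t s1 -> polygon_length c a s1 \is a fin_num.
  move=> p1; rewrite ge0_fin_numE ?polygon_length_ge0//.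
  apply: le_lt_trans (leeDl _ (polygon_length_ge0 c t s20)) _.
  apply: le_lt_trans (cat_le _ _ p1 p20) _; by rewrite -ge0_fin_numE// curve_length_ge0// (le_trans at_).
have H1 s1 : itv_partition a t s1 ->
    polygon_length c a s1 + curve_length d c t b <= curve_length d c a b.
  move=> p1; rewrite -leeBrDl ?fin1// [leLHS]curve_lengthE.
  by apply: ge_ereal_sup => _ [s2 p2 <-]; rewrite leeBrDl ?fin1// cat_le.
have [s10 p10] := itv_partition_ex at_.
have fin2 : curve_length d c t b \is a fin_num.
  rewrite ge0_fin_numE ?curve_length_ge0//.
  apply: le_lt_trans (leeDr _ (polygon_length_ge0 c a s10)) _.
  apply: le_lt_trans (H1 _ p10) _; by rewrite -ge0_fin_numE// curve_length_ge0// (le_trans at_).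
rewrite -leeBrDr// [leLHS]curve_lengthE.
by apply: ge_ereal_sup => _ [s1 p1 <-]; rewrite leeBrDr// H1.
Qed.

Lemma curve_length_xx c a : curve_length d c a a = 0.
Proof.
rewrite curve_lengthE; apply/eqP; rewrite eq_le; apply/andP; split.
  by apply: ge_ereal_sup => _ [s /itv_partitionxx -> <-].
by apply: ereal_sup_ubound; exists [::].
Qed.

Lemma curve_length_reverse c k a b : (a <= b)%R ->
  curve_length d (fun t => c (k - t)%R) (k - b)%R (k - a)%R = curve_length d c a b.
Proof.
have le_rev c' a' b' : (a' <= b')%R -> curve_length d c' a' b' <=
    curve_length d (fun t => c' (k - t)%R) (k - b')%R (k - a')%R.
  move=> ab; rewrite curve_lengthE; apply: ge_ereal_sup => _ [s abs <-] {ab}.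
  elim: s a' abs => [|y s ih] a' abs /=.
    by rewrite curve_length_ge0// lerD2l lerN2 (itv_partition_nil abs).
  have ybs := itv_partition_cons abs.
  have ay : (a' <= y)%R by case: abs => /=/andP[/ltW].
  have yb := itv_partition_le ybs.
  rewrite (@curve_lengthD _ _ (k - y)%R) ?lerD2l ?lerN2 ?yb ?ay//.
  rewrite addeC leeD ?ih// d_sym.
  have := @dist_le_curve_length (fun t => c' (k - t)%R) (k - y)%R (k - a')%R.
  by rewrite !subKr; apply; rewrite lerD2l lerN2.
move=> ab; apply/eqP; rewrite eq_le le_rev// andbT.
have := @le_rev (fun t => c (k - t)%R) (k - b)%R (k - a)%R.
rewrite lerD2l lerN2 !subKr => /(_ ab) /le_trans; apply.
rewrite !curve_lengthE le_eqVlt; apply/orP; left; apply/eqP.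
congr ereal_sup; apply: eq_imagel => s _; apply: eq_polygon_length => y _.
by rewrite subKr.
Qed.


Lemma curve_length_fin_num c a b s t : curve_length d c a b < +oo ->
  (a <= s)%R -> (s <= t)%R -> (t <= b)%R -> curve_length d c s t \is a fin_num.
Proof.
move=> Lfin as_ st tb; rewrite ge0_fin_numE ?curve_length_ge0//.
apply: le_lt_trans Lfin; rewrite (@curve_lengthD c a s b) ?as_ ?(le_trans st)//.
rewrite (@curve_lengthD c s t b) ?st// addeCA.
by rewrite leeDl// adde_ge0// curve_length_ge0// (le_trans as_, le_trans st).
Qed.

(** Take a partition of [[t, b]] whose polygon falls short of the length by less than [e / 2]. If
    [s] precedes its first point and [c s] is [e / 2]-close to [c t], then starting the polygon at
    [s] loses at most another [e / 2], so the part from [s] to [b] already has almost the full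
    length. *)
Lemma curve_length_right_small c a b t (e : R) :
  curve_continuous d c a b -> curve_length d c a b < +oo -> t \in `[a, b] ->
  (0 < e)%R -> exists2 k : R, (0 < k)%R &
  forall s, (t <= s <= b)%R -> (s < t + k)%R -> curve_length d c t s < e%:E.
Proof.
move=> cc Lfin /[dup] tab; rewrite in_itv/= => /andP[at_ tb] e0.
have := tb; rewrite le_eqVlt => /predU1P[tb'|tb'].
  exists 1%R => // s; rewrite tb' => /andP[bs sb] _.
  have -> : s = b by apply/eqP; rewrite eq_le sb.
  by rewrite curve_length_xx.
have Ltb : curve_length d c t b \is a fin_num.
  exact: curve_length_fin_num Lfin _ _ _.
have e20 : (0 < e / 2)%R by rewrite divr_gt0.
have : ereal_sup [set polygon_length c t s | s in itv_partition t b] \is a fin_num.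
  by rewrite -curve_lengthE.
move=> /(ub_ereal_sup_adherent e20)[_ [[|y s'] ps <-]].
  by rewrite (itv_partition_nil ps) ltxx in tb'.
rewrite -curve_lengthE /= => H.
have [k0 k00 Hk] := cc _ tab _ e20.
have ty : (t < y)%R by case: ps => /=/andP[].
have ybs := itv_partition_cons ps.
exists (Num.min k0 (y - t))%R; first by rewrite lt_min k00 subr_gt0.
move=> s /andP[ts sb]; have := ts; rewrite le_eqVlt => /predU1P[<- _|{}ts'].
  by rewrite curve_length_xx.
rewrite -ltrBlDl lt_min => /andP[sk0 syt].
have sy : (s < y)%R by rewrite ltrBlDr subrK in syt.
have psb : itv_partition s b (y :: s').
  by case: ybs => p1 l1; split => //=; rewrite sy.
have Lsb : curve_length d c s b \is a fin_num.
  by apply: curve_length_fin_num Lfin _ _ _ => //; exact: le_trans ts.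
have dts : d (c t) (c s) < (e / 2)%:E.
  by apply: Hk; [rewrite in_itv/= sb (le_trans at_)|rewrite ger0_norm// subr_ge0].
rewrite -(lteD2rE _ _ Lsb) -(@curve_lengthD c t s b) ?ts//.
rewrite EFinN lteBlDr// in H; apply: lt_le_trans H _.
rewrite {2}(splitr e) EFinD [leRHS]addeAC leeD2r//.
apply: (@le_trans _ _ (d (c t) (c s) + (d (c s) (c y) + polygon_length c y s'))).
  by rewrite addeA leeD2r.
by apply: leeD; [exact: ltW|exact: (polygon_length_le_curve_length c psb)].
Qed.

(** The previous lemma for the curve run backwards. *)
Lemma curve_length_left_small c a b t (e : R) :
  curve_continuous d c a b -> curve_length d c a b < +oo -> t \in `[a, b] ->
  (0 < e)%R -> exists2 k : R, (0 < k)%R &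
  forall s, (a <= s <= t)%R -> (t - k < s)%R -> curve_length d c s t < e%:E.
Proof.
move=> cc Lfin; rewrite in_itv/= => /andP[at_ tb] e0.
have ab := le_trans at_ tb.
have cc' : curve_continuous d (fun u => c (0 - u)%R) (0 - b)%R (0 - a)%R.
  move=> u; rewrite in_itv/= => /andP[bu ua] e' e'0.
  have [|k k0 Hk] := cc (0 - u)%R _ _ e'0.
    by rewrite in_itv/=; apply/andP; split; lra.
  exists k => // s; rewrite in_itv/= => /andP[bs sa] su; apply: Hk.
    by rewrite in_itv/=; apply/andP; split; lra.
  by rewrite (_ : 0 - s - (0 - u) = - (s - u))%R ?normrN//; lra.
have [|||k k0 Hk] := @curve_length_right_small _ _ _ (0 - t)%R e cc'.
- by rewrite curve_length_reverse.
- by rewrite in_itv/=; apply/andP; split; lra.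
- exact: e0.
exists k => // s /andP[as_ st] tks.
rewrite -(curve_length_reverse c 0 st); apply: Hk; last lra.
by apply/andP; split; lra.
Qed.

Lemma fine_curve_lengthB c a b s t : curve_length d c a b < +oo ->
  (a <= s)%R -> (s <= t)%R -> (t <= b)%R ->
  curve_length d c s t =
    (fine (curve_length d c a t) - fine (curve_length d c a s))%:E.
Proof.
move=> Lfin as_ st tb.
have at_ := le_trans as_ st.
have Las := curve_length_fin_num Lfin (lexx _) as_ (le_trans st tb).
have Lst := curve_length_fin_num Lfin as_ st tb.
rewrite (@curve_lengthD c a s t) ?as_// fineD//.
by rewrite addrAC subrr add0r fineK.
Qed.

Lemma continuous_curve_length c a b :
  (a <= b)%R -> curve_continuous d c a b -> curve_length d c a b < +oo ->
  {within `[a, b]%classic, continuous (fun t => fine (curve_length d c a t))}.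
Proof.
move=> ab cc Lfin; apply/subspace_continuousP => t /=; rewrite set_itvE/= => tab.
have /andP[at_ tb] : (a <= t <= b)%R by move: tab; rewrite in_itv.
apply/cvgrPdist_lt => e e0.
have [k1 k10 H1] := curve_length_right_small cc Lfin tab e0.
have [k2 k20 H2] := curve_length_left_small cc Lfin tab e0.
rewrite near_withinE /from_subspace; near=> s => /andP[as_ sb].
have : (`|t - s| < Num.min k1 k2)%R.
  by near: s; apply: cvgr_dist_lt => //; rewrite lt_min k10.
rewrite lt_min => /andP[/ltr_normlP[h1 _] /ltr_normlP[_ h2]].
rewrite -lte_fin; have [ts|/ltW st] := leP t s.
  rewrite distrC ger0_norm; last first.
    rewrite -lee_fin -(fine_curve_lengthB Lfin at_ ts sb) curve_length_ge0//.
  rewrite -(fine_curve_lengthB Lfin at_ ts sb); apply: H1; [by rewrite ts|lra].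
rewrite ger0_norm; last first.
  by rewrite -lee_fin -(fine_curve_lengthB Lfin as_ st tb) curve_length_ge0.
by rewrite -(fine_curve_lengthB Lfin as_ st tb); apply: H2; [rewrite as_|lra].
Unshelve. all: by end_near. Qed.

Lemma arclength_inv_surj c a b (l : R) :
  (a <= b)%R -> curve_continuous d c a b -> curve_length d c a b < +oo ->
  (0 <= l <= fine (curve_length d c a b))%R ->
  exists2 t, t \in `[a, b] & curve_length d c a t = l%:E.
Proof.
move=> ab cc Lfin l0L.
pose f t := fine (curve_length d c a t).
have fa : f a = 0%R by rewrite /f curve_length_xx.
have fb : (0 <= f b)%R by rewrite -lee_fin fineK ?curve_length_ge0// (curve_length_fin_num Lfin).
have [||t tab ft] := @IVT R f a b l ab.
- exact: continuous_curve_length.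
- by rewrite fa min_l// max_r.
exists t => //; move: tab; rewrite in_itv/= => /andP[at_ tb].
by rewrite -ft fineK// (curve_length_fin_num Lfin).
Qed.

(** * Arc-length parametrization *)

Section arclength.
Variables (c : R -> T) (a b : R).
Hypotheses (ab : (a <= b)%R) (cc : curve_continuous d c a b)
  (Lfin : curve_length d c a b < +oo).
Let L := fine (curve_length d c a b).
Let tau := arclength_inv d c a b.

Lemma arclength_inv_itv l : tau l \in `[a, b].
Proof.
rewrite /tau /arclength_inv; case: xgetP => [t _ []//|_].
by rewrite in_itv/= lexx.
Qed.

Lemma arclength_invK l : (0 <= l <= L)%R -> curve_length d c a (tau l) = l%:E.
Proof.
move=> l0L; have [t tab Lt] := arclength_inv_surj ab cc Lfin l0L.
have : exists t, t \in `[a, b] /\ curve_length d c a t = l%:E by exists t.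
by move=> /(xgetPex a)[].
Qed.

Lemma arclength_inv_homo l l' : (0 <= l)%R -> (l < l')%R -> (l' <= L)%R ->
  (tau l <= tau l')%R.
Proof.
move=> l0 ll' l'L; rewrite leNgt; apply/negP => tt.
have := arclength_inv_itv l; have := arclength_inv_itv l'.
rewrite !in_itv/= => /andP[at' _] /andP[_ tb].
have : curve_length d c a (tau l') <= curve_length d c a (tau l).
  rewrite (@curve_lengthD c a (tau l') (tau l)) ?at' ?(ltW tt)//.
  by rewrite leeDl// curve_length_ge0// ltW.
by rewrite !arclength_invK ?lee_fin ?l0 ?l'L ?(le_trans (ltW ll') l'L) ?(le_trans l0 (ltW ll'))// leNgt ll'.
Qed.

Lemma arclength_inv_lipschitz l l' : (0 <= l)%R -> (l <= l')%R -> (l' <= L)%R ->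
  d (c (tau l)) (c (tau l')) <= (l' - l)%:E.
Proof.
move=> l0; rewrite le_eqVlt => /predU1P[<-|ll'] l'L; first by rewrite dxx subrr.
have tt := arclength_inv_homo l0 ll' l'L.
apply: le_trans (dist_le_curve_length c tt) _.
have := arclength_inv_itv l; have := arclength_inv_itv l'.
rewrite !in_itv/= => /andP[_ tb] /andP[at_ _].
rewrite (fine_curve_lengthB Lfin at_ tt tb) !arclength_invK ?l0 ?l'L//.
  by rewrite (le_trans (ltW ll')).
by rewrite (le_trans l0 (ltW ll')).
Qed.

End arclength.

End curve_length_theory.

(** * Lipschitz functions on the filling *)

Section filling_points.
Context {R : realType} {Z : completeMetricType R}.
Local Notation vertex := (Z * int)%type.
Implicit Types (v w u : vertex) (s t : R).

Lemma edge_pt0 v w : @edge_pt R Z v w 0 = edge_pt v v 0.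
Proof. by apply/funext => u; rewrite /edge_pt !mul0r. Qed.

Lemma edge_pt1 v w : @edge_pt R Z v w 1 = edge_pt w w 0.
Proof.
by apply/funext => u; rewrite /edge_pt subrr subr0 !mul0r !mul1r add0r addr0.
Qed.

Lemma edge_ptC v w t : @edge_pt R Z v w t = edge_pt w v (1 - t).
Proof. by apply/funext => u; rewrite /edge_pt subKr addrC. Qed.

(** Extension of a vertex function to points by barycentric coordinates; [height] is the extension
    of the level. *)
Definition affine_ext (phi : vertex -> R) (x : vertex -> R) : R :=
  \sum_(u \in [set: vertex]) x u * phi u.

Lemma affine_ext_edge phi v w t :
  affine_ext phi (edge_pt v w t) = (1 - t) * phi v + t * phi w.
Proof.
rewrite /affine_ext (fsbigTE (finmap.fsetU (finmap.fset1 v) (finmap.fset1 w))); last first.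
  move=> u; rewrite finmap.in_fsetU !finmap.in_fset1 negb_or => /andP[/negbTE uv /negbTE uw].
  by rewrite /edge_pt uv uw !mulr0 addr0 mul0r.
have [<-|vw] := eqVneq v w.
  by rewrite finmap.fsetUid finmap.big_seq_fset1 /edge_pt eqxx !mulr1 mulrDl.
rewrite finmap.big_fsetU1 ?finmap.in_fset1//= finmap.big_seq_fset1.
rewrite /edge_pt !eqxx [w == v]eq_sym (negbTE vw).
by rewrite !mulr1 !mulr0 addr0 add0r.
Qed.

Lemma height_edge v w t :
  height (edge_pt v w t) = (1 - t) * v.2%:~R + t * w.2%:~R.
Proof. exact: affine_ext_edge. Qed.

Variables (alpha tau : R) (S : int -> set Z).
Hypothesis alpha1 : 1 < alpha.
Local Notation X := (filling alpha tau S).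
Local Notation E := (filling_edge alpha tau S).

Let alpha0 : 0 < alpha. Proof. exact: lt_trans alpha1. Qed.

Lemma filling_edgeC v w : E v w -> E w v.
Proof.
case=> Vv Vw vw hvw; rewrite setIC => vwI; split => //; last by rewrite distrC.
by move=> wv; apply: vw.
Qed.

Lemma filling_edge_height v w : E v w ->
  `|v.2%:~R - w.2%:~R| <= 1 :> R.
Proof. by case=> _ _ _ h _; rewrite -intrB -intr_norm -[1]/(1%:~R) ler_int. Qed.

Lemma rho_edge v w t : rho alpha (edge_pt v w t) =
  alpha `^ (- ((1 - t) * v.2%:~R + t * w.2%:~R)).
Proof. by rewrite /rho height_edge. Qed.

Lemma rho_gt0 x : 0 < @rho R Z alpha x. Proof. exact: powR_gt0. Qed.

Lemma rho_edge_ge v w t : t \in `[0, 1] ->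
  alpha `^ (- Num.max v.2%:~R w.2%:~R) <= rho alpha (edge_pt v w t).
Proof.
rewrite in_itv/= => /andP[t0 t1]; rewrite rho_edge ler_powR ?(ltW alpha1)// lerN2.
have : v.2%:~R <= Num.max v.2%:~R w.2%:~R :> R by rewrite le_max lexx.
have : w.2%:~R <= Num.max v.2%:~R w.2%:~R :> R by rewrite le_max lexx orbT.
by move: (Num.max _ _) => m; nra.
Qed.

Lemma rho_edge_le v w t : t \in `[0, 1] ->
  rho alpha (edge_pt v w t) <= alpha `^ (- Num.min v.2%:~R w.2%:~R).
Proof.
rewrite in_itv/= => /andP[t0 t1]; rewrite rho_edge ler_powR ?(ltW alpha1)// lerN2.
have : Num.min v.2%:~R w.2%:~R <= v.2%:~R :> R by rewrite ge_min lexx.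
have : Num.min v.2%:~R w.2%:~R <= w.2%:~R :> R by rewrite ge_min lexx orbT.
by move: (Num.min _ _) => m; nra.
Qed.

Lemma filling_vertex v : vertices S v -> X (edge_pt v v 0).
Proof. by move=> Vv; left; exists v. Qed.

Lemma filling_edge_pt v w t : E v w -> t \in `[0, 1] -> X (edge_pt v w t).
Proof. by move=> vw t01; right; exists v, w, t. Qed.

Local Notation ed := (edge_dist alpha tau S).
Local Notation gd := (graph_dist alpha tau S).

Lemma edge_dist_ge0 x y : (0 <= ed x y)%E.
Proof.
by apply: le_ereal_inf_tmp => _ [v [w [s [t [_ _ _ _ ->]]]]]; rewrite lee_fin.
Qed.

Lemma edge_distC x y : ed x y = ed y x.
Proof.
by congr ereal_inf; apply/seteqP; split => _ [v [w [s [t [vw [s01 t01] -> -> ->]]]]];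
  exists v, w, t, s; rewrite distrC.
Qed.

Lemma edge_dist_le v w s t : E v w -> s \in `[0, 1] -> t \in `[0, 1] ->
  (ed (edge_pt v w s) (edge_pt v w t) <= `|s - t|%:E)%E.
Proof. by move=> vw s01 t01; apply: ereal_inf_lbound; exists v, w, s, t. Qed.

Fixpoint chain_length (x : vertex -> R) (p : seq (vertex -> R)) : \bar R :=
  if p is z :: p' then (ed x z + chain_length z p')%E else 0%E.

Lemma chain_lengthE b x p :
  (\sum_(0 <= i < size p) ed (nth b (x :: p) i) (nth b (x :: p) i.+1) =
  chain_length x p)%E.
Proof.
elim: p x => [|y p ih] x; first by rewrite big_nil.
by rewrite big_nat_recl//= ih.
Qed.

Lemma chain_length_ge0 x p : (0 <= chain_length x p)%E.
Proof. by elim: p x => //= z p ih x; rewrite adde_ge0// edge_dist_ge0. Qed.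

Lemma chain_length_cat x p q :
  (chain_length x (p ++ q) = chain_length x p + chain_length (last x p) q)%E.
Proof. by elim: p x => [|z p ih] x; rewrite ?add0e//= ih addeA. Qed.

Lemma graph_distE x y : gd x y =
  ereal_inf [set chain_length x p | p in [set p | last x p = y]].
Proof. by congr ereal_inf; apply: eq_imagel => p _; exact: chain_lengthE. Qed.

Lemma graph_dist_le_chain x p : (gd x (last x p) <= chain_length x p)%E.
Proof. by rewrite graph_distE; apply: ereal_inf_lbound; exists p. Qed.

Lemma graph_dist_le v w s t : E v w -> s \in `[0, 1] -> t \in `[0, 1] ->
  (gd (edge_pt v w s) (edge_pt v w t) <= `|s - t|%:E)%E.
Proof.
move=> vw s01 t01; apply: le_trans (edge_dist_le vw s01 t01).
by have := graph_dist_le_chain (edge_pt v w s) [:: edge_pt v w t]; rewrite /= adde0.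
Qed.

Lemma edist_graph_dist : edist gd.
Proof.
have ge0 x y : (0 <= gd x y)%E.
  by rewrite graph_distE; apply: le_ereal_inf_tmp => _ [p _ <-]; exact: chain_length_ge0.
have tri x y z : (gd x z <= gd x y + gd y z)%E.
  have chain p q : last x p = y -> last y q = z ->
      (gd x z <= chain_length x p + chain_length y q)%E.
    move=> <- <-; rewrite -chain_length_cat -last_cat; exact: graph_dist_le_chain.
  have [->|/eqP xyoo] := eqVneq (gd x y) +oo%E.
    by rewrite addye ?leey// gt_eqF// (lt_le_trans _ (ge0 _ _)).
  have [->|/eqP yzoo] := eqVneq (gd y z) +oo%E.
    by rewrite addey ?leey// gt_eqF// (lt_le_trans _ (ge0 _ _)).
  have xyfin : gd x y \is a fin_num.
    by rewrite ge0_fin_numE// lt_neqAle leey andbT; apply/eqP.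
  have yzfin : gd y z \is a fin_num.
    by rewrite ge0_fin_numE// lt_neqAle leey andbT; apply/eqP.
  apply/lee_addgt0Pr => e e0; have e20 : 0 < e / 2 by rewrite divr_gt0.
  have [_ [p pl <-] pe] := lb_ereal_inf_adherent e20 xyfin.
  have [_ [q ql <-] qe] := lb_ereal_inf_adherent e20 yzfin.
  apply: le_trans (chain _ _ pl ql) _; rewrite (splitr e) EFinD addeACA.
  move: pe qe; rewrite !chain_lengthE => pe qe.
  exact: leeD (ltW pe) (ltW qe).
have xx x : gd x x = 0%E.
  apply/eqP; rewrite eq_le ge0 andbT.
  by have := graph_dist_le_chain x [::].
have le_sym x y : (gd y x <= gd x y)%E.
  rewrite [leRHS]graph_distE; apply: le_ereal_inf_tmp => _ [p <- <-].
  elim: p x => [|z p ih] x /=; first by rewrite xx.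
  apply: le_trans (tri _ z _) _; rewrite addeC leeD// edge_distC.
  by have := graph_dist_le_chain z [:: x]; rewrite /= adde0.
by split => // x y; apply/eqP; rewrite eq_le !le_sym.
Qed.


(** * Lipschitz estimates for affine extensions *)

Section lipschitz.
Variables (phi : vertex -> R) (K : R).
Hypothesis K0 : 0 <= K.
Hypothesis phi_edge : forall v w, E v w ->
  `|phi v - phi w| <= K * alpha `^ (- Num.max v.2%:~R w.2%:~R).

(** The power of [alpha] in the hypothesis on [phi] is the smallest value of [rho] on the edge, so
    [phi] varies at rate at most [K * rho] along it. The distance being an infimum, a strict
    inequality is what yields an actual edge. *)
Lemma edge_dist_lipschitz x y (e : R) : (ed x y <= e%:E)%E ->
  `|height x - height y| <= e /\
  `|affine_ext phi x - affine_ext phi y| <= K * rho alpha x * e.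
Proof.
move=> xye.
have H e' : (ed x y < e'%:E)%E -> `|height x - height y| <= e' /\
    `|affine_ext phi x - affine_ext phi y| <= K * rho alpha x * e'.
  move=> /ereal_inf_lt[_ [v [w [s [t [vw [s01 t01] -> -> ->]]]]]].
  rewrite lte_fin => /ltW ste; rewrite !height_edge !affine_ext_edge; split.
    rewrite (_ : _ - _ = (s - t) * (w.2%:~R - v.2%:~R)); last by ring.
    rewrite normrM distrC in ste *; apply: le_trans ste.
    by rewrite ler_piMr// distrC filling_edge_height.
  rewrite (_ : _ - _ = (t - s) * (phi v - phi w)); last by ring.
  rewrite normrM mulrC ler_pM// ?(le_trans (phi_edge vw))//; last by rewrite distrC.
  by rewrite ler_wpM2l// rho_edge_ge.
have e'gt e' : 0 < e' -> (ed x y < (e + e')%:E)%E.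
  by move=> e'0; apply: le_lt_trans xye _; rewrite lte_fin ltrDl.
split; first by apply/ler_addgt0Pr => e' /e'gt/H[].
have Kr0 : 0 <= K * rho alpha x by rewrite mulr_ge0// ltW// rho_gt0.
apply/ler_addgt0Pr => e' e'0.
have Kr1 : 0 < K * rho alpha x + 1 by rewrite ltr_wpDl.
have [_ /le_trans] := H _ (e'gt (e' / (K * rho alpha x + 1)) (divr_gt0 e'0 Kr1)).
apply; rewrite mulrDr lerD2l mulrCA ler_piMr ?(ltW e'0)//.
by rewrite ler_pdivrMr// mul1r lerDl.
Qed.

(** Along a chain of length [e] the height moves by at most [e], so [rho] grows at most by the
    factor [alpha] to the power [e]; this is why the height is controlled in the same induction. *)
Lemma chain_length_lipschitz p x (e : R) : (chain_length x p <= e%:E)%E ->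
  `|height x - height (last x p)| <= e /\
  `|affine_ext phi x - affine_ext phi (last x p)| <=
    K * rho alpha x * alpha `^ e * e.
Proof.
elim: p x e => [|z p ih] x e /=.
  rewrite lee_fin => e0; rewrite !subrr normr0; split => //.
  by rewrite !mulr_ge0 ?powR_ge0.
move=> xpe.
have xz0 := edge_dist_ge0 x z; have zp0 := chain_length_ge0 z p.
have : ed x z \is a fin_num.
  by rewrite ge0_fin_numE//; apply: le_lt_trans (ltry e); apply: le_trans xpe; rewrite leeDl.
have : chain_length z p \is a fin_num.
  by rewrite ge0_fin_numE//; apply: le_lt_trans (ltry e); apply: le_trans xpe; rewrite leeDr.
move=> /fineK pE /fineK xE; move: xpe xz0 zp0; rewrite -pE -xE -EFinD !lee_fin.
set a := fine _; set b := fine _ => abe a0 b0.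
have [|h1 f1] := @edge_dist_lipschitz x z a; first by rewrite -xE.
have [|h2 f2] := ih z b; first by rewrite -pE.
split; first by apply: le_trans (ler_distD (height z) _ _) _; lra.
apply: le_trans (ler_distD (affine_ext phi z) _ _) _.
have rzx : rho alpha z <= rho alpha x * alpha `^ a.
  rewrite /rho -powRD ?(gt_eqF alpha0) ?implybT// ler_powR ?(ltW alpha1)//.
  by move: h1; rewrite ler_norml => /andP[]; lra.
have ae : alpha `^ a * alpha `^ b <= alpha `^ e.
  by rewrite -powRD ?(gt_eqF alpha0) ?implybT// ler_powR ?(ltW alpha1).
have a1 : 1 <= alpha `^ a * alpha `^ b.
  rewrite -powRD ?(gt_eqF alpha0) ?implybT// -(powRr0 alpha) ler_powR ?(ltW alpha1)//.
  exact: addr_ge0.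
have r0 := ltW (rho_gt0 x).
have f2' : `|affine_ext phi z - affine_ext phi (last z p)| <=
    K * rho alpha x * (alpha `^ a * alpha `^ b) * b.
  apply: le_trans f2 _; rewrite ler_wpM2r// mulrA ler_wpM2r ?powR_ge0//.
  by rewrite -mulrA ler_wpM2l.
apply: (@le_trans _ _ (K * rho alpha x * (alpha `^ a * alpha `^ b) * (a + b))).
  rewrite mulrDr lerD// (le_trans f1)// ler_wpM2r//.
  by rewrite ler_peMr// mulr_ge0.
by rewrite ler_pM ?mulr_ge0 ?powR_ge0 ?addr_ge0// ler_wpM2l ?mulr_ge0.
Qed.

(** The infimum only provides chains of length [e + e'] with [e' <= 1], that is of length at most 2;
    hence the square of [alpha]. *)
Lemma graph_dist_lipschitz x y (e : R) : (gd x y <= e%:E)%E -> e <= 1 ->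
  `|height x - height y| <= e /\
  `|affine_ext phi x - affine_ext phi y| <= K * alpha ^+ 2 * rho alpha x * e.
Proof.
move=> xye e1.
have e0 : 0 <= e.
  by have [_ ge0 _ _] := edist_graph_dist; rewrite -lee_fin (le_trans (ge0 x y)).
have H e' : 0 < e' -> e' <= 1 -> `|height x - height y| <= e + e' /\
    `|affine_ext phi x - affine_ext phi y| <= K * alpha ^+ 2 * rho alpha x * (e + e').
  move=> e'0 e'1; have : (gd x y < (e + e')%:E)%E.
    by apply: le_lt_trans xye _; rewrite lte_fin ltrDl.
  rewrite graph_distE => /ereal_inf_lt[_ [p <- <-]] /ltW /chain_length_lipschitz[h f].
  split => //; apply: le_trans f _; rewrite ler_wpM2r ?addr_ge0 ?(ltW e'0)//.
  rewrite mulrAC ler_wpM2r ?(ltW (rho_gt0 _))// ler_wpM2l//.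
  rewrite -powR_mulrn ?(ltW alpha0)// ler_powR ?(ltW alpha1)//; lra.
have Kr0 : 0 <= K * alpha ^+ 2 * rho alpha x.
  by rewrite !mulr_ge0 ?exprn_ge0 ?(ltW alpha0) ?(ltW (rho_gt0 _)).
have Kr1 : 0 < K * alpha ^+ 2 * rho alpha x + 1 by rewrite ltr_wpDl.
split.
  apply/ler_addgt0Pr => e' e'0.
  have [||h _] := H (Num.min e' 1).
  - by rewrite lt_min e'0 ltr01.
  - by rewrite ge_min lexx orbT.
  by apply: le_trans h _; rewrite lerD2l ge_min lexx.
apply/ler_addgt0Pr => e' e'0.
have [||_ /le_trans] := H (Num.min (e' / (K * alpha ^+ 2 * rho alpha x + 1)) 1).
- by rewrite lt_min ltr01 divr_gt0.
- by rewrite ge_min lexx orbT.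
apply; rewrite mulrDr lerD2l.
apply: (@le_trans _ _ (K * alpha ^+ 2 * rho alpha x * (e' / (K * alpha ^+ 2 * rho alpha x + 1)))).
  by rewrite ler_wpM2l// ge_min lexx.
rewrite mulrCA ler_piMr ?(ltW e'0)//.
by rewrite ler_pdivrMr// mul1r lerDl.
Qed.

Local Notation li c a b := (line_integral gd c a b (EFin \o rho alpha)).

(** The curve is cut into pieces of equal arc length at most 1. The increments of [phi] over the
    pieces add up to a Riemann sum for [rho], which lies below the line integral up to one more
    factor [alpha]. *)
Lemma line_integral_lipschitz c (a b : R) : rectifiable_curve gd X c a b ->
  (`|affine_ext phi (c a) - affine_ext phi (c b)|%:E <=
   (K * alpha ^+ 3)%:E * li c a b)%E.
Proof.
move=> [ab cX cc Lfin]; have hd := edist_graph_dist.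
pose L := fine (curve_length gd c a b).
have Lf : (curve_length gd c a b = L%:E)%E.
  by rewrite /L fineK// (curve_length_fin_num hd Lfin).
have L0 : 0 <= L by rewrite -lee_fin -Lf curve_length_ge0.
pose T := arclength_inv gd c a b.
(* One more than a bound of the length: [N] is nonzero and the pieces have length at most 1. *)
pose N := (Num.bound L).+1; pose l (i : nat) := i%:R * (L / N%:R).
have N0 : (0 : R) < N%:R by rewrite ltr0n.
have d0 : 0 <= L / N%:R by rewrite divr_ge0// ltW.
have d1 : L / N%:R <= 1.
  rewrite ler_pdivrMr// mul1r (le_trans (ltW (archi_boundP L0)))//.
  by rewrite ler_nat leqnSn.
have lS i : l i.+1 = l i + L / N%:R by rewrite /l -natr1 mulrDl mul1r.
have lN : l N = L by rewrite /l mulrC divfK// gt_eqF.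
have l0 i : 0 <= l i by rewrite /l mulr_ge0.
have lle i j : (i <= j)%N -> l i <= l j by move=> ij; rewrite /l ler_wpM2r// ler_nat.
have lL i : (i <= N)%N -> l i <= L by move=> /lle; rewrite lN.
pose x i := c (T (l i)).
have Tlip s t : 0 <= s -> s <= t -> t <= L -> (gd (c (T s)) (c (T t)) <= (t - s)%:E)%E.
  by move=> *; exact: arclength_inv_lipschitz.
have Tab t : T t \in `[a, b] by exact: arclength_inv_itv.
(* The time chosen for arc length 0 need not be [a], but the two points are at graph distance 0, and
   an affine extension does not separate such points. *)
have end0 : affine_ext phi (c a) = affine_ext phi (x 0%N).
  apply/eqP; rewrite -subr_eq0 -normr_le0.
  have := Tab (l 0%N); rewrite in_itv/= => /andP[aT _].
  have := dist_le_curve_length hd c aT.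
  rewrite arclength_invK ?l0 ?lL// {2}/l mul0r => /graph_dist_lipschitz[//|_].
  by rewrite mulr0.
have endN : affine_ext phi (x N) = affine_ext phi (c b).
  apply/eqP; rewrite -subr_eq0 -normr_le0.
  have := Tab (l N); rewrite in_itv/= => /andP[aT Tb].
  have := dist_le_curve_length hd c Tb.
  rewrite (fine_curve_lengthB hd Lfin aT Tb)// arclength_invK ?l0 ?lL//.
  have -> : fine (curve_length gd c a b) - fine (l N)%:E = 0 by rewrite /= lN subrr.
  by move=> /graph_dist_lipschitz[//|_]; rewrite mulr0.
rewrite end0 -endN.
have step i : (i < N)%N -> `|affine_ext phi (x i) - affine_ext phi (x i.+1)| <=
    K * alpha ^+ 2 * rho alpha (x i) * (L / N%:R).
  move=> iN; have := Tlip (l i) (l i.+1) (l0 i) (lle _ _ (leqnSn i)) (lL _ iN).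
  by rewrite {2}lS addrC addKr => /graph_dist_lipschitz[].
have sum_le n : (n <= N)%N -> `|affine_ext phi (x 0%N) - affine_ext phi (x n)| <=
    K * alpha ^+ 2 * (\sum_(0 <= i < n) rho alpha (x i) * (L / N%:R)).
  elim: n => [|n ih] nN; first by rewrite subrr normr0 big_nil mulr0.
  rewrite big_nat_recr//= mulrDr.
  apply: le_trans (ler_distD (affine_ext phi (x n)) _ _) _.
  by rewrite lerD// ?ih ?(ltnW nN)// mulrA step.
apply: (@le_trans _ _ ((K * alpha ^+ 2)%:E *
    (\sum_(0 <= i < N) rho alpha (x i) * (L / N%:R))%:E)%E).
  by rewrite -EFinM lee_fin sum_le.
(* Two factors come from the steps. The third replaces the value of [rho] at the start of a piece by
   its values on the piece, where the height differs by at most 1. *)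
have -> : (K * alpha ^+ 3)%:E = ((K * alpha ^+ 2)%:E * alpha%:E)%E.
  by rewrite -EFinM [alpha ^+ 3]exprSr mulrA.
rewrite -muleA lee_wpmul2l ?lee_fin//.
  by rewrite mulr_ge0// exprn_ge0// ltW.
apply: (@le_trans _ _ (alpha%:E * \sum_(i <- index_iota 0 N)
    (rho alpha (x i) / alpha)%:E * @lebesgue_measure R `[l i, l i.+1[%classic)%E).
  rewrite ge0_sume_distrr; last first.
    by move=> i _; rewrite mule_ge0// lee_fin divr_ge0 ?(ltW alpha0)// ltW// rho_gt0.
  rewrite -sumEFin le_eqVlt; apply/orP; left; apply/eqP; apply: eq_bigr => i _.
  rewrite lebesgue_measure_itv/= lte_fin lS.
  case: ltP => [_|]; last first.
    rewrite -{2}[l i]addr0 lerD2l => d0'.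
    have -> : L / N%:R = 0 by apply/eqP; rewrite eq_le d0' d0.
    by rewrite mulr0 !mule0.
  rewrite -EFinB -!EFinM addrAC subrr add0r; congr EFin.
  by field; rewrite !gt_eqF.
rewrite lee_wpmul2l ?lee_fin ?(ltW alpha0)//.
apply: sum_cst_le_integral.
- exact: iota_uniq.
- by move=> i _; exact: measurable_itv.
- move=> i; rewrite mem_index_iota => /andP[_ iN] t /=.
  rewrite !in_itv/= => /andP[lt tl].
  by rewrite (le_trans (l0 i))//= -/L (le_trans (ltW tl))// lL.
- move=> i j t _ _ /=; rewrite !in_itv/= => /andP[it ti] /andP[jt tj].
  apply/eqP; rewrite eqn_leq; apply/andP; split; rewrite leqNgt; apply/negP => /lle.
    by rewrite leNgt (le_lt_trans it tj).
  by rewrite leNgt (le_lt_trans jt ti).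
- by move=> i _; rewrite lee_fin divr_ge0 ?(ltW alpha0)// ltW// rho_gt0.
- by move=> t _; rewrite lee_fin ltW// rho_gt0.
- move=> i t; rewrite mem_index_iota => /andP[_ iN] /=.
  rewrite in_itv/= => /andP[lt tl]; rewrite lee_fin.
  have := Tlip (l i) t (l0 i) lt (le_trans (ltW tl) (lL _ iN)).
  have tl1 : t - l i <= 1 by rewrite lS in tl; lra.
  move=> /graph_dist_lipschitz -/(_ tl1)[h _].
  rewrite ler_pdivrMr// /rho -[X in _ <= _ * X](powRr1 (ltW alpha0)) -powRD ?(gt_eqF alpha0) ?implybT//.
  rewrite ler_powR ?(ltW alpha1)//.
  by move: h; rewrite ler_norml => /andP[]; rewrite /x; lra.
Qed.

(* The boundary distance, the height and the injectivity of [iota] are all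
   controlled by this lemma, with [phi] the distance to a base point, the radius
   and the indicator of a vertex. *)
Lemma d_rho_lipschitz x y (e : R) : (d_rho alpha tau S x y <= e%:E)%E ->
  `|affine_ext phi x - affine_ext phi y| <= K * alpha ^+ 3 * e.
Proof.
move=> xye.
have K30 : 0 <= K * alpha ^+ 3 by rewrite mulr_ge0// exprn_ge0// ltW.
have K31 : 0 < K * alpha ^+ 3 + 1 by rewrite ltr_wpDl.
apply/ler_addgt0Pr => e' e'0.
have : (d_rho alpha tau S x y < (e + e' / (K * alpha ^+ 3 + 1))%:E)%E.
  by apply: le_lt_trans xye _; rewrite lte_fin ltrDl divr_gt0.
move=> /ereal_inf_lt[_ [c [a [b [rc <- <- ->]]]]] /ltW le_li.
rewrite -lee_fin; apply: le_trans (line_integral_lipschitz rc) _.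
apply: le_trans (lee_wpmul2l _ le_li) _; first by rewrite lee_fin.
rewrite -EFinM lee_fin mulrDr lerD2l mulrCA ler_piMr ?(ltW e'0)//.
by rewrite ler_pdivrMr// mul1r lerDl.
Qed.

End lipschitz.

Lemma edge_curve_length_le v w s t : E v w -> 0 <= s -> s <= t -> t <= 1 ->
  (curve_length gd (edge_pt v w) s t <= (t - s)%:E)%E.
Proof.
move=> vw s0 st t1; rewrite curve_lengthE; apply: ge_ereal_sup => _ [p + <-].
elim: p s s0 st => [|y p ih] s s0 st.
  by move=> /itv_partition_nil ->; rewrite subrr.
move=> spt; have sy : s < y by case: spt => /=/andP[].
have ypt := itv_partition_cons spt; have yt := itv_partition_le ypt.
rewrite /= (_ : t - s = (y - s) + (t - y)); last by ring.
rewrite EFinD leeD ?ih ?(le_trans s0 (ltW sy))//.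
apply: le_trans (graph_dist_le vw _ _) _.
- by rewrite in_itv/= s0 (le_trans st).
- by rewrite in_itv/= (le_trans s0 (ltW sy)) (le_trans yt).
- by rewrite lee_fin distrC ger0_norm// subr_ge0 ltW.
Qed.

Lemma edge_rectifiable v w s t : E v w -> 0 <= s -> s <= t -> t <= 1 ->
  rectifiable_curve gd X (edge_pt v w) s t.
Proof.
move=> vw s0 st t1; have sub (u : R) : u \in `[s, t] -> u \in `[0, 1].
  by rewrite !in_itv/= => /andP[su ut]; rewrite (le_trans s0 su) (le_trans ut t1).
split => //.
- by move=> u /sub; exact: filling_edge_pt.
- move=> u /sub u01 e e0; exists e => // u' /sub u'01 uu'.
  by apply: le_lt_trans (graph_dist_le vw u01 u'01) _; rewrite lte_fin distrC.
- exact: le_lt_trans (edge_curve_length_le vw s0 st t1) (ltry _).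
Qed.

(** The edge itself is an admissible curve, and [rho] is largest at its end of smaller height. *)
Lemma d_rho_edge_le v w s t : E v w -> s \in `[0, 1] -> t \in `[0, 1] ->
  (d_rho alpha tau S (edge_pt v w s) (edge_pt v w t) <=
   (alpha `^ (- Num.min v.2%:~R w.2%:~R) * `|s - t|)%:E)%E.
Proof.
wlog st : v w s t / s <= t => [H vw s01 t01|].
  have [st|/ltW ts] := leP s t; first exact: H.
  rewrite (edge_ptC v w s) (edge_ptC v w t) minC.
  rewrite (_ : s - t = (1 - t) - (1 - s)); last by ring.
  rewrite distrC; apply: H; first by rewrite lerD2l lerN2.
  - exact: filling_edgeC.
  - by move: s01; rewrite !in_itv/= => /andP[]; lra.
  - by move: t01; rewrite !in_itv/= => /andP[]; lra.
move=> vw; rewrite !in_itv/= => /andP[s0 s1] /andP[t0 t1].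
have rc := edge_rectifiable vw s0 st t1.
apply: (@le_trans _ _ (line_integral gd (edge_pt v w) s t (EFin \o rho alpha))).
  by apply: ereal_inf_lbound; exists (edge_pt v w), s, t.
have [_ _ cc Lfin] := rc; have hd := edist_graph_dist.
set L := fine (curve_length gd (edge_pt v w) s t).
have L0 : 0 <= L by rewrite fine_ge0// curve_length_ge0.
have Lst : L <= t - s.
  rewrite -lee_fin fineK ?edge_curve_length_le//.
  by apply: (curve_length_fin_num hd Lfin).
set M := alpha `^ _.
apply: (@le_trans _ _ (\int[@lebesgue_measure R]_(l in `[0%R, L]) M%:E)%E).
  apply: ge0_le_integral_nm => l _ /=; first by rewrite lee_fin ltW// rho_gt0.
  rewrite lee_fin rho_edge_le//.
  have := arclength_inv_itv gd (edge_pt v w) st l.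
  by rewrite !in_itv/= => /andP[sl lt]; rewrite (le_trans s0 sl) (le_trans lt t1).
rewrite integral_cst//= lebesgue_measure_itv/= lte_fin.
case: ltP => [_|L0']; last by rewrite mule0 lee_fin mulr_ge0 ?powR_ge0.
rewrite -EFinB -EFinM lee_fin subr0 ler_wpM2l ?powR_ge0//.
by rewrite distrC ger0_norm// subr_ge0.
Qed.

End filling_points.

(** * Filling and boundary *)

Section powers.
Context {R : realType} (alpha : R).
Hypothesis alpha1 : 1 < alpha.
Let alpha0 : 0 < alpha. Proof. exact: lt_trans alpha1. Qed.

Lemma exprz_powR (n : int) : alpha `^ (n%:~R) = alpha ^ n.
Proof. by rewrite powR_intmul// ltW. Qed.

Lemma powRN_int (n : int) : alpha `^ (- n%:~R) = alpha ^ (- n).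
Proof. by rewrite -intrN exprz_powR. Qed.

Lemma ler_exprzN (m n : int) : m <= n -> alpha ^ (- n) <= alpha ^ (- m).
Proof. by move=> mn; rewrite ler_eXz2l// lerN2. Qed.

Lemma exprzNS (n : int) : alpha ^ (- n) = alpha * alpha ^ (- (n + 1)).
Proof. by rewrite -{2}(expr1z alpha) -expfzDr ?gt_eqF// opprD addrCA subrr addr0. Qed.

Lemma exprz_scale (s : R) : 0 < s ->
  exists m : int, s <= alpha ^ (- m) < alpha * s.
Proof.
move=> s0; have l0 : 0 < ln alpha by rewrite ln_gt0.
exists (- Num.ceil (ln s / ln alpha)); rewrite opprK -exprz_powR.
have sE : s = alpha `^ (ln s / ln alpha).
  by rewrite /powR gt_eqF// divfK ?gt_eqF// lnK.
rewrite {1}sE ler_powR ?(ltW alpha1) ?ceil_ge//=.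
have /andP[h _] := ceil_itv (ln s / ln alpha).
have -> : alpha * s = alpha `^ (1 + ln s / ln alpha).
  by rewrite powRD ?(gt_eqF alpha0) ?implybT// powRr1 ?(ltW alpha0)// -sE.
rewrite /powR gt_eqF// ltr_expR ltr_pM2r//.
by move: h; rewrite intrB; lra.
Qed.

Lemma exprz_small (e : R) : 0 < e -> exists N : nat,
  forall n : nat, (N <= n)%N -> alpha ^ (- n%:Z) <= e.
Proof.
move=> e0; have [m /andP[_ me]] := exprz_scale (divr_gt0 e0 alpha0).
exists `|m|%N => n mn.
rewrite (le_trans (ler_exprzN (_ : m <= n%:Z)))//.
  by rewrite (le_trans (ler_norm m))// -abszE lez_nat.
by rewrite (le_trans (ltW me))// mulrC divfK// gt_eqF.
Qed.

End powers.

Section geometry.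
Context {R : realType} {Z : completeMetricType R}.
Variables (alpha tau : R) (S : int -> set Z).
Hypothesis alpha1 : 1 < alpha.
Hypothesis tau3 : 3 < tau.
Hypothesis maxS : forall n : int, maximal_separated (alpha ^ (- n)) (S n).
Local Notation vertex := (Z * int)%type.
Local Notation X := (filling alpha tau S).
Local Notation E := (filling_edge alpha tau S).
Local Notation r n := (alpha ^ (- n%R)).

Let alpha0 : 0 < alpha. Proof. exact: lt_trans alpha1. Qed.
Let tau0 : 0 < tau. Proof. by have := tau3; lra. Qed.
Let rgt0 (n : int) : 0 < r n. Proof. exact: exprz_gt0. Qed.
Hint Resolve rgt0 : core.

(** Otherwise [x] could be added to [S n], against maximality. *)
Lemma separated_net n x : exists2 s, S n s & mdist s x < r n.
Proof.
have [sepS maxSn] := maxS n; apply: contrapT => H.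
have far s : S n s -> r n <= mdist s x.
  by move=> Ss; rewrite leNgt; apply/negP => sx; apply: H; exists s.
have Sx : S n x.
  rewrite -(maxSn (S n `|` [set x])); first by right.
  - by move=> s; left.
  - move=> s t [Ss|->] [St|->] st; first exact: sepS.
    + exact: far.
    + by rewrite metric_sym far.
    + by rewrite eqxx in st.
by have := far _ Sx; rewrite mdistxx leNgt rgt0.
Qed.

(* [net_pt n x] is [x] itself when [x] is in the net, so that the chain
   [k |-> (net_pt k x, k)] passes through [(x, n)] for [x] in [S n]. *)
Definition net_pt (n : int) (x : Z) : Z :=
  if `[< S n x >] then x else xget x [set s | S n s /\ mdist s x < r n].

Lemma net_ptP n x : S n (net_pt n x) /\ mdist (net_pt n x) x < r n.
Proof.
rewrite /net_pt; case: asboolP => [Sx|_]; first by rewrite mdistxx.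
have [s Ss sx] := separated_net n x.
have : exists s, S n s /\ mdist s x < r n by exists s.
by move=> /(xgetPex x).
Qed.

Lemma net_pt_id n x : S n x -> net_pt n x = x.
Proof. by move=> Sx; rewrite /net_pt asboolT. Qed.

Definition net_vertex (n : int) (x : Z) : vertex := (net_pt n x, n).

Lemma vertices_net n x : vertices S (net_vertex n x).
Proof. by have [] := net_ptP n x. Qed.

Lemma net_vertex_id v : vertices S v -> net_vertex v.2 v.1 = v.
Proof. by case: v => x n Sx; rewrite /net_vertex net_pt_id. Qed.

Lemma edge_intro v w x : vertices S v -> vertices S w -> v <> w ->
  `|v.2 - w.2| <= 1 -> mdist v.1 x < tau * r v.2 -> mdist w.1 x < tau * r w.2 ->
  E v w.
Proof.
move=> Vv Vw vw h vx wx; split => //.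
by exists x; split; rewrite /vball ballEmdist.
Qed.

Lemma net_edge k x : E (net_vertex k x) (net_vertex (k + 1) x).
Proof.
have taur n : r n <= tau * r n.
  by rewrite ler_peMl ?(ltW (rgt0 _))// (le_trans _ (ltW tau3))// ler1n.
apply: (@edge_intro _ _ x); try exact: vertices_net.
- by move=> [_ /eqP]; rewrite -subr_eq0 opprD addNKr.
- by rewrite /= opprD addNKr normrN.
- exact: lt_le_trans (net_ptP _ _).2 (taur _).
- exact: lt_le_trans (net_ptP _ _).2 (taur _).
Qed.

Lemma vertex_edge v : vertices S v -> exists w, E v w.
Proof.
move=> Vv; exists (net_vertex (v.2 + 1) v.1).
by have := net_edge v.2 v.1; rewrite net_vertex_id.
Qed.

Lemma fillingP x : X x ->
  exists v w t, [/\ E v w, t \in `[0, 1] & x = edge_pt v w t].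
Proof.
case=> [[v Vv ->]|//]; have [w vw] := vertex_edge Vv.
by exists v, w, 0; rewrite edge_pt0; split => //; rewrite in_itv/= lexx ler01.
Qed.

Lemma edge_maxl v w : E v w ->
  r v.2 <= alpha * alpha `^ (- Num.max v.2%:~R w.2%:~R).
Proof.
move=> /filling_edge_height; rewrite ler_norml => /andP[h1 h2].
rewrite -powRN_int// -[X in X * _](powRr1 (ltW alpha0)) -powRD ?(gt_eqF alpha0) ?implybT//.
rewrite ler_powR ?(ltW alpha1)//.
have [_|_] := leP (v.2%:~R : R) (w.2%:~R); lra.
Qed.

Lemma edge_max_le (v w : vertex) : alpha `^ (- Num.max v.2%:~R w.2%:~R) <= r v.2.
Proof.
by rewrite -powRN_int// ler_powR ?(ltW alpha1)// lerN2 le_max lexx.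
Qed.

Lemma edge_minl v w : E v w ->
  alpha `^ (- Num.min v.2%:~R w.2%:~R) <= alpha * r v.2.
Proof.
move=> /filling_edge_height; rewrite ler_norml => /andP[h1 h2].
rewrite -powRN_int// -[X in X * _](powRr1 (ltW alpha0)) -powRD ?(gt_eqF alpha0) ?implybT//.
rewrite ler_powR ?(ltW alpha1)//.
have [_|_] := leP (v.2%:~R : R) (w.2%:~R); lra.
Qed.

Lemma edge_radius v w : E v w -> r w.2 <= alpha * r v.2.
Proof.
move=> vw; apply: le_trans (edge_minl vw).
by rewrite -powRN_int// ler_powR ?(ltW alpha1)// lerN2 ge_min lexx orbT.
Qed.

Lemma edge_dist_base v w : E v w ->
  mdist v.1 w.1 <= 2 * tau * alpha * alpha `^ (- Num.max v.2%:~R w.2%:~R).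
Proof.
move=> vw; have [_ _ _ _ [x []]] := vw; rewrite /vball !ballEmdist/= => vx wx.
apply: le_trans (metric_triangle _ x _) _; rewrite (metric_sym x).
have h1 := edge_maxl vw; have := edge_maxl (filling_edgeC vw); rewrite maxC => h2.
have taup := tau0.
have := ler_wpM2l (ltW taup) h1; have := ler_wpM2l (ltW taup) h2.
by move: vx wx; move: (alpha `^ _) => a; lra.
Qed.

Definition base_dist (x0 : Z) (v : vertex) : R := mdist x0 v.1.

Lemma base_dist_edge x0 v w : E v w -> `|base_dist x0 v - base_dist x0 w| <=
  2 * tau * alpha * alpha `^ (- Num.max v.2%:~R w.2%:~R).
Proof.
move=> vw; apply: le_trans (edge_dist_base vw); rewrite /base_dist ler_norml.
have := metric_triangle x0 v.1 w.1; have := metric_triangle x0 w.1 v.1.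
by rewrite (metric_sym w.1 v.1); lra.
Qed.

Lemma radius_edge v w : E v w ->
  `|r v.2 - r w.2| <= (alpha - 1) * alpha `^ (- Num.max v.2%:~R w.2%:~R).
Proof.
wlog vw : v w / v.2 <= w.2 => [H vw|].
  have [vw'|/ltW wv] := leP v.2 w.2; first exact: H.
  by rewrite distrC maxC; apply: H => //; exact: filling_edgeC.
move=> e; rewrite max_r ?ler_int// powRN_int// ger0_norm; last first.
  by rewrite subr_ge0 ler_exprzN.
have := edge_maxl e; rewrite max_r ?ler_int// powRN_int//; lra.
Qed.

Definition vertex_indicator (v0 v : vertex) : R := (v == v0)%:R.

(** Only edges at [v0] matter, and their ends have level at most [v0.2 + 1], so the right-hand side
    is at least 1 on them. *)
Lemma vertex_indicator_edge v0 v w : E v w ->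
  `|vertex_indicator v0 v - vertex_indicator v0 w| <=
  alpha ^ (v0.2 + 1) * alpha `^ (- Num.max v.2%:~R w.2%:~R).
Proof.
move=> vw; have h0 : 0 <= alpha ^ (v0.2 + 1) * alpha `^ (- Num.max v.2%:~R w.2%:~R).
  by rewrite mulr_ge0 ?powR_ge0// ltW// exprz_gt0.
have key u u' : E u u' -> 1 <= alpha ^ (u.2 + 1) * alpha `^ (- Num.max u.2%:~R u'.2%:~R).
  move=> /edge_maxl h; rewrite -(ler_pM2l (rgt0 u.2)) mulr1; apply: le_trans h _.
  by rewrite mulrA -expfzDr ?gt_eqF// addKr expr1z.
rewrite /vertex_indicator; have [ev|] := eqVneq v v0.
  have := key _ _ vw; rewrite ev => k.
  rewrite -ev in k *; case: (w == v); rewrite ?subrr ?subr0 ?normr0 ?normr1//.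
  exact: le_trans k.
move=> _; case: eqP => [ew|_]; last by rewrite subrr normr0.
have := key _ _ (filling_edgeC vw); rewrite maxC ew => k.
by rewrite sub0r normrN normr1.
Qed.

(** * The filling inside its completion, and the boundary *)

Variables (Y : completeMetricType R) (iota : (Z * int -> R) -> Y) (j : Z -> Y).
Hypothesis compl : uniformized_completion alpha tau S iota.
Hypothesis bdry : boundary_identification alpha S iota j.

Lemma iota_dist x y : X x -> X y ->
  (mdist (iota x) (iota y))%:E = d_rho alpha tau S x y.
Proof. by case: compl => H _; exact: H. Qed.

Lemma iota_lipschitz (phi : vertex -> R) (K : R) x y : 0 <= K ->
  (forall v w, E v w ->
    `|phi v - phi w| <= K * alpha `^ (- Num.max v.2%:~R w.2%:~R)) ->
  X x -> X y ->
  `|affine_ext phi x - affine_ext phi y| <= K * alpha ^+ 3 * mdist (iota x) (iota y).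
Proof.
move=> K0 phiE Xx Xy; apply: (d_rho_lipschitz alpha1 K0 phiE).
by rewrite iota_dist.
Qed.

(** The affine extension of the indicator of [v0] is the coordinate at [v0]; being Lipschitz, it
    agrees at points with the same image. *)
Lemma iota_inj x y : X x -> X y -> iota x = iota y -> x = y.
Proof.
move=> Xx Xy xy; apply/funext => v0.
have K0 : 0 <= alpha ^ (v0.2 + 1) by rewrite ltW// exprz_gt0.
have := iota_lipschitz K0 (@vertex_indicator_edge v0) Xx Xy.
rewrite xy mdistxx mulr0 normr_le0 subr_eq0 => /eqP.
have [v [w [t [_ _ ->]]]] := fillingP Xx; have [v' [w' [t' [_ _ ->]]]] := fillingP Xy.
by rewrite !affine_ext_edge /edge_pt /vertex_indicator !(eq_sym v0).
Qed.

Lemma iota_invK x : X x -> iota_inv alpha tau S iota (iota x) = x.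
Proof.
move=> Xx; rewrite /iota_inv.
have : exists y, X y /\ iota y = iota x by exists x.
by move=> /(xgetPex (fun=> 0))[Xy /iota_inj]; apply.
Qed.

Definition edge_curve (v w : vertex) (t : R) : Y := iota (edge_pt v w t).

Lemma edge_curve_lipschitz v w s t : E v w -> s \in `[0, 1] -> t \in `[0, 1] ->
  mdist (edge_curve v w s) (edge_curve v w t) <= alpha * r v.2 * `|s - t|.
Proof.
move=> vw s01 t01; rewrite -lee_fin iota_dist; try exact: filling_edge_pt.
apply: le_trans (d_rho_edge_le alpha1 vw s01 t01) _.
by rewrite lee_fin ler_wpM2r// edge_minl.
Qed.

Definition iv (v : vertex) : Y := iota (edge_pt v v 0).

Lemma X_vertex v : vertices S v -> X (edge_pt v v 0).
Proof. exact: filling_vertex. Qed.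

Lemma iv_edge v w : E v w ->
  mdist (iv v) (iv w) <= alpha `^ (- Num.min v.2%:~R w.2%:~R).
Proof.
move=> vw; have [Vv Vw _ _ _] := vw.
rewrite -lee_fin iota_dist; try exact: X_vertex.
rewrite -(edge_pt0 v w) -(edge_pt1 v w).
have := d_rho_edge_le alpha1 vw (_ : 0 \in `[0, 1]) (_ : 1 \in `[0, 1]).
rewrite sub0r normrN normr1 mulr1; apply; by rewrite in_itv/= ler01 lexx.
Qed.

(** The sum of the geometric series of ratio [alpha^-1]: a vertical chain from level [k] to the
    boundary has length at most [geom] times [alpha ^ (- k)]. *)
Definition geom : R := alpha / (alpha - 1).

Lemma geom_ge1 : 1 <= geom.
Proof. by rewrite /geom ler_pdivlMr ?subr_gt0// mul1r; lra. Qed.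

(** The bound telescopes: between consecutive levels its increment is exactly the bound of [iv_edge]
    on the length of the edge. *)
Lemma net_chain_dist k x (n : nat) :
  mdist (iv (net_vertex k x)) (iv (net_vertex (k + n%:Z) x)) <=
  geom * (r k - r (k + n%:Z)).
Proof.
elim: n => [|n ih]; first by rewrite addr0 mdistxx subrr mulr0.
apply: le_trans (metric_triangle _ (iv (net_vertex (k + n%:Z) x)) _) _.
have -> : k + n.+1%:Z = k + n%:Z + 1 by rewrite -addn1 PoszD addrA.
have step := iv_edge (net_edge (k + n%:Z) x).
rewrite min_l/= in step; last by rewrite ler_int lerDl.
rewrite powRN_int// in step.
have -> : geom * (r k - r (k + n%:Z + 1)) = geom * (r k - r (k + n%:Z)) + r (k + n%:Z).
  rewrite (exprzNS alpha1 (k + n%:Z)) /geom; field.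
  by rewrite subr_eq0 gt_eqF.
exact: lerD.
Qed.

Lemma net_cvg x (e : R) : 0 < e -> exists N : nat, forall n : nat, (N <= n)%N ->
  mdist (j x) (iv (net_vertex n%:Z x)) < e.
Proof.
move=> e0.
have := @bdry x (fun n => net_pt n%:Z x) (fun n => net_ptP n%:Z x).
move=> /metricType_numDomainType.cvgr_dist_lt/(_ _ e0) -[N _ H].
by exists N => n Nn; exact: H.
Qed.

Lemma net_dist k x : mdist (j x) (iv (net_vertex k x)) <= geom * r k.
Proof.
apply/ler_addgt0Pr => e e0; have [N HN] := net_cvg x e0.
pose n := (N + `|k|)%N.
have kn : exists m : nat, k + m%:Z = n%:Z.
  exists `|n%:Z - k|%N; rewrite gez0_abs; first by rewrite addrCA subrr addr0.
  rewrite subr_ge0 (le_trans (ler_norm k))// -abszE lez_nat leq_addl//.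
have [m km] := kn.
apply: le_trans (metric_triangle _ (iv (net_vertex n%:Z x)) _) _.
rewrite addrC lerD//; last by rewrite ltW// HN// leq_addr.
rewrite metric_sym -km (le_trans (net_chain_dist _ _ _))//.
rewrite ler_wpM2l// ?(le_trans ler01 geom_ge1)//.
by rewrite lerBlDr lerDl ltW.
Qed.

(** [iota_lipschitz] passes to the boundary point [j z], where the value of the extension is the
    limit of [phi] along the vertical chain over [z]. *)
Lemma boundary_lipschitz (phi : vertex -> R) (K l : R) z x : 0 <= K ->
  (forall v w, E v w ->
    `|phi v - phi w| <= K * alpha `^ (- Num.max v.2%:~R w.2%:~R)) ->
  (forall e, 0 < e -> exists N : nat, forall n : nat, (N <= n)%N ->
    `|phi (net_vertex n%:Z z) - l| <= e) ->
  X x -> `|affine_ext phi x - l| <= K * alpha ^+ 3 * mdist (iota x) (j z).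
Proof.
move=> K0 phiE phil Xx; apply/ler_addgt0Pr => e e0.
have K30 : 0 <= K * alpha ^+ 3 by rewrite mulr_ge0// exprn_ge0// ltW.
have K31 : 0 < K * alpha ^+ 3 + 1 by rewrite ltr_wpDl.
have e20 : 0 < e / 2 by rewrite divr_gt0.
have [N1 H1] := phil _ e20.
have [N2 H2] := net_cvg z (divr_gt0 e20 K31).
pose n := maxn N1 N2.
have {}H1 := H1 n (leq_maxl _ _); have {}H2 := H2 n (leq_maxr _ _).
have XV : X (edge_pt (net_vertex n%:Z z) (net_vertex n%:Z z) 0).
  exact/X_vertex/vertices_net.
have := iota_lipschitz K0 phiE Xx XV.
rewrite affine_ext_edge subr0 mul1r mul0r addr0 => H3.
have : mdist (iota x) (iv (net_vertex n%:Z z)) <=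
    mdist (iota x) (j z) + e / 2 / (K * alpha ^+ 3 + 1).
  by apply: le_trans (metric_triangle _ (j z) _) _; rewrite lerD2l ltW.
move=> /(ler_wpM2l K30); rewrite mulrDr => H4.
have H5 : K * alpha ^+ 3 * (e / 2 / (K * alpha ^+ 3 + 1)) <= e / 2.
  by rewrite mulrCA ler_piMr ?(ltW e20)// ler_pdivrMr// mul1r lerDl.
apply: le_trans (ler_distD (phi (net_vertex n%:Z z)) _ _) _.
by rewrite /iv in H4; lra.
Qed.

(** [2 * tau * alpha] bounds the increment of [base_dist] along an edge, and [alpha ^+ 3] is the
    factor of [d_rho_lipschitz]. *)
Definition lipB : R := 2 * tau * alpha * alpha ^+ 3.

Lemma lipB_gt0 : 0 < lipB.
Proof. by rewrite /lipB !mulr_gt0// exprn_gt0. Qed.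

Lemma base_dist_lipschitz x0 z x : X x ->
  `|affine_ext (base_dist x0) x - mdist x0 z| <= lipB * mdist (iota x) (j z).
Proof.
move=> Xx; apply: boundary_lipschitz => //.
- by rewrite !mulr_ge0// ltW.
- exact: base_dist_edge.
- move=> e e0; have [N HN] := exprz_small alpha1 e0; exists N => n /HN.
  apply: le_trans; have [_ /ltW] := net_ptP n z; apply: le_trans.
  rewrite /base_dist/= ler_norml.
  have := metric_triangle x0 z (net_pt n z).
  have := metric_triangle x0 (net_pt n z) z.
  by rewrite (metric_sym z (net_pt _ _)); lra.
Qed.

(** [base_dist_lipschitz] is applied to the vertices of the chain over [x], which converge to [j x]
    while their distance to [x] tends to 0. *)
Lemma dist_le_boundary_dist x y : mdist x y <= lipB * mdist (j x) (j y).
Proof.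
apply/ler_addgt0Pr => e e0.
have L1 : 0 < lipB + 1 by rewrite ltr_wpDl// ltW// lipB_gt0.
have [N1 H1] := net_cvg x (divr_gt0 e0 L1).
have [N2 H2] := exprz_small alpha1 (divr_gt0 e0 L1).
pose n := maxn N1 N2.
have {}H1 := H1 n (leq_maxl _ _); have {}H2 := H2 n (leq_maxr _ _).
have := base_dist_lipschitz x y (X_vertex (vertices_net n x)).
rewrite affine_ext_edge subr0 mul1r mul0r addr0 /base_dist/= => H3.
have [_ H4] := net_ptP n x.
have H5 := metric_triangle (iv (net_vertex n x)) (j x) (j y).
rewrite metric_sym in H1.
have H6 := ler_wpM2l (ltW lipB_gt0) H5.
have H7 := ler_wpM2l (ltW lipB_gt0) (ltW H1).
have H8 : lipB * (e / (lipB + 1)) + e / (lipB + 1) = e.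
  by field; rewrite gt_eqF.
move: H3; rewrite ler_norml => /andP[H3 _].
rewrite metric_sym in H4; rewrite /iv in H6, H7.
by move: H3 H6; rewrite mulrDr; lra.
Qed.

(** Two points are joined by two vertical chains, each costing [geom], and one horizontal edge,
    costing 1, at the level given by their distance; [alpha] is the loss in rounding this distance
    to a level. *)
Definition lipJ : R := (2 * geom + 1) * alpha.

Lemma boundary_dist_le_dist x y : mdist (j x) (j y) <= lipJ * mdist x y.
Proof.
have [->|xy] := eqVneq x y; first by rewrite !mdistxx mulr0.
have xy0 : 0 < mdist x y by rewrite mdist_gt0.
have [k /andP[k1 k2]] := exprz_scale alpha1 xy0.
have g1 := geom_ge1.
have H : mdist (iv (net_vertex k x)) (iv (net_vertex k y)) <= r k.
  have [->|/eqP vw] := eqVneq (net_vertex k x) (net_vertex k y).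
    by rewrite mdistxx ltW.
  have := @iv_edge (net_vertex k x) (net_vertex k y); rewrite /= min_l// powRN_int//.
  apply; apply: (@edge_intro _ _ y) => //; try exact: vertices_net.
  - by rewrite subrr normr0.
  - have [_ h] := net_ptP k x.
    apply: le_lt_trans (metric_triangle _ x _) _ => /=.
    have := rgt0 k; have := tau3; nra.
  - have [_ h] := net_ptP k y; apply: lt_trans h _ => /=; have := rgt0 k; have := tau3; nra.
have h1 := net_dist k x; have h2 := net_dist k y.
apply: (@le_trans _ _ ((2 * geom + 1) * r k)).
  apply: le_trans (metric_triangle _ (iv (net_vertex k x)) _) _.
  have := metric_triangle (iv (net_vertex k x)) (iv (net_vertex k y)) (j y).
  by rewrite (metric_sym (iv (net_vertex k y)) (j y)); lra.
by rewrite /lipJ -mulrA ler_wpM2l ?(ltW k2)//; lra.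
Qed.

(** [(alpha - 1) * alpha ^+ 3] is the Lipschitz constant of the radius, which vanishes on the
    boundary; the first [alpha] passes from the radius at the higher end of an edge to the radius at
    either end. *)
Definition lipH : R := alpha * ((alpha - 1) * alpha ^+ 3).
Definition lipC : R := lipB + 2 * tau * alpha * lipH.

(** The first bound compares the radius with its boundary value 0. The second combines the distance
    to [z] at the given point of the edge with its increment along the edge, which is controlled by
    the first; this is the origin of [lipC]. *)
Lemma edge_near_boundary v w t z (s : R) : E v w -> t \in `[0, 1] ->
  mdist (j z) (edge_curve v w t) < s ->
  r v.2 <= lipH * s /\ mdist v.1 z <= lipC * s.
Proof.
move=> vw t01; rewrite metric_sym => xs.
have Xx := filling_edge_pt vw t01.
have s0 : 0 <= s by rewrite (le_trans _ (ltW xs))// mdist_ge0.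
have a1 : 0 <= alpha - 1 by rewrite subr_ge0 ltW.
have a30 : 0 <= alpha ^+ 3 by rewrite exprn_ge0// ltW.
have rlim e : 0 < e -> exists N : nat, forall n : nat, (N <= n)%N ->
    `|r (net_vertex n%:Z z).2 - 0| <= e.
  move=> e0; have [N HN] := exprz_small alpha1 e0; exists N => n /HN.
  by rewrite subr0 /= ger0_norm// ltW.
have := @boundary_lipschitz (fun v => r v.2) (alpha - 1) 0 z _ a1 (@radius_edge) rlim Xx.
rewrite subr0 affine_ext_edge => H.
have rv : r v.2 <= lipH * s.
  apply: le_trans (edge_maxl vw) _; rewrite /lipH -mulrA ler_wpM2l ?(ltW alpha0)//.
  apply: le_trans (le_trans _ H) _; last first.
    by rewrite ler_wpM2l ?(ltW xs)// mulr_ge0.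
  apply: le_trans (ler_norm _).
  have h1 := edge_max_le v w; have := edge_max_le w v; rewrite maxC => h2.
  move: t01; rewrite in_itv/= => /andP[t0 t1].
  by move: (alpha `^ _) h1 h2 => a; nra.
split => //.
have := base_dist_lipschitz z z Xx; rewrite mdistxx subr0 affine_ext_edge /base_dist => H2.
have H3 := base_dist_edge z vw; rewrite /base_dist in H3.
have H4 := edge_max_le v w.
have tt : 0 <= 2 * tau * alpha by rewrite !mulr_ge0// ltW.
have H5 : `|mdist z v.1 - mdist z w.1| <= 2 * tau * alpha * (lipH * s).
  by apply: le_trans H3 _; rewrite ler_wpM2l// (le_trans H4).
have H6 : lipB * mdist (iota (edge_pt v w t)) (j z) <= lipB * s.
  by rewrite ler_wpM2l ?(ltW lipB_gt0)// ltW.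
rewrite metric_sym /lipC mulrDl -(mulrA (2 * tau * alpha)).
move: H2 H5; rewrite !ler_norml => /andP[_ H2] /andP[_ H5].
move: t01; rewrite in_itv/= => /andP[t0 t1].
have H7 : t * (mdist z v.1 - mdist z w.1) <= 2 * tau * alpha * (lipH * s).
  have : 0 <= 2 * tau * alpha * (lipH * s) by rewrite mulr_ge0// (le_trans _ rv)// ltW.
  by move: (2 * tau * alpha * _) H5 => a; nra.
lra.
Qed.

(** A converse to the previous lemma. The three terms are the way along the edge to [v], the
    vertical chain from [v] to [j v.1], and the boundary distance from [j v.1] to [j z]. The factor
    3 leaves room for net points above points within twice the radius. *)
Lemma edge_inside v w t z (m : int) : E v w -> t \in `[0, 1] ->
  m <= v.2 -> mdist v.1 z <= 3 * r m ->
  mdist (j z) (edge_curve v w t) <= (alpha + geom + 3 * lipJ) * r m.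
Proof.
move=> vw t01 mv vz; have [Vv _ _ _ _] := vw.
have h1 : mdist (iv v) (edge_curve v w t) <= alpha * r m.
  have := edge_curve_lipschitz vw (_ : 0 \in `[0, 1]) t01.
  rewrite /edge_curve edge_pt0 => /(_ _)/le_trans; apply; first by rewrite in_itv/= lexx ler01.
  move: t01; rewrite in_itv/= => /andP[t0 t1].
  rewrite sub0r normrN ger0_norm// -mulrA ler_wpM2l ?(ltW alpha0)//.
  rewrite (le_trans (ler_piMr _ t1)) ?(ltW (rgt0 _))//.
  exact: ler_exprzN.
have h2 : mdist (j v.1) (iv v) <= geom * r m.
  have := net_dist v.2 v.1; rewrite net_vertex_id// => /le_trans; apply.
  by rewrite ler_wpM2l ?(le_trans ler01 geom_ge1)// ler_exprzN.
have h3 := boundary_dist_le_dist v.1 z.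
have J0 : 0 <= lipJ by rewrite /lipJ mulr_ge0 ?(ltW alpha0)//; have := geom_ge1; lra.
have h4 := ler_wpM2l J0 vz.
apply: le_trans (metric_triangle _ (j v.1) _) _; rewrite metric_sym.
have := metric_triangle (j v.1) (iv v) (edge_curve v w t).
rewrite !mulrDl; lra.
Qed.

End geometry.

(** * Volume of balls *)

Lemma open_lipschitz_lt (R : realType) (Z : completeMetricType R) (f : Z -> R)
    (K s : R) : 0 <= K -> (forall x y, `|f x - f y| <= K * mdist x y) ->
  open [set x | f x < s].
Proof.
move=> K0 fK; rewrite openE => x /= fx; apply/nbhs_ballP.
have K1 : 0 < K + 1 by rewrite ltr_wpDl.
exists ((s - f x) / (K + 1)) => /=; first by rewrite divr_gt0// subr_gt0.
move=> y; rewrite ballEmdist/= => xy; have := fK x y.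
rewrite ler_norml => /andP[h _].
have h1 : (K + 1) * mdist x y < s - f x by rewrite mulrC -ltr_pdivlMr.
have := mdist_ge0 x y; lra.
Qed.

Section volume.
Context {R : realType} {Z : completeMetricType R}.
Variables (alpha tau Cnu : R) (S : int -> set Z).
Variable nu : {outer_measure set Z -> \bar R}.
Hypothesis alpha1 : 1 < alpha.
Hypothesis tau3 : 3 < tau.
Hypothesis maxS : forall n : int, maximal_separated (alpha ^ (- n)) (S n).
Hypothesis mm : metric_measure nu.
Hypothesis dbl : doubling nu Cnu.
Local Notation vertex := (Z * int)%type.
Local Notation E := (filling_edge alpha tau S).
Local Notation r n := (alpha ^ (- n%R)).

Let alpha0 : 0 < alpha. Proof. exact: lt_trans alpha1. Qed.
Let tau0 : 0 < tau. Proof. by have := tau3; lra. Qed.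
Let rgt0 (n : int) : 0 < r n. Proof. exact: exprz_gt0. Qed.
Hint Resolve rgt0 : core.

Lemma open_cara (A : set Z) : open A -> nu.-cara.-measurable A.
Proof. by case: mm => -[H _] _; exact: H. Qed.

Lemma open_mball (z : Z) (s : R) : open (ball z s).
Proof.
rewrite ballEmdist; apply: (open_lipschitz_lt (K := 1)) => // x y.
rewrite mul1r ler_norml; have := metric_triangle z x y; have := metric_triangle z y x.
by rewrite (metric_sym y x); lra.
Qed.

Lemma ball_cara (z : Z) (s : R) : nu.-cara.-measurable (ball z s).
Proof. by apply: open_cara; exact: open_mball. Qed.

Lemma nu_mono (A B : set Z) : A `<=` B -> (nu A <= nu B)%E.
Proof. exact: le_outer_measure. Qed.

Definition vol (A : set Z) : R := fine (nu A).

Lemma volE z s : 0 < s -> nu (ball z s) = (vol (ball z s))%:E.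
Proof.
by case: mm => _ H /(H z) /andP[h0 h1]; rewrite /vol fineK// ge0_fin_numE// ltW.
Qed.

Lemma vol_gt0 z s : 0 < s -> 0 < vol (ball z s).
Proof.
move=> s0; rewrite -lte_fin -volE//.
by case: mm => _ /(_ z s s0) /andP[].
Qed.

Lemma ball_sub (x y : Z) (s t : R) : mdist y x + s <= t -> ball x s `<=` ball y t.
Proof.
move=> xyst w; rewrite !ballEmdist/= => xw.
by apply: le_lt_trans (metric_triangle y x w) _; lra.
Qed.

Lemma vol_mono x y s t : 0 < s -> 0 < t -> mdist y x + s <= t ->
  vol (ball x s) <= vol (ball y t).
Proof.
by move=> s0 t0 xyst; rewrite -lee_fin -!volE// nu_mono//; exact: ball_sub.
Qed.

(** Since [lambda] is at most 2 to the power [Num.bound lambda], this many doublings suffice; the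
    maximum makes the constant at least 1. *)
Definition dbl_const (lambda : R) : R := Num.max Cnu 1 ^+ Num.bound lambda.

Lemma dbl_const_ge1 lambda : 1 <= dbl_const lambda.
Proof. by rewrite /dbl_const exprn_ege1// le_max lexx orbT. Qed.

Lemma dbl_const_gt0 lambda : 0 < dbl_const lambda.
Proof. exact: lt_le_trans (dbl_const_ge1 _). Qed.

Lemma vol_doubling lambda x y s t : 0 < s -> 0 < t -> 0 <= lambda ->
  mdist y x + s <= lambda * t ->
  vol (ball x s) <= dbl_const lambda * vol (ball y t).
Proof.
move=> s0 t0 l0 xyst.
have pow2 (n : nat) : vol (ball y (2 ^+ n * t)) <= Num.max Cnu 1 ^+ n * vol (ball y t).
  elim: n => [|n ih]; first by rewrite !expr0 !mul1r.
  have p0 : 0 < 2 ^+ n * t by rewrite mulr_gt0// exprn_gt0.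
  have := dbl y p0; rewrite !volE ?mulr_gt0// -EFinM lee_fin !exprS -!mulrA => h.
  apply: le_trans h _.
  have h : Cnu * vol (ball y (2 ^+ n * t)) <= Num.max Cnu 1 * vol (ball y (2 ^+ n * t)).
    by rewrite ler_wpM2r ?le_max ?lexx// ltW// vol_gt0.
  by apply: le_trans h _; rewrite ler_wpM2l// le_max ler01 orbT.
apply: le_trans (pow2 (Num.bound lambda)).
apply: vol_mono => //; first by rewrite mulr_gt0// exprn_gt0.
apply: le_trans xyst _; rewrite ler_wpM2r ?(ltW t0)//.
apply: le_trans (ltW (archi_boundP l0)) _.
by rewrite -natrX ler_nat ltnW// ltn_expl.
Qed.

Local Notation vb v := (vball alpha tau v).

Lemma vball_radius_gt0 (v : vertex) : 0 < tau * r v.2.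
Proof. by rewrite mulr_gt0. Qed.

Lemma vol_vball_gt0 v : 0 < vol (vb v).
Proof. exact: vol_gt0 (vball_radius_gt0 v). Qed.

Lemma nu_vball v : nu (vb v) = (vol (vb v))%:E.
Proof. exact: volE (vball_radius_gt0 v). Qed.

Lemma vball_disjoint n x y w : S n x -> S n y ->
  ball x (r n / 2) w -> ball y (r n / 2) w -> x = y.
Proof.
move=> Sx Sy; rewrite !ballEmdist/= => xw yw; apply/eqP; apply: contrapT => /negP xy.
have [sep _] := maxS n; have := sep _ _ Sx Sy xy.
have := metric_triangle x w y; rewrite (metric_sym w y); lra.
Qed.

(** The balls [vball] overlap, but the concentric balls of radius half the separation are disjoint,
    lie in the large ball, and have comparable volume by doubling; the radii have ratio
    [2 * tau]. *)
Lemma net_sum_vol (F : seq vertex) n u s : uniq F -> 0 < s ->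
  (forall v, v \in F -> [/\ vertices S v, v.2 = n & mdist u v.1 + r n / 2 <= s]) ->
  \sum_(v <- F) vol (vb v) <= dbl_const (2 * tau) * vol (ball u s).
Proof.
move=> uF s0 HF.
have n20 : 0 < r n / 2 by rewrite divr_gt0.
have h v : v \in F -> vol (vb v) <= dbl_const (2 * tau) * vol (ball v.1 (r n / 2)).
  move=> /HF[_ vn _]; apply: vol_doubling => //.
  - exact: vball_radius_gt0.
  - by rewrite mulr_ge0// ltW.
  - by rewrite mdistxx add0r vn; lra.
have : \sum_(v <- F) vol (vb v) <=
    \sum_(v <- F) dbl_const (2 * tau) * vol (ball v.1 (r n / 2)).
  by rewrite big_seq [leRHS]big_seq; apply: ler_sum => v /h.
move/le_trans; apply; rewrite -mulr_sumr ler_wpM2l ?(ltW (dbl_const_gt0 _))//.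
rewrite -lee_fin -sumEFin -volE//.
(* The volume is written as the integral of 1, a function that dominates the step functions of the
   disjoint balls. *)
have -> : nu (ball u s) = (\int[nu : set (caratheodory_type nu) -> \bar R]_(x in ball u s) 1)%E.
  by rewrite integral_cst ?mul1e//; exact: ball_cara.
under eq_bigr do rewrite -volE// -[nu _]mul1e.
apply: (@sum_cst_le_integral _ (caratheodory_type nu) R nu) => //.
- by move=> v _; exact: ball_cara.
- by move=> v /HF[_ _ vs]; apply: ball_sub; rewrite metric_sym metric_sym.
- move=> v w x /HF[Vv vn _] /HF[Vw wn _] vx wx.
  move: Vv Vw; rewrite /vertices/= vn wn => Vv Vw.
  rewrite [v]surjective_pairing [w]surjective_pairing vn wn.
  by rewrite (vball_disjoint Vv Vw vx wx).
Qed.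

(** By doubling every such vertex has at least a fixed share of the volume of one large ball, so
    [net_sum_vol] bounds their number. *)
Lemma finite_net n u (s : R) : finite_set [set v | vertices S v /\ v.2 = n /\ mdist u v.1 <= s].
Proof.
apply: contrapT => infA.
have s'0 : 0 < `|s| + tau * r n by rewrite ltr_wpDl// mulr_gt0.
set c := vol (ball u (`|s| + tau * r n)).
pose lam := (`|s| + (`|s| + tau * r n)) / (tau * r n).
have lam0 : 0 <= lam.
  by rewrite divr_ge0 ?addr_ge0 ?mulr_ge0 ?(ltW tau0) ?(ltW (rgt0 n)).
have c0 : 0 < c by exact: vol_gt0.
pose N := Num.bound (dbl_const (2 * tau) * dbl_const lam).
have [B BA NB] := infinite_set_fset N infA.
have HB v : v \in finmap.enum_fset B -> [/\ vertices S v, v.2 = n & mdist u v.1 <= s].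
  by move=> /BA[Vv [vn us]].
have := @net_sum_vol (finmap.enum_fset B) n u (`|s| + tau * r n) (finmap.fset_uniq _) s'0.
have H v : v \in finmap.enum_fset B ->
    [/\ vertices S v, v.2 = n & mdist u v.1 + r n / 2 <= `|s| + tau * r n].
  move=> /HB[Vv vn us]; split => //; have := ler_norm s; have := tau3; have := rgt0 n; nra.
move=> /(_ H); rewrite -/c.
have : \sum_(v <- finmap.enum_fset B) (c / dbl_const lam) <= \sum_(v <- finmap.enum_fset B) vol (vb v).
  rewrite big_seq [leRHS]big_seq; apply: ler_sum => v /HB[Vv vn us].
  rewrite ler_pdivrMr ?dbl_const_gt0// mulrC; apply: vol_doubling => //.
    exact: vball_radius_gt0.
  rewrite vn /lam divfK; last by rewrite gt_eqF// mulr_gt0.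
  by rewrite metric_sym; have := ler_norm s; lra.
rewrite big_const_seq count_predT iter_addr_0 => /le_trans h /h.
rewrite -[X in X <= _]mulr_natr mulrAC ler_pdivrMr ?dbl_const_gt0// mulrAC.
rewrite (mulrC c) ler_pM2r// => {}h.
have := le_lt_trans h (archi_boundP (mulr_ge0 (ltW (dbl_const_gt0 (2 * tau)))
  (ltW (dbl_const_gt0 lam)))).
by rewrite ltr_nat ltnNge => /negP; apply.
Qed.

Lemma countable_vertices : countable (vertices S).
Proof.
have -> : vertices S = \bigcup_(k in [set: int * nat])
    [set v | vertices S v /\ v.2 = k.1 /\ mdist point v.1 <= k.2%:R].
  apply/seteqP; split => [v Vv|v [k _ []]//].
  exists (v.2, Num.bound (mdist point v.1)) => //; split => //; split => //=.
  by rewrite ltW// archi_boundP// mdist_ge0.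
apply: bigcup_countable; first exact: countableP.
by move=> k _; apply: finite_set_countable; exact: finite_net.
Qed.

Lemma vol_edge v w : E v w -> vol (vb v) <= dbl_const (2 * alpha + 1) * vol (vb w).
Proof.
move=> vw; have [_ _ _ _ [x []]] := vw; rewrite /vball !ballEmdist/= => vx wx.
have := edge_radius alpha1 (filling_edgeC vw) => rvw.
have ha : 0 <= 2 * alpha + 1 by rewrite addr_ge0// mulr_ge0// ltW.
rewrite -!ballEmdist.
apply: (vol_doubling (vball_radius_gt0 v) (vball_radius_gt0 w) ha).
have := metric_triangle w.1 x v.1; rewrite (metric_sym x).
have := ler_wpM2l (ltW tau0) rvw; lra.
Qed.

End volume.

(** * The measure on the uniformized filling *)

Section lipschitz_curves.
Context {R : realType} {Y : completeMetricType R}.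

Lemma lipschitz_open_preimage (c : R -> Y) (K : R) (U : set Y) :
  (forall s t, mdist (c s) (c t) <= K * `|s - t|) -> open U -> open (c @^-1` U).
Proof.
move=> cK oU; rewrite openE => s /= Us.
have /nbhs_ballP[e e0 eU] : nbhs (c s) U by exact: open_nbhs_nbhs.
have K1 : 0 < `|K| + 1 by rewrite ltr_wpDl.
apply/nbhs_ballP; exists (e / (`|K| + 1)) => /=; first by rewrite divr_gt0.
move=> t /= st; apply: eU; rewrite ballEmdist/=.
apply: le_lt_trans (cK s t) _.
have : `|s - t| * (`|K| + 1) < e by rewrite -ltr_pdivlMr.
have := ler_norm K; have := normr_ge0 (s - t); nra.
Qed.

Lemma lipschitz_measurable (c : R -> Y) (K : R) :
  (forall s t, mdist (c s) (c t) <= K * `|s - t|) ->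
  measurable_fun [set: R] (c : R -> borel_type Y).
Proof.
move=> cK; apply: (@measurability _ _ _ (borel_type Y) setT c (@open Y)) => // _ [U oU <-].
rewrite setTI; apply: open_measurable; exact: lipschitz_open_preimage cK oU.
Qed.

Lemma lipschitz_continuous (c : R -> Y) (K : R) :
  (forall s t, mdist (c s) (c t) <= K * `|s - t|) -> continuous c.
Proof.
by move=> cK; apply/continuousP => U oU; exact: lipschitz_open_preimage cK oU.
Qed.

Lemma compact_borel (A : set Y) : compact A -> measurable (A : set (borel_type Y)).
Proof.
move=> /(compact_closed (@metric_hausdorff _ Y)) cA.
rewrite -(setCK A); apply: measurableC; apply: sub_sigma_algebra.
exact: closed_openC.
Qed.

Definition clamp (t : R) : R := Num.max 0 (Num.min t 1).

Lemma clamp_itv t : clamp t \in `[0, 1].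
Proof. by rewrite in_itv/= /clamp le_max lexx ge_max ler01 ge_min lexx orbT. Qed.

Lemma clamp_id t : t \in `[0, 1] -> clamp t = t.
Proof. by rewrite in_itv/= /clamp => /andP[t0 t1]; rewrite min_l// max_r. Qed.

Lemma clamp_lipschitz s t : `|clamp s - clamp t| <= `|s - t|.
Proof.
have h (a b x : R) : `|Num.min a x - Num.min b x| <= `|a - b|.
  by have [?|?] := leP a x; have [?|?] := leP b x; rewrite ler_norml;
    have := ler_norm (a - b); have := ler_norm (b - a); rewrite (distrC b a) => *; apply/andP; split; lra.
have h' (a b x : R) : `|Num.max x a - Num.max x b| <= `|a - b|.
  by have [?|?] := leP x a; have [?|?] := leP x b; rewrite ler_norml;
    have := ler_norm (a - b); have := ler_norm (b - a); rewrite (distrC b a) => *; apply/andP; split; lra.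
exact: le_trans (h' _ _ _) (h _ _ _).
Qed.

End lipschitz_curves.

Lemma ge0_integral_mrestr d (T : measurableType d) (R : realType)
    (mu : {measure set T -> \bar R}) (D : set T) (mD : measurable D) (E : set T)
    (f : T -> \bar R) : measurable E ->
  (\int[mrestr mu mD]_(x in E) f x = \int[mu]_(x in E `&` D) f x)%E.
Proof.
move=> mE; rewrite (@integral_full_measure _ _ _ (mrestr mu mD) E D)//; last first.
  by rewrite /= /mrestr setICl measure0.
apply: eq_measure_integral => A mA AED; rewrite /= /mrestr.
by congr (mu _); apply/setIidPl => x /AED[].
Qed.

Section edge_measures.
Context {R : realType} {Z : completeMetricType R}.
Variables (alpha tau Cnu : R) (S : int -> set Z).
Variable nu : {outer_measure set Z -> \bar R}.
Hypothesis alpha1 : 1 < alpha.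
Hypothesis tau3 : 3 < tau.
Hypothesis maxS : forall n : int, maximal_separated (alpha ^ (- n)) (S n).
Hypothesis mm : metric_measure nu.
Hypothesis dbl : doubling nu Cnu.
Variables (Y : completeMetricType R) (iota : (Z * int -> R) -> Y) (j : Z -> Y).
Hypothesis compl : uniformized_completion alpha tau S iota.
Local Notation vertex := (Z * int)%type.
Local Notation X := (filling alpha tau S).
Local Notation E := (filling_edge alpha tau S).
Local Notation r n := (alpha ^ (- n%R)).
Local Notation lam := (@lebesgue_measure R).
Local Notation Xp := (Xpart alpha tau S iota).
Local Notation vb v := (vball alpha tau v).

Let alpha0 : 0 < alpha. Proof. exact: lt_trans alpha1. Qed.

Definition edges : set (vertex * vertex) := [set e | E e.1 e.2].

Lemma countable_edges : countable edges.
Proof.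
apply: (@sub_countable _ _ _ (vertices S `*` vertices S)).
  by apply: subset_card_le => -[v w] [].
by apply: countableX; exact: (countable_vertices alpha1 tau3 maxS mm dbl).
Qed.

(** A total version of the edge curve, constant beyond the ends of the edge and on pairs that are
    not edges, so that it is Lipschitz and hence Borel on the whole line for every index. *)
Definition ce (e : vertex * vertex) (t : R) : Y :=
  if `[< E e.1 e.2 >] then edge_curve iota e.1 e.2 (clamp t) else point.

Lemma ceE e t : edges e -> t \in `[0, 1] -> ce e t = edge_curve iota e.1 e.2 t.
Proof. by move=> Ee t01; rewrite /ce asboolT// clamp_id. Qed.

Lemma ce_lipschitz e s t :
  mdist (ce e s) (ce e t) <= alpha * r e.1.2 * `|s - t|.
Proof.
have K0 : 0 <= alpha * r e.1.2 by rewrite mulr_ge0 ?exprz_ge0 ?(ltW alpha0).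
rewrite /ce; case: asboolP => [Ee|_]; last by rewrite mdistxx mulr_ge0.
apply: le_trans (edge_curve_lipschitz alpha1 compl Ee (clamp_itv s) (clamp_itv t)) _.
by rewrite ler_wpM2l// clamp_lipschitz.
Qed.

Lemma measurable_ce e :
  measurable_fun [set: measurableTypeR R] (ce e : measurableTypeR R -> borel_type Y).
Proof. exact: lipschitz_measurable (ce_lipschitz e). Qed.

Lemma ce_Xpart e t : edges e -> Xp (ce e t).
Proof.
move=> Ee; rewrite /ce asboolT//; exists (edge_pt e.1 e.2 (clamp t)) => //.
by apply: filling_edge_pt => //; exact: clamp_itv.
Qed.

Lemma XpartP y : Xp y -> exists e t, [/\ edges e, t \in `[0, 1] & y = ce e t].
Proof.
move=> [x /(fillingP alpha1 tau3 maxS)[v [w [t [vw t01 ->]]]] <-].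
by exists (v, w), t; split => //; rewrite ceE.
Qed.

Lemma bigcup_edges_measurable (F : vertex * vertex -> set Y) :
  (forall e, edges e -> measurable (F e : set (borel_type Y))) ->
  measurable (\bigcup_(e in edges) F e : set (borel_type Y)).
Proof.
move=> mF; have [/eqP ->|/set0P[e0 Ee0]] := boolP (edges == set0).
  by rewrite bigcup_set0.
have /countable_injP[f injf] := countable_edges.
pose g n := xget e0 [set e | edges e /\ f e = n].
have gK e : edges e -> g (f e) = e.
  move=> Ee; have : exists e', edges e' /\ f e' = f e by exists e.
  by move=> /(xgetPex e0)[Eg fg]; exact: (injf _ _ (mem_set Eg) (mem_set Ee) fg).
have -> : \bigcup_(e in edges) F e = \bigcup_(n in f @` edges) F (g n).
  apply/seteqP; split => [y [e Ee Fy]|y [_ [e Ee <-] Fy]].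
    by exists (f e) => /=; [exists e|rewrite gK].
  by exists e => //; rewrite gK in Fy.
by apply: bigcup_measurable => _ [e Ee <-]; rewrite gK//; exact: mF.
Qed.

Lemma edge_image_measurable e (C : set R) : closed C ->
  measurable (ce e @` (`[0%R, 1%R]%classic `&` C) : set (borel_type Y)).
Proof.
move=> clC; apply: compact_borel; apply: continuous_compact.
  by apply: continuous_subspaceT; exact: lipschitz_continuous (ce_lipschitz e).
by apply: compact_closedI => //; exact: segment_compact.
Qed.

Lemma measurable_Xpart : measurable (Xp : set (borel_type Y)).
Proof.
have -> : Xp = \bigcup_(e in edges) ce e @` (`[0%R, 1%R]%classic `&` setT).
  apply/seteqP; split => [y /XpartP[e [t [Ee t01 ->]]]|y [e Ee [t _ <-]]].
    by exists e => //; exists t.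
  exact: ce_Xpart.
apply: bigcup_edges_measurable => e Ee; apply: edge_image_measurable; exact: closedT.
Qed.

(** On each edge a superlevel set of [G] is closed in the parameter, so its image is compact; the
    whole superlevel set is a union of such images over the countably many edges. *)
Lemma measurable_fun_Xpart (G : Y -> R) :
  (forall e, edges e -> exists K : R, forall s t, s \in `[0, 1] -> t \in `[0, 1] ->
    `|G (ce e s) - G (ce e t)| <= K * `|s - t|) ->
  measurable_fun (Xp : set (borel_type Y)) G.
Proof.
move=> GK; apply: (measurability (@RGenCInfty.G R)) => [|/= _ [_] [a] -> <-].
  exact: RGenCInfty.measurableE.
have -> : Xp `&` G @^-1` `[a, +oo[%classic =
    \bigcup_(e in edges) ce e @` (`[0%R, 1%R]%classic `&` [set t | a <= G (ce e (clamp t))]).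
  apply/seteqP; split => [y [/XpartP[e [t [Ee t01 ->]]] /=]|y [e Ee [t [t01 /= at_] <-]]].
    rewrite in_itv/= andbT => aG; exists e => //; exists t => //; split => //=.
    by rewrite clamp_id.
  by split; [exact: ce_Xpart|rewrite /= in_itv/= andbT -(clamp_id t01)].
apply: bigcup_edges_measurable => e Ee; apply: edge_image_measurable.
have [K HK] := GK _ Ee.
have H (s t : R) : `|G (ce e (clamp s)) - G (ce e (clamp t))| <= `|K| * `|s - t|.
  apply: le_trans (HK _ _ (clamp_itv s) (clamp_itv t)) _.
  apply: le_trans (ler_wpM2r (normr_ge0 _) (ler_norm K)) _.
  by rewrite ler_wpM2l// clamp_lipschitz.
have cG : continuous (fun t : R => G (ce e (clamp t))).
  move=> t; apply/cvgrPdist_lt => e' e'0; near=> s.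
  apply: le_lt_trans (H t s) _.
  have K1 : 0 < `|K| + 1 by rewrite ltr_wpDl.
  have : `|t - s| < e' / (`|K| + 1).
    by near: s; apply: cvgr_dist_lt => //; rewrite divr_gt0.
  by rewrite ltr_pdivlMr// => h; have := normr_ge0 (t - s); lra.
have := @preimage_closed _ _ (fun t : R => G (ce e (clamp t))) [set x | a <= x].
by apply; [move=> t _; exact: cG|exact: closed_ge].
Unshelve. all: by end_near. Qed.

Let m01 : measurable (`[0%R, 1%R]%classic : set R).
Proof. exact: measurable_itv. Qed.

Definition edge_measure e : {measure set (borel_type Y) -> \bar R} :=
  measure_function_pushforward__canonical__measure_function_Measure
    (mrestr lam m01) (measurable_ce e).

Lemma integral_edge_measure e (D : set (borel_type Y)) (G : borel_type Y -> \bar R) :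
  measurable D -> measurable_fun D G -> (forall y, D y -> 0 <= G y)%E ->
  (\int[edge_measure e]_(y in D) G y =
   \int[lam]_(t in `[0%R, 1%R]%classic `&` ce e @^-1` D) G (ce e t))%E.
Proof.
move=> mD mG G0; rewrite ge0_integral_pushforward//; first last.
- by move=> y /set_mem Dy; exact: G0.
- exact: measurable_ce.
rewrite (ge0_integral_mrestr lam m01); first by rewrite setIC.
by rewrite -[X in measurable X]setTI; exact: measurable_ce.
Qed.

Definition edge_weight (e : vertex * vertex) : R := vol nu (vb e.1) + vol nu (vb e.2).

Lemma edge_weight_ge0 e : 0 <= edge_weight e.
Proof. by rewrite addr_ge0// fine_ge0. Qed.

Definition base_measure : {measure set (borel_type Y) -> \bar R} :=
  esum_measure edges (fun e => mscale (NngNum (edge_weight_ge0 e)) (edge_measure e)).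

Lemma filling_measureE :
  filling_measure alpha tau S iota nu = base_measure :> (set (borel_type Y) -> \bar R).
Proof.
apply/funext => A; rewrite /filling_measure esum_esum; last first.
  move=> v w _ _; apply: mule_ge0; last exact: measure_ge0.
  by apply: adde_ge0; exact: outer_measure_ge0.
have -> : vertices S `*`` E = edges.
  by apply/seteqP; split => -[v w] /=; [case|move=> vw; split => //; case: vw].
apply: eq_esum => -[v w] vw /=; rewrite /mscale/= /pushforward /mrestr/=.
rewrite !(nu_vball alpha1 tau3 mm) -EFinD; congr (_ * lam _)%E.
apply/seteqP; split => t /=.
  by move=> [t01 At]; split => //; rewrite ceE.
by move=> [+ t01]; rewrite ceE.
Qed.

Definition edge_pos (y : Y) : vertex -> R := iota_inv alpha tau S iota y.

Lemma edge_pos_ce e t : edges e -> t \in `[0, 1] -> edge_pos (ce e t) = edge_pt e.1 e.2 t.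
Proof.
move=> Ee t01; rewrite ceE// /edge_pos /edge_curve.
rewrite (iota_invK alpha1 tau3 maxS compl)//.
exact: filling_edge_pt.
Qed.

Variable beta : R.
Hypothesis beta0 : 0 < beta.

Definition density (y : Y) : R := alpha `^ (- beta * height (edge_pos y)).

Lemma density_gt0 y : 0 < density y. Proof. exact: powR_gt0. Qed.

(** The height on an edge differs by at most 1 from the level of its first end. *)
Lemma density_bounds e t : edges e -> t \in `[0, 1] ->
  alpha `^ (- beta) * alpha `^ (- beta * e.1.2%:~R) <= density (ce e t) <=
  alpha `^ beta * alpha `^ (- beta * e.1.2%:~R).
Proof.
move=> Ee t01; rewrite /density edge_pos_ce// height_edge.
rewrite -!powRD ?(gt_eqF alpha0) ?implybT// !ler_powR ?(ltW alpha1)//.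
  have := filling_edge_height Ee; move: t01; rewrite in_itv/= ler_norml.
  move=> /andP[t0 t1] /andP[h1 h2]; have b0 := beta0.
  have : t * (e.1.2%:~R - e.2.2%:~R) <= 1 by nra.
  by move=> /(ler_wpM2l (ltW b0)); nra.
have := filling_edge_height Ee; move: t01; rewrite in_itv/= ler_norml.
move=> /andP[t0 t1] /andP[h1 h2]; have b0 := beta0.
have : t * (e.2.2%:~R - e.1.2%:~R) <= 1 by nra.
by move=> /(ler_wpM2l (ltW b0)); nra.
Qed.

Lemma measurable_height : measurable_fun (Xp : set (borel_type Y)) (fun y => height (edge_pos y)).
Proof.
apply: measurable_fun_Xpart => e Ee; exists 1 => s t s01 t01.
rewrite !edge_pos_ce// !height_edge.
rewrite (_ : _ - _ = (s - t) * (e.2.2%:~R - e.1.2%:~R)); last by ring.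
by rewrite normrM mul1r ler_piMr// distrC (filling_edge_height Ee).
Qed.

Lemma measurable_density : measurable_fun (Xp : set (borel_type Y)) (EFin \o density).
Proof.
apply/measurable_EFinP.
apply: (@measurableT_comp _ _ _ _ _ _ (fun h => alpha `^ (- beta * h))); last exact: measurable_height.
have -> : (fun h => alpha `^ (- beta * h)) = (fun h => expR (- beta * h * ln alpha)).
  by apply/funext => h; rewrite /powR gt_eqF.
apply: (@measurableT_comp _ _ _ _ _ _ (@expR R)); first exact: measurable_expR.
by apply: measurable_funM => //; exact: measurable_funM.
Qed.

Lemma mu_betaE (A : set (borel_type Y)) :
  mu_beta alpha tau S iota nu beta A =
  (\int[base_measure]_(y in A `&` Xp) (density y)%:E)%E.
Proof. by rewrite /mu_beta filling_measureE. Qed.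

Let mu0 : mu_beta alpha tau S iota nu beta set0 = 0%E.
Proof. by rewrite mu_betaE set0I integral_set0. Qed.

Let mu_ge0 A : (0 <= mu_beta alpha tau S iota nu beta A)%E.
Proof.
by rewrite mu_betaE; apply: integral_ge0 => y _; rewrite lee_fin ltW// density_gt0.
Qed.

Let mu_sigma_additive : semi_sigma_additive (mu_beta alpha tau S iota nu beta).
Proof.
move=> F mF tF mUF; rewrite mu_betaE setI_bigcupl.
rewrite ge0_integral_bigcup//=.
- have -> : (fun n => \sum_(0 <= i < n) mu_beta alpha tau S iota nu beta (F i))%E =
      (fun n => \sum_(0 <= i < n) \int[base_measure]_(y in F i `&` Xp) (density y)%:E)%E.
    by apply/funext => n; apply: eq_bigr => i _; rewrite mu_betaE.
  apply: is_cvg_nneseries => n _ _.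
  by apply: integral_ge0 => y _; rewrite lee_fin ltW// density_gt0.
- by move=> k; apply: measurableI => //; exact: measurable_Xpart.
- rewrite -setI_bigcupl; apply: measurable_funS measurable_density => //.
  exact: measurable_Xpart.
- by move=> y _; rewrite lee_fin ltW// density_gt0.
- exact: trivIset_setIr.
Qed.

Definition mub : {measure set (borel_type Y) -> \bar R} :=
  HB.pack (mu_beta alpha tau S iota nu beta : set (borel_type Y) -> \bar R)
    (isMeasure.Build _ _ _ (mu_beta alpha tau S iota nu beta) mu0 mu_ge0 mu_sigma_additive).

Lemma mubE : mu_beta alpha tau S iota nu beta = mub :> (set (borel_type Y) -> \bar R).
Proof. by []. Qed.


(** Up to the factors of [density_bounds], the contribution of the ordered pair [e] to [mu_beta] of
    its edge. *)
Definition edge_mass (e : vertex * vertex) : R :=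
  alpha `^ (- beta * e.1.2%:~R) * edge_weight e.

Lemma edge_mass_ge0 e : 0 <= edge_mass e.
Proof. by rewrite mulr_ge0 ?powR_ge0 ?edge_weight_ge0. Qed.

Lemma scaled_mass_ge0 (c : R) e : 0 <= `|c| * edge_mass e.
Proof. by rewrite mulr_ge0 ?edge_mass_ge0. Qed.

Let scaled_measure (c : R) : {measure set (borel_type Y) -> \bar R} :=
  esum_measure edges (fun e => mscale (NngNum (scaled_mass_ge0 c e)) (edge_measure e)).

Let mub_esum (A : set (borel_type Y)) : measurable A ->
  mub A = (\esum_(e in edges) (edge_weight e)%:E *
    \int[lam]_(t in `[0%R, 1%R]%classic `&` ce e @^-1` A) (density (ce e t))%:E)%E.
Proof.
move=> mA; have mAX : measurable (A `&` Xp : set (borel_type Y)).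
  by apply: measurableI => //; exact: measurable_Xpart.
have mdens : measurable_fun (A `&` Xp : set (borel_type Y)) (EFin \o density).
  by apply: measurable_funS measurable_density => //; exact: measurable_Xpart.
have d0 y : (0 <= (density y)%:E)%E by rewrite lee_fin ltW// density_gt0.
rewrite -mubE mu_betaE ge0_integral_esum_measure//.
apply: eq_esum => e Ee; rewrite ge0_integral_mscale//=; congr (_ * _)%E.
rewrite integral_edge_measure//; congr (integral _ _ _).
apply/seteqP; split => t [t01 /=]; first by case.
by move=> At; split => //; split => //; exact: ce_Xpart.
Qed.

Let edge_measurable_preimage e (A : set (borel_type Y)) : measurable A ->
  measurable (`[0%R, 1%R]%classic `&` ce e @^-1` A : set (measurableTypeR R)).
Proof.
move=> mA; apply: measurableI => //.
by rewrite -[X in measurable X]setTI; exact: measurable_ce.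
Qed.

Let scaled_measureE c (A : set (borel_type Y)) : scaled_measure c A =
  (\esum_(e in edges) (`|c| * edge_mass e)%:E * lam (`[0%R, 1%R]%classic `&` ce e @^-1` A))%E.
Proof.
apply: eq_esum => e Ee; rewrite /mscale/= /pushforward /mrestr.
by rewrite setIC.
Qed.

Let mub_ge (A : set (borel_type Y)) : measurable A ->
  (scaled_measure (alpha `^ (- beta)) A <= mub A)%E.
Proof.
move=> mA; rewrite mub_esum// scaled_measureE; apply: le_esum => e Ee.
rewrite ger0_norm ?powR_ge0// /edge_mass mulrA mulrC EFinM -muleA.
rewrite lee_wpmul2l ?lee_fin ?edge_weight_ge0//.
rewrite -integral_cst; last exact: edge_measurable_preimage.
apply: ge0_le_integral_nm => t [t01 _]; rewrite lee_fin.
  by rewrite mulr_ge0 ?powR_ge0.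
by have /andP[] := density_bounds Ee t01.
Qed.

Let mub_le (A : set (borel_type Y)) : measurable A ->
  (mub A <= scaled_measure (alpha `^ beta) A)%E.
Proof.
move=> mA; rewrite mub_esum// scaled_measureE; apply: le_esum => e Ee.
rewrite ger0_norm ?powR_ge0// /edge_mass mulrA [(_ * edge_weight _)%R]mulrC EFinM -muleA.
rewrite lee_wpmul2l ?lee_fin ?edge_weight_ge0//.
rewrite -[leRHS]integral_cst; last exact: edge_measurable_preimage.
apply: ge0_le_integral_nm => t [t01 _]; rewrite lee_fin.
  by rewrite ltW// density_gt0.
by have /andP[] := density_bounds Ee t01.
Qed.

(** [mu_beta] dominates the measure with constant weight [edge_mass] on each edge, whose integrals
    are explicit sums; finitely many edges contained in [D] are kept. The companion bound from above
    runs over all edges. *)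
Lemma mub_integral_ge (s : seq (vertex * vertex)) (D : set (borel_type Y))
    (G : borel_type Y -> \bar R) :
  uniq s -> (forall e, e \in s -> edges e) ->
  measurable D -> measurable_fun D G -> (forall y, D y -> 0 <= G y)%E ->
  (forall e t, e \in s -> t \in `[0, 1] -> D (edge_curve iota e.1 e.2 t)) ->
  (\sum_(e <- s) (alpha `^ (- beta) * edge_mass e)%:E *
    \int[lam]_(t in `[0%R, 1%R]) G (edge_curve iota e.1 e.2 t) <=
   \int[mub]_(y in D) G y)%E.
Proof.
move=> us sE mD mG G0 sD.
apply: le_trans (ge0_le_measure_integral mub_ge G0).
rewrite ge0_integral_esum_measure//.
apply: esum_ge; exists [set` s].
  by split => [|e /= /sE//]; exact: finite_seq.
rewrite -fsbig_seq// big_seq [leRHS]big_seq; apply: lee_sum => e es.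
rewrite ge0_integral_mscale//= ger0_norm ?powR_ge0//.
rewrite lee_wpmul2l//.
  by rewrite lee_fin; apply: mulr_ge0; [exact: powR_ge0|exact: edge_mass_ge0].
have := integral_edge_measure e mD mG G0; rewrite /= => ->; have Ee := sE _ es.
have -> : `[0%R, 1%R]%classic `&` ce e @^-1` D = `[0%R, 1%R]%classic.
  by apply/setIidPl => t t01 /=; rewrite ceE//; exact: sD.
rewrite le_eqVlt; apply/orP; left; apply/eqP; apply: eq_integral => t.
by move=> /set_mem t01; rewrite ceE.
Qed.

Lemma mub_integral_le (D : set (borel_type Y)) (G : borel_type Y -> \bar R) :
  measurable D -> measurable_fun D G -> (forall y, D y -> 0 <= G y)%E ->
  (\int[mub]_(y in D) G y <=
   \esum_(e in edges) (alpha `^ beta * edge_mass e)%:E *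
    \int[lam]_(t in `[0%R, 1%R]%classic `&` edge_curve iota e.1 e.2 @^-1` D)
      G (edge_curve iota e.1 e.2 t))%E.
Proof.
move=> mD mG G0; apply: le_trans (ge0_le_measure_integral mub_le G0) _.
rewrite ge0_integral_esum_measure//; apply: le_esum => e Ee.
rewrite ge0_integral_mscale//= ger0_norm ?powR_ge0//.
rewrite lee_wpmul2l//.
  by rewrite lee_fin; apply: mulr_ge0; [exact: powR_ge0|exact: edge_mass_ge0].
have := integral_edge_measure e mD mG G0; rewrite /= => ->.
rewrite le_eqVlt; apply/orP; left; apply/eqP.
have -> : `[0%R, 1%R]%classic `&` ce e @^-1` D =
    `[0%R, 1%R]%classic `&` edge_curve iota e.1 e.2 @^-1` D.
  by apply/seteqP; split => t [/= t01]; rewrite ceE.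
apply: eq_integral => t; by move=> /set_mem[t01 _]; rewrite ceE.
Qed.

Lemma mub_boundary : mub (~` Xp) = 0%E.
Proof. by rewrite -mubE mu_betaE setICl integral_set0. Qed.

End edge_measures.

(** * Line integrals along edges *)

(** Lebesgue measure is the infimum of total lengths of countable covers by half-open intervals, and
    [m] is countably subadditive on each cover. *)
Lemma le_lebesgue_measure (R : realType)
    (m : {measure set (measurableTypeR R) -> \bar R}) (K : R) : 0 < K ->
  (forall a b : R, a <= b -> (m `]a, b]%classic <= (K * (b - a))%:E)%E) ->
  forall A, measurable A -> (m A <= K%:E * lebesgue_measure A)%E.
Proof.
move=> K0 mK A mA.
rewrite -lee_pdivrMl//; apply: le_ereal_inf_tmp => _ [F [mF AF] <-].
rewrite lee_pdivrMl//.
have mF' k : measurable (F k : set (measurableTypeR R)).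
  by apply: sub_sigma_algebra; exact: mF.
apply: le_trans (measure_sigma_subadditive m _ _ AF) _ => //.
rewrite -nneseriesZl//.
apply: lee_nneseries => [*|k _]; first exact: measure_ge0.
have [[x1 x2] _ <-] := mF k.
have [x12|x21] := leP x1 x2; last by rewrite set_itv_ge ?measure0 ?mule_ge0 ?lee_fin ?(ltW K0)//= bnd_simp -leNgt ltW.
by rewrite /= wlength_itv_bnd// -EFinM mK.
Qed.

Section line_integral_upper.
Context {R : realType} {T : Type} (d : T -> T -> \bar R).
Hypothesis hd : edist d.
Variables (c : R -> T) (K : R).
Hypotheses (K0 : 0 < K) (cc : curve_continuous d c 0 1)
  (Lfin : (curve_length d c 0 1 < +oo)%E).
Hypothesis lenK : forall s t, 0 <= s -> s <= t -> t <= 1 ->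
  (curve_length d c s t <= (K * (t - s))%:E)%E.
Local Notation lam := (@lebesgue_measure R).

Let L : R := fine (curve_length d c 0 1).
Let L0 : 0 <= L. Proof. by rewrite fine_ge0// curve_length_ge0. Qed.
(** Clamping the arc length makes the choice of times nondecreasing on the whole line, hence
    measurable. *)
Let arc (l : R) : R := arclength_inv d c 0 1 (Num.max 0 (Num.min l L)).

Let clampL_itv l : 0 <= Num.max 0 (Num.min l L) <= L.
Proof. by rewrite le_max lexx ge_max L0 ge_min lexx orbT. Qed.

Let arc_homo : nondecreasing_fun arc.
Proof.
move=> l l' ll'; rewrite /arc.
set a := Num.max _ _; set b := Num.max _ _.
have ab : a <= b.
  by rewrite /a /b ge_max !le_max lexx/= le_min !ge_min ll' lexx !orbT.
have [a0 aL] := andP (clampL_itv l); have [b0 bL] := andP (clampL_itv l').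
move: ab; rewrite le_eqVlt => /predU1P[->//|ab].
exact: (arclength_inv_homo hd ler01 cc Lfin a0 ab bL).
Qed.

Let measurable_arc : measurable_fun [set: measurableTypeR R] (arc : measurableTypeR R -> measurableTypeR R).
Proof. exact: (nondecreasing_measurable measurableT arc_homo). Qed.

Let mL : measurable (`[0%R, L]%classic : set (measurableTypeR R)).
Proof. exact: measurable_itv. Qed.

Let arc_measure : {measure set (measurableTypeR R) -> \bar R} :=
  measure_function_pushforward__canonical__measure_function_Measure
    (mrestr lam mL) measurable_arc.

Let arc_itv l : arc l \in `[0, 1].
Proof. exact: arclength_inv_itv. Qed.

(** The arc lengths whose time falls in an interval lie between the lengths accumulated at its ends,
    and these differ by at most [K] times the duration. *)
Let arc_measure_le (A : set (measurableTypeR R)) : measurable A ->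
  (arc_measure A <= K%:E * lam A)%E.
Proof.
apply: le_lebesgue_measure => // a b ab; rewrite /= /pushforward /mrestr.
set a' := clamp a; set b' := clamp b.
have a'b' : 0 <= b' - a' <= b - a.
  rewrite /a' /b' /clamp; have [?|?] := leP a 1; have [?|?] := leP b 1;
    rewrite ?min_l ?min_r//; try lra.
  - by have [?|?] := leP 0 a; have [?|?] := leP 0 b; lra.
  - by have [?|?] := leP 0 a; rewrite max_r//; lra.
have [a'0 a'1] : 0 <= a' /\ a' <= 1.
  by have := clamp_itv a; rewrite in_itv/= => /andP[].
have [b'0 b'1] : 0 <= b' /\ b' <= 1.
  by have := clamp_itv b; rewrite in_itv/= => /andP[].
have /andP[ab0 ab1] := a'b'.
have ab' : a' <= b' by rewrite -subr_ge0.
have len_ab := fine_curve_lengthB hd Lfin a'0 ab' b'1.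
set la := fine (curve_length d c 0 a') in len_ab; set lb := fine _ in len_ab.
have lab : 0 <= lb - la <= K * (b' - a').
  rewrite -!lee_fin -len_ab curve_length_ge0//=; exact: lenK.
apply: (@le_trans _ _ (lam `[la, lb]%classic)).
  apply: le_measure; [apply/mem_set|apply/mem_set; exact: measurable_itv|].
    apply: measurableI; last exact: mL.
    by rewrite -[X in measurable X]setTI; apply: measurable_arc => //; exact: measurable_itv.
  move=> l [/= + +]; rewrite !in_itv/= => /andP[al lb'] /andP[l0 lL].
  have cl : Num.max 0 (Num.min l L) = l by rewrite min_l// max_r.
  have Tl := arclength_invK hd ler01 cc Lfin (introT andP (conj l0 lL)).
  rewrite /arc cl in al lb'.
  set t := arclength_inv _ _ _ _ _ in Tl al lb'.
  have := arclength_inv_itv d c ler01 l; rewrite -/t in_itv/= => /andP[t0 t1].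
  have at' : a' <= t by rewrite /a' /clamp ge_max t0 ge_min (ltW al).
  have tb' : t <= b' by rewrite /b' /clamp le_max le_min lb' t1 orbT.
  have := fine_curve_lengthB hd Lfin a'0 at' t1.
  have := fine_curve_lengthB hd Lfin t0 tb' b'1.
  have h1 := curve_length_ge0 hd c at'; have h2 := curve_length_ge0 hd c tb'.
  rewrite Tl /= => e1 e2; move: h1 h2; rewrite e1 e2 !lee_fin -/la -/lb.
  by move=> *; apply/andP; split; lra.
rewrite lebesgue_measure_itv/= lte_fin; case: ltP => _; last first.
  by rewrite lee_fin mulr_ge0 ?(ltW K0)//; lra.
rewrite -EFinB lee_fin; have /andP[_ /le_trans] := lab; apply.
by rewrite ler_wpM2l// ltW.
Qed.

(** A change of variables: the line integral is the integral of [g \o c] against the distribution of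
    the times [arc], which has density at most [K]. *)
Lemma line_integral_le (g : T -> \bar R) :
  measurable_fun (`[0%R, 1%R]%classic : set (measurableTypeR R)) (g \o c) ->
  (forall t, t \in `[0, 1] -> (0 <= g (c t))%E) ->
  (line_integral d c 0 1 g <= K%:E * \int[lam]_(t in `[0%R, 1%R]) g (c t))%E.
Proof.
move=> mg g0; rewrite /line_integral -/L.
have -> : (\int[lam]_(l in `[0%R, L]) g (c (arclength_inv d c 0 1 l)) =
    \int[mrestr lam mL]_l g (c (arc l)))%E.
  rewrite ge0_integral_mrestr// setTI; apply: eq_integral => l /set_mem /=.
  by rewrite in_itv/= /arc => /andP[l0 lL]; rewrite min_l// max_r.
have -> : (\int[mrestr lam mL]_l g (c (arc l)) =
    \int[arc_measure]_(t in `[0%R, 1%R]) g (c t))%E.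
  rewrite ge0_integral_pushforward//; first last.
  - by move=> t /set_mem t01; exact: g0.
  have -> // : arc @^-1` `[0%R, 1%R]%classic = setT.
  by apply/seteqP; split => // l _; exact: arc_itv.
have h1 (A : set (measurableTypeR R)) : measurable A ->
    (arc_measure A <= mscale (NngNum (ltW K0)) lam A)%E.
  by move=> mA; rewrite /mscale/=; exact: arc_measure_le.
apply: le_trans (ge0_le_measure_integral h1 _) _; first by move=> t /= /g0.
by rewrite ge0_integral_mscale.
Qed.

End line_integral_upper.

(** * The extension operator *)

Lemma edist_mdist (R : realType) (Y : completeMetricType R) :
  edist (fun x y : Y => (mdist x y)%:E).
Proof.
split => [x|x y|x y|x y z]; first by rewrite mdistxx.
- by rewrite lee_fin mdist_ge0.
- by rewrite metric_sym.
- by rewrite -EFinD lee_fin metric_triangle.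
Qed.

Section extension.
Context {R : realType} {Z : completeMetricType R}.
Variables (alpha tau Cnu : R) (S : int -> set Z).
Variable nu : {outer_measure set Z -> \bar R}.
Hypothesis alpha1 : 1 < alpha.
Hypothesis tau3 : 3 < tau.
Hypothesis maxS : forall n : int, maximal_separated (alpha ^ (- n)) (S n).
Hypothesis mm : metric_measure nu.
Hypothesis dbl : doubling nu Cnu.
Variables (Y : completeMetricType R) (iota : (Z * int -> R) -> Y) (j : Z -> Y).
Hypothesis compl : uniformized_completion alpha tau S iota.
Local Notation vertex := (Z * int)%type.
Local Notation X := (filling alpha tau S).
Local Notation E := (filling_edge alpha tau S).
Local Notation r n := (alpha ^ (- n%R)).
Local Notation lam := (@lebesgue_measure R).
Local Notation Xp := (Xpart alpha tau S iota).
Local Notation vb v := (vball alpha tau v).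
Local Notation md := (fun x y : Y => (mdist x y)%:E).
Local Notation ec := (edge_curve iota).
Variables (beta : R) (f : Z -> R).
Hypothesis beta0 : 0 < beta.

Let alpha0 : 0 < alpha. Proof. exact: lt_trans alpha1. Qed.

Definition edge_len v w t : R := fine (curve_length md (ec v w) 0 t).

Lemma edge_len_le v w s t : E v w -> 0 <= s -> s <= t -> t <= 1 ->
  (curve_length md (ec v w) s t <= (alpha * r v.2 * (t - s))%:E)%E.
Proof.
move=> vw s0 st t1; rewrite curve_lengthE; apply: ge_ereal_sup => _ [p + <-].
elim: p s s0 st => [|y p ih] s s0 st.
  by move=> /itv_partition_nil ->; rewrite subrr mulr0.
move=> spt; have sy : s < y by case: spt => /=/andP[].
have ypt := itv_partition_cons spt; have yt := itv_partition_le ypt.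
rewrite /= (_ : t - s = (y - s) + (t - y)); last by ring.
rewrite mulrDr EFinD leeD ?ih ?(le_trans s0 (ltW sy))//.
rewrite lee_fin.
have := edge_curve_lipschitz alpha1 compl vw (_ : s \in `[0, 1]) (_ : y \in `[0, 1]).
rewrite (distrC s) ger0_norm ?subr_ge0 ?(ltW sy)//; apply.
- by rewrite in_itv/= s0 (le_trans st).
- by rewrite in_itv/= (le_trans s0 (ltW sy)) (le_trans yt).
Qed.

Lemma edge_curve_continuous v w : E v w -> curve_continuous md (ec v w) 0 1.
Proof.
move=> vw t t01 e e0.
have K0 : 0 < alpha * r v.2 by rewrite mulr_gt0// exprz_gt0.
exists (e / (alpha * r v.2)); first by rewrite divr_gt0.
move=> s s01; rewrite ltr_pdivlMr// => st; rewrite lte_fin.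
apply: le_lt_trans (edge_curve_lipschitz alpha1 compl vw t01 s01) _.
by rewrite mulrC distrC.
Qed.

Lemma edge_len_lty v w : E v w -> (curve_length md (ec v w) 0 1 < +oo)%E.
Proof. by move=> vw; apply: le_lt_trans (edge_len_le vw _ _ _) (ltry _). Qed.

Lemma edge_rectifiableY v w (D : set Y) : E v w ->
  (forall t, t \in `[0, 1] -> D (ec v w t)) -> rectifiable_curve md D (ec v w) 0 1.
Proof.
move=> vw Dvw; split => //; first exact: edge_curve_continuous.
exact: edge_len_lty.
Qed.

Lemma iv_neq v w : E v w -> iv iota v <> iv iota w.
Proof.
move=> vw; have [Vv Vw nvw _ _] := vw.
move=> /(iota_inj alpha1 tau3 maxS compl (X_vertex alpha tau Vv) (X_vertex alpha tau Vw)) h.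
have := congr1 (fun x => x v) h.
rewrite /edge_pt eqxx; have /eqP/negbTE -> : v <> w by [].
by rewrite !subr0 !mul1r !mul0r !addr0 => /eqP; rewrite oner_eq0.
Qed.

(** The definition of the extension measures edges by [d_rho], the curves of the upper gradient live
    in [Y]; polygons have the same length because [iota] is isometric. *)
Lemma edge_len_drho v w t : E v w -> t \in `[0, 1] ->
  fine (curve_length (d_rho alpha tau S) (edge_pt v w) 0 t) = edge_len v w t.
Proof.
move=> vw; rewrite in_itv/= => /andP[t0 t1]; congr fine; rewrite !curve_lengthE.
congr ereal_sup; apply: eq_imagel => s st.
suff H x : (forall y, y \in x :: s -> 0 <= y <= 1) ->
    polygon_length (d_rho alpha tau S) (edge_pt v w) x s =
    polygon_length md (ec v w) x s.
  apply: H => y /(itv_partition_mem st); rewrite in_itv/= => /andP[-> yt].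
  exact: le_trans yt t1.
elim: s x {st} => //= y s ih x mem01.
rewrite ih; last by move=> z zs; apply: mem01; rewrite inE zs orbT.
congr (_ + _)%E; rewrite -(iota_dist compl)//; apply: filling_edge_pt => //.
  by rewrite in_itv/= mem01// mem_head.
by rewrite in_itv/= mem01// !inE eqxx orbT.
Qed.

Lemma edge_len1_gt0 v w : E v w -> 0 < edge_len v w 1.
Proof.
move=> vw; have hd := edist_mdist Y.
have Lf := edge_len_lty vw.
rewrite -lte_fin fineK ?(curve_length_fin_num hd Lf)//.
apply: lt_le_trans (dist_le_curve_length hd _ ler01).
rewrite lte_fin mdist_gt0 /edge_curve (edge_pt0 v w) (edge_pt1 v w).
by apply/eqP; exact: iv_neq.
Qed.

Definition edge_ratio v w t : R := edge_len v w t / edge_len v w 1.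

Lemma edge_ratio0 v w : edge_ratio v w 0 = 0.
Proof. by rewrite /edge_ratio /edge_len curve_length_xx ?mul0r//; exact: edist_mdist. Qed.

Lemma edge_ratio1 v w : E v w -> edge_ratio v w 1 = 1.
Proof. by move=> vw; rewrite /edge_ratio divff// gt_eqF// edge_len1_gt0. Qed.

Lemma edge_lenB v w s t : E v w -> 0 <= s -> s <= t -> t <= 1 ->
  0 <= edge_len v w t - edge_len v w s <= alpha * r v.2 * (t - s).
Proof.
move=> vw s0 st t1; have hd := edist_mdist Y.
have := fine_curve_lengthB hd (edge_len_lty vw) s0 st t1.
rewrite -/(edge_len v w t) -/(edge_len v w s) -!lee_fin => <-.
by rewrite edge_len_le// curve_length_ge0.
Qed.

Lemma edge_ratio_itv v w t : E v w -> t \in `[0, 1] -> 0 <= edge_ratio v w t <= 1.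
Proof.
move=> vw; rewrite in_itv/= => /andP[t0 t1].
have L1 := edge_len1_gt0 vw.
have /andP[h1 _] := edge_lenB vw (lexx 0) t0 t1.
have /andP[h2 _] := edge_lenB vw t0 t1 (lexx 1).
have e0 : edge_len v w 0 = 0 by rewrite /edge_len curve_length_xx//; exact: edist_mdist.
apply/andP; split; first by rewrite divr_ge0 ?(ltW L1)//; lra.
by rewrite ler_pdivrMr//; lra.
Qed.

Lemma edge_ratioC v w t : E v w -> t \in `[0, 1] ->
  edge_ratio w v (1 - t) = 1 - edge_ratio v w t.
Proof.
move=> vw; rewrite in_itv/= => /andP[t0 t1]; have hd := edist_mdist Y.
have Lf := edge_len_lty vw.
have ecC : ec w v = fun s => ec v w (1 - s).
  by apply/funext => s; rewrite /edge_curve edge_ptC.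
have len_rev s : 0 <= s -> s <= 1 -> edge_len w v (1 - s) = edge_len v w 1 - edge_len v w s.
  move=> s0 s1; rewrite /edge_len ecC.
  have := curve_length_reverse hd (ec v w) 1 s1; rewrite subrr => ->.
  by rewrite (fine_curve_lengthB hd Lf).
have := len_rev 0 (lexx _) ler01; rewrite subr0 => len1.
rewrite /edge_ratio len1 len_rev//.
have -> : edge_len v w 0 = 0 by rewrite /edge_len curve_length_xx.
rewrite subr0 mulrBl divff// gt_eqF//; exact: edge_len1_gt0.
Qed.

Local Notation P := (extension_vertex alpha tau nu f).

Definition edge_interp v w t : R := P v + (P w - P v) * edge_ratio v w t.

Lemma edge_interp0 v w : edge_interp v w 0 = P v.
Proof. by rewrite /edge_interp edge_ratio0 mulr0 addr0. Qed.

Lemma edge_interp1 v w : E v w -> edge_interp v w 1 = P w.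
Proof. by move=> vw; rewrite /edge_interp edge_ratio1// mulr1 addrC subrK. Qed.

Lemma edge_interpC v w t : E v w -> t \in `[0, 1] ->
  edge_interp w v (1 - t) = edge_interp v w t.
Proof. by move=> vw t01; rewrite /edge_interp edge_ratioC//; ring. Qed.

(** An interior point determines its edge up to orientation, and at a vertex the interpolation gives
    [P] of that vertex along every edge. So the choice made in [extension_filling] is harmless. *)
Lemma edge_interp_unique v w v' w' s t : E v w -> E v' w' ->
  s \in `[0, 1] -> t \in `[0, 1] ->
  edge_pt v w s = edge_pt v' w' t -> edge_interp v w s = edge_interp v' w' t.
Proof.
move=> vw vw' s01 t01 h.
have ev u : edge_pt v w s u = edge_pt v' w' t u :> R by rewrite h.
have nvw : (v == w) = false by apply/eqP; case: vw.
have nvw' : (v' == w') = false by apply/eqP; case: vw'.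
have nwv : (w == v) = false by rewrite eq_sym.
have nwv' : (w' == v') = false by rewrite eq_sym.
(* Comparing the coordinates at [v] and [w] settles all coincidences between the two pairs of
   ends. *)
have := ev v; have := ev w; rewrite /edge_pt !eqxx nvw nwv /=.
rewrite !mulr0 !mulr1 add0r addr0.
have [e1|n1] := eqVneq v v'.
  subst v'; rewrite nwv nvw' !mulr0 mulr1 add0r addr0 => h1 h2.
  have st : s = t by lra.
  subst t; have [e2|n2] := eqVneq w w'; first by rewrite e2.
  move: h1; rewrite (negbTE n2) mulr0 => ->.
  by rewrite !edge_interp0.
have [e2|n2] := eqVneq v w'.
  subst w'; rewrite nwv !mulr0 mulr1 addr0 add0r => h1 h2.
  have [e3|n3] := eqVneq w v'.
    subst v'; rewrite (_ : t = 1 - s) ?edge_interpC//; lra.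
  move: h1; rewrite (negbTE n3) mulr0 => h1.
  have -> : s = 0 by lra.
  have -> : t = 1 by lra.
  by rewrite edge_interp0 edge_interp1.
rewrite !mulr0 addr0 => h1 h2; have s1 : s = 1 by lra.
rewrite s1 edge_interp1//.
have [e3|n3] := eqVneq w v'.
  subst v'; move: h1; rewrite ?eqxx nvw' mulr1 mulr0 addr0 => h1.
  by rewrite (_ : t = 0) ?edge_interp0//; lra.
have [e4|n4] := eqVneq w w'.
  subst w'; move: h1; rewrite ?eqxx (negbTE n3) mulr1 mulr0 add0r => h1.
  by rewrite (_ : t = 1) ?edge_interp1//; lra.
by move: h1; rewrite (negbTE n3) (negbTE n4) !mulr0 addr0; lra.
Qed.

Lemma extension_edge v w t : E v w -> t \in `[0, 1] ->
  extension_filling alpha tau S nu f (edge_pt v w t) = edge_interp v w t.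
Proof.
move=> vw t01; rewrite /extension_filling.
have : exists l, exists v' w' s, [/\ E v' w', s \in `[0%R, 1%R],
    edge_pt v w t = edge_pt v' w' s &
    l = (extension_vertex alpha tau nu f v' +
      (extension_vertex alpha tau nu f w' - extension_vertex alpha tau nu f v') *
      (fine (curve_length (d_rho alpha tau S) (edge_pt v' w') 0 s) /
       fine (curve_length (d_rho alpha tau S) (edge_pt v' w') 0 1)))%R].
  by eexists; exists v, w, t; split.
move=> /(xgetPex 0)[v' [w' [s [vw' s01 h ->]]]].
rewrite (edge_interp_unique vw vw' t01 s01 h) /edge_interp /edge_ratio.
by rewrite !edge_len_drho// in_itv/= ler01 lexx.
Qed.

Local Notation Pf := (extension alpha tau S iota nu beta f).

Lemma extension_edge_curve v w t : E v w -> t \in `[0, 1] ->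
  Pf (ec v w t) = (edge_interp v w t)%:E.
Proof.
move=> vw t01; rewrite /extension ifT; last first.
  by apply/mem_set; exists (edge_pt v w t) => //; exact: filling_edge_pt.
rewrite /edge_curve (iota_invK alpha1 tau3 maxS compl) ?extension_edge//.
exact: filling_edge_pt.
Qed.

Lemma extension_Xpart y : Xp y -> Pf y = (fine (Pf y))%:E.
Proof.
move=> /(XpartP alpha1 tau3 maxS)[e [t [Ee t01 ->]]].
by rewrite (ceE _ Ee t01) extension_edge_curve.
Qed.

Lemma measurable_extension : measurable_fun (Xp : set (borel_type Y)) Pf.
Proof.
have mX := measurable_Xpart alpha1 tau3 maxS mm dbl compl.
apply: (@eq_measurable_fun _ _ (borel_type Y) _ _ (EFin \o (fine \o Pf))).
  by move=> y /set_mem Xy; rewrite /= -extension_Xpart.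
apply/measurable_EFinP; apply: (measurable_fun_Xpart alpha1 tau3 maxS mm dbl compl).
move=> e Ee; set c := (P e.2 - P e.1) / edge_len e.1 e.2 1.
exists (`|c| * (alpha * r e.1.2)) => s t.
wlog st : s t / s <= t => [H s01 t01|].
  have [st|/ltW ts] := leP s t; first exact: H.
  by rewrite distrC (distrC s); exact: H.
move=> s01 t01; rewrite !(ceE _ Ee)//= !extension_edge_curve//= /edge_interp.
have -> : P e.1 + (P e.2 - P e.1) * edge_ratio e.1 e.2 s -
    (P e.1 + (P e.2 - P e.1) * edge_ratio e.1 e.2 t) =
    c * (edge_len e.1 e.2 s - edge_len e.1 e.2 t).
  by rewrite /c /edge_ratio; field; rewrite gt_eqF// edge_len1_gt0.
rewrite normrM -mulrA ler_wpM2l// distrC (distrC s).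
move: s01 t01; rewrite !in_itv/= => /andP[s0 _] /andP[_ t1].
have /andP[h1 h2] := edge_lenB Ee s0 st t1.
by rewrite ger0_norm// ger0_norm ?subr_ge0.
Qed.

Lemma extension_edge_between v w t (c : R) : E v w -> t \in `[0, 1] ->
  (`|Pf (ec v w t) - c%:E| <= (Num.max `|P v - c| `|P w - c|)%:E)%E.
Proof.
move=> vw t01; rewrite extension_edge_curve// -EFinB /= lee_fin.
have /andP[l0 l1] := edge_ratio_itv vw t01; move: l0 l1.
rewrite /edge_interp; move: (edge_ratio _ _ _) => l l0 l1.
have -> : P v + (P w - P v) * l - c = (1 - l) * (P v - c) + l * (P w - c) by ring.
apply: le_trans (ler_normD _ _) _.
rewrite !normrM (ger0_norm (_ : 0 <= 1 - l)) ?subr_ge0// (ger0_norm l0).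
have h1 : `|P v - c| <= Num.max `|P v - c| `|P w - c| by rewrite le_max lexx.
have h2 : `|P w - c| <= Num.max `|P v - c| `|P w - c| by rewrite le_max lexx orbT.
set m : R := Num.max `|P v - c| `|P w - c| in h1 h2 *.
rewrite (_ : m = (1 - l) * m + l * m); last by ring.
by rewrite lerD// ler_wpM2l// subr_ge0.
Qed.

(** The edge, a nonconstant rectifiable curve inside [D], is a test curve for the upper gradient.
    Its arc length grows at rate at most [alpha * alpha ^ (- v.2)] in the parameter, and
    [weak_jensen] on the unit interval contributes the factor 2. *)
Lemma edge_oscillation (D : set Y) (g : Y -> \bar R) (p : R) v w : 1 <= p ->
  open D -> upper_gradient D g Pf -> E v w ->
  (forall t, t \in `[0, 1] -> D (ec v w t)) ->
  ((`|P v - P w| `^ p)%:E <= ((2 * alpha * r v.2) `^ p)%:E *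
    \int[lam]_(t in `[0%R, 1%R]) g (ec v w t) `^ p)%E.
Proof.
move=> p1 oD [mg g0 ug] vw Dvw; have hd := edist_mdist Y.
have p0 : 0 <= p by lra.
have i0 : (0 : R) \in `[0, 1] by rewrite in_itv/= lexx ler01.
have i1 : (1 : R) \in `[0, 1] by rewrite in_itv/= lexx ler01.
have K0 : 0 < alpha * r v.2 by rewrite mulr_gt0// exprz_gt0.
have := ug (ec v w) 0 1 (edge_rectifiableY vw Dvw) _.
have nonconst : exists s t, [/\ s \in `[(0 : R), 1], t \in `[(0 : R), 1] & ec v w s <> ec v w t].
  exists 0, 1; split => //; rewrite /edge_curve edge_pt0 edge_pt1; exact: iv_neq.
move=> /(_ nonconst)/=; rewrite !extension_edge_curve//= edge_interp0 edge_interp1//.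
move=> [/(_ isT) osc _].
have mgc : measurable_fun (`[0%R, 1%R]%classic : set (measurableTypeR R)) (g \o ec v w).
  have mD : measurable (D : set (borel_type Y)) by exact: sub_sigma_algebra.
  have Ee : edges alpha tau S (v, w) by [].
  apply: (@eq_measurable_fun _ _ _ _ _ (g \o ce alpha tau S iota (v, w))).
    by move=> t /set_mem t01; rewrite /= (ceE _ Ee t01).
  apply: (@measurable_comp _ _ _ _ _ _ (D : set (borel_type Y))) => //.
    by move=> _ [t t01 <-]; rewrite (ceE _ Ee t01); exact: Dvw.
  apply: measurable_funS (measurable_ce alpha1 compl (v, w)) => //.
have gc0 t : t \in `[0, 1] -> (0 <= g (ec v w t))%E by move=> /Dvw/g0.
have := line_integral_le hd K0 (edge_curve_continuous vw) (edge_len_lty vw)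
  (fun s t s0 st t1 => edge_len_le vw s0 st t1) mgc gc0.
move=> /(le_trans osc) {}osc.
rewrite -poweR_EFin.
apply: (@le_trans _ _ (((alpha * r v.2)%:E *
    \int[lam]_(t in `[0%R, 1%R]) g (ec v w t)) `^ p)%E).
  exact: lee_poweR.
rewrite poweRM ?lee_fin ?(ltW K0)//; last first.
  by apply: integral_ge0 => t; exact: gc0.
have -> : 2 * alpha * r v.2 = (alpha * r v.2) * 2 by ring.
rewrite (powRM _ (ltW K0)) ?ler0n// (EFinM ((alpha * r v.2) `^ p)) -muleA.
rewrite poweR_EFin lee_wpmul2l ?lee_fin ?powR_ge0//.
have := @weak_jensen _ (measurableTypeR R) R lam `[0%R, 1%R]%classic (g \o ec v w) p 1 p1.
rewrite powR1 mulr1; apply => //.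
have := @lebesgue_measure_itv R `[0, 1]%R.
by rewrite /= lte_fin ltr01 -EFinB subr0.
Qed.

End extension.

(** * Chains of vertices *)

Section sums.
Variable R : realType.

Lemma sum_by_key (I J : eqType) (F : seq I) (k : I -> J) (a : I -> R) (h : J -> R) :
  \sum_(i <- F) a i * h (k i) =
  \sum_(j <- undup [seq k i | i <- F]) (\sum_(i <- F | k i == j) a i) * h j.
Proof.
under [RHS]eq_bigr do rewrite mulr_suml.
rewrite (exchange_big_dep predT)//=.
apply: eq_big_seq => i iF.
rewrite (eq_bigl (pred1 (k i))) => [|j]; last by rewrite /= eq_sym.
by rewrite -big_filter filter_pred1_uniq ?undup_uniq ?mem_undup ?map_f// big_seq1.
Qed.

Lemma sum_geometric (x : R) (N : nat) : 0 <= x -> x < 1 ->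
  \sum_(k < N) x ^+ k <= (1 - x)^-1.
Proof.
move=> x0 x1; rewrite -[leRHS]mul1r ler_pdivlMr ?subr_gt0// mulrC.
by rewrite -opprB mulNr -subrX1 opprB gerBl exprn_ge0.
Qed.

Lemma sum_geometric_uniq (x : R) (s : seq nat) : 0 <= x -> x < 1 -> uniq s ->
  \sum_(k <- s) x ^+ k <= (1 - x)^-1.
Proof.
move=> x0 x1 us.
have sub N : forall s : seq nat, uniq s -> (forall k, k \in s -> (k < N)%N) ->
    \sum_(k <- s) x ^+ k <= \sum_(k < N) x ^+ k.
  elim: N => [|N ih] [|k0 s'] us' sN; rewrite ?big_nil ?big_ord0 ?sumr_ge0//.
  - by have := sN k0 (mem_head _ _).
  - by move=> i _; exact: exprn_ge0.
  - rewrite big_ord_recr/=; have [Ns|Ns] := boolP (N \in k0 :: s').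
      have -> : \sum_(k <- k0 :: s') x ^+ k = \sum_(k <- rem N (k0 :: s')) x ^+ k + x ^+ N.
        by rewrite addrC (big_rem N Ns).
      rewrite lerD2r; apply: ih; first exact: rem_uniq.
      move=> k; rewrite mem_rem_uniq// !inE => /andP[kN ks].
      by rewrite ltn_neqAle kN -ltnS sN.
    rewrite ler_wpDr ?exprn_ge0//; apply: ih => // k ks.
    rewrite ltn_neqAle -ltnS sN// andbT.
    by apply: contra Ns => /eqP <-.
apply: le_trans (sum_geometric (\max_(k <- s) k).+1 x0 x1); apply: sub => // k ks.
by rewrite ltnS; apply: (@leq_bigmax_seq _ s predT id).
Qed.

(** In place of Hölder's inequality: the weighted sum dominates each of its terms, so each [D i] is
    at most [x ^+ i] times its p-th root, and these bounds form a geometric series. *)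
Lemma powR_sum_geometric (p x : R) (n : nat) (D : nat -> R) : 1 <= p ->
  0 < x -> x < 1 -> (forall i, 0 <= D i) ->
  (\sum_(i < n) D i) `^ p <=
  (1 - x)^-1 `^ p * \sum_(i < n) (x ^- i) `^ p * D i `^ p.
Proof.
move=> p1 x0 x1 D0; have p0 : 0 < p by lra.
set T := \sum_(i < n) _ * _.
have T0 : 0 <= T by rewrite sumr_ge0// => i _; rewrite mulr_ge0 ?powR_ge0.
have le1 (i : 'I_n) : D i <= x ^+ i * T `^ p^-1.
  rewrite mulrC -ler_pdivrMr ?exprn_gt0//.
  have Dx0 : 0 <= D i / x ^+ i by rewrite divr_ge0 ?D0 ?exprn_ge0 ?(ltW x0).
  rewrite -[leLHS](powRr1 Dx0) -(@divff _ p) ?gt_eqF// powRrM.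
  rewrite ge0_ler_powR ?nnegrE ?invr_ge0 ?powR_ge0 ?(ltW p0)//.
  rewrite powRM ?D0// ?invr_ge0 ?exprn_ge0 ?(ltW x0)// mulrC /T (bigD1 i)//= lerDl.
  by rewrite sumr_ge0// => k _; rewrite mulr_ge0 ?powR_ge0.
have le2 : \sum_(i < n) D i <= (1 - x)^-1 * T `^ p^-1.
  apply: le_trans (ler_sum _ (fun i _ => le1 i)) _.
  rewrite -mulr_suml ler_wpM2r ?powR_ge0//.
  exact: sum_geometric (ltW x0) x1.
have := ge0_ler_powR (ltW p0) _ _ le2.
have s0 : 0 <= \sum_(i < n) D i by rewrite sumr_ge0// => i _; exact: D0.
rewrite !nnegrE s0 mulr_ge0 ?powR_ge0 ?invr_ge0 ?subr_ge0 ?(ltW x1)// => /(_ isT isT).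
rewrite powRM ?powR_ge0 ?invr_ge0 ?subr_ge0 ?(ltW x1)//.
by rewrite -[X in _ <= _ * X]powRrM mulVf ?gt_eqF// powRr1.
Qed.

Lemma powR_root_expn (k p : R) (i : nat) : 0 < k -> 0 < p ->
  ((k `^ p^-1) ^- i) `^ p = k ^- i.
Proof.
move=> k0 p0; rewrite -powR_mulrn ?powR_ge0// -powRN -!powRrM.
rewrite (_ : p^-1 * _ = - i%:R); last by field; rewrite gt_eqF.
by rewrite powRN powR_mulrn ?(ltW k0).
Qed.

Lemma powRD_le (p a b : R) : 0 <= p -> 0 <= a -> 0 <= b ->
  (a + b) `^ p <= 2 `^ p * (a `^ p + b `^ p).
Proof.
move=> p0; wlog ab : a b / a <= b => [H a0 b0|a0 b0].
  have [ab|/ltW ba] := leP a b; first exact: H.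
  by rewrite addrC (addrC (a `^ p)); exact: H.
apply: (@le_trans _ _ ((2 * b) `^ p)).
  by rewrite ge0_ler_powR ?nnegrE ?addr_ge0 ?mulr_ge0//; lra.
by rewrite powRM// ler_wpM2l ?powR_ge0// lerDr powR_ge0.
Qed.

End sums.

Section chain.
Context {R : realType} {Z : completeMetricType R}.
Variables (alpha tau Cnu : R) (S : int -> set Z).
Variable nu : {outer_measure set Z -> \bar R}.
Hypothesis alpha1 : 1 < alpha.
Hypothesis tau3 : 3 < tau.
Hypothesis maxS : forall n : int, maximal_separated (alpha ^ (- n)) (S n).
Hypothesis mm : metric_measure nu.
Hypothesis dbl : doubling nu Cnu.
Variables (Y : completeMetricType R) (iota : (Z * int -> R) -> Y).
Hypothesis compl : uniformized_completion alpha tau S iota.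
Local Notation vertex := (Z * int)%type.
Local Notation E := (filling_edge alpha tau S).
Local Notation r n := (alpha ^ (- n%R)).
Local Notation lam := (@lebesgue_measure R).
Local Notation vb v := (vball alpha tau v).
Local Notation ec := (edge_curve iota).
Variables (beta p : R) (f : Z -> R).
Hypothesis p1 : 1 <= p.
Hypothesis beta0 : 0 < beta.
Hypothesis betap : beta < p.
Local Notation P := (extension_vertex alpha tau nu f).
Local Notation mub := (mub alpha1 tau3 maxS mm dbl compl beta).
Variables (D : set Y) (g : Y -> \bar R).
Hypothesis oD : open D.
Hypothesis ug : upper_gradient D g (extension alpha tau S iota nu beta f).

Let alpha0 : 0 < alpha. Proof. exact: lt_trans alpha1. Qed.
Let rgt0 (n : int) : 0 < r n. Proof. exact: exprz_gt0. Qed.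
Hint Resolve rgt0 : core.

Lemma powR_radius (b : R) (l : int) : alpha `^ (- b * l%:~R) = r l `^ b.
Proof. by rewrite -powRN_int// -powRrM; congr (_ `^ _); ring. Qed.

Lemma edge_massE e : edge_mass alpha tau nu beta e = r e.1.2 `^ beta * edge_weight alpha tau nu e.
Proof. by rewrite /edge_mass powR_radius. Qed.

(** The doubling constant bounds the total volume of the vertices that share an edge, the p-th power
    comes from [edge_oscillation], and the last factor from the density in [mub_integral_ge]. *)
Definition level_const : R :=
  dbl_const Cnu (2 * tau) * (2 * alpha) `^ p * alpha `^ beta.

Lemma level_const_ge0 : 0 <= level_const.
Proof. by rewrite !mulr_ge0 ?powR_ge0//; exact/ltW/dbl_const_gt0. Qed.

(** Here [e v] is one jump of the chain of [v], from level [l] to level [l']. Many chains use the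
    same edge [j], but the vertices whose chains do are [l']-close to its lower end, so their
    volumes add up to at most a multiple of the volume of that end. *)
Lemma level_sum (n l l' : int) (F : seq vertex) (e : vertex -> vertex * vertex) :
  uniq F -> l' <= n ->
  (forall v, v \in F -> [/\ vertices S v, v.2 = n, (e v).1.2 = l, (e v).2.2 = l' &
     mdist (e v).2.1 v.1 < r l']) ->
  (forall v, v \in F -> (e v).1 = (e v).2 \/
     E (e v).1 (e v).2 /\ forall t, t \in `[0, 1] -> D (ec (e v).1 (e v).2 t)) ->
  (\sum_(v <- F) (vol nu (vb v) * `|P (e v).1 - P (e v).2| `^ p)%:E <=
   (level_const * r l `^ (p - beta))%:E * \int[mub]_(y in D) g y `^ p)%E.
Proof.
move=> uF ln Fl Fe; have p0 : 0 < p := lt_le_trans ltr01 p1.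
(* Jumps that stay at one vertex contribute 0 because [p] is positive; the others are true edges. *)
pose F' := [seq v <- F | (e v).1 != (e v).2].
have uF' : uniq F' by rewrite filter_uniq.
have F'F v : v \in F' -> v \in F by rewrite mem_filter => /andP[].
have F'e v : v \in F' -> E (e v).1 (e v).2 /\
    forall t, t \in `[0, 1] -> D (ec (e v).1 (e v).2 t).
  rewrite mem_filter => /andP[ne vF]; case: (Fe v vF) => // e0.
  by rewrite e0 eqxx in ne.
pose h (e : vertex * vertex) := `|P e.1 - P e.2| `^ p.
rewrite sumEFin.
have -> : \sum_(v <- F) vol nu (vb v) * `|P (e v).1 - P (e v).2| `^ p =
    \sum_(v <- F') vol nu (vb v) * h (e v).
  rewrite big_filter [RHS]big_mkcond; apply: eq_bigr => v _.
  by case: eqP => //= ->; rewrite subrr normr0 powR0 ?mulr0// gt_eqF.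
rewrite sum_by_key; set s := undup _.
have sP j : j \in s -> exists2 v, v \in F' & j = e v.
  by rewrite mem_undup => /mapP[v vF ->]; exists v.
have [mg g0 _] := ug.
have mD : measurable (D : set (borel_type Y)) by exact: sub_sigma_algebra.
have ge := mub_integral_ge alpha1 tau3 maxS mm dbl compl beta0 (s := s)
  (D := D) (G := fun y => (g y `^ p)%E) (undup_uniq _).
have K0 : 0 <= level_const * r l `^ (p - beta).
  by rewrite !mulr_ge0 ?powR_ge0// ltW// dbl_const_gt0.
have J0 (j : vertex * vertex) :
    (0 <= \int[lam]_(t in `[0%R, 1%R]) (g (ec j.1 j.2 t) `^ p))%E.
  by apply: integral_ge0 => t _; exact: poweR_ge0.
apply: le_trans (lee_wpmul2l _ (ge _ _ _ _ _)); rewrite ?lee_fin//.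
- rewrite ge0_sume_distrr; last first.
    move=> j _; apply: mule_ge0 => //.
    by rewrite lee_fin mulr_ge0 ?powR_ge0 ?edge_mass_ge0.
  rewrite -sumEFin big_seq_cond [leRHS]big_seq_cond; apply: lee_sum => j /andP[js _].
  have [v0 v0F jv] := sP j js; have [Ej Dj] := F'e _ v0F.
  have [_ _ jl jl' _] := Fl _ (F'F _ v0F).
  rewrite -jv in Ej Dj jl jl'.
  have osc := edge_oscillation alpha1 tau3 maxS compl p1 oD ug Ej Dj.
  have mass : \sum_(i <- F' | e i == j) vol nu (vb i) <=
      dbl_const Cnu (2 * tau) * edge_weight alpha tau nu j.
    rewrite -big_filter.
    apply: le_trans (net_sum_vol alpha1 tau3 maxS mm dbl (n := n)
       (u := j.2.1) (s := tau * r j.2.2) _ _ _) _.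
    + exact: filter_uniq.
    + exact: vball_radius_gt0.
    + move=> v; rewrite mem_filter => /andP[/eqP ev vF'].
      have [Vv vn _ _ vd] := Fl _ (F'F _ vF'); split => //.
      rewrite ev in vd; rewrite jl'.
      have := ler_exprzN alpha1 ln; have := rgt0 n; have := tau3; have := rgt0 l'.
      nra.
    + rewrite ler_wpM2l ?(ltW (dbl_const_gt0 _ _))// /edge_weight lerDr.
      exact/ltW/(vol_vball_gt0 alpha1 tau3 mm).
  rewrite EFinM; apply: (@le_trans _ _ ((dbl_const Cnu (2 * tau) * edge_weight alpha tau nu j)%:E *
      (((2 * alpha * r l) `^ p)%:E * \int[lam]_(t in `[0%R, 1%R]) (g (ec j.1 j.2 t) `^ p)))%E).
    apply: lee_pmul => //; rewrite ?lee_fin ?powR_ge0//.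
      by apply: sumr_ge0 => i _; exact/ltW/(vol_vball_gt0 alpha1 tau3 mm).
    by rewrite -jl; exact: osc.
  rewrite !muleA -!EFinM lee_wpmul2r// lee_fin edge_massE jl.
  (* The power [beta] of the radius is absorbed by [edge_mass], which leaves the exponent
     [p - beta]. *)
  rewrite (_ : (2 * alpha * r l) `^ p = (2 * alpha) `^ p * (r l `^ (p - beta) * r l `^ beta)).
    rewrite powRN /level_const le_eqVlt; apply/orP; left; apply/eqP.
    by field; rewrite gt_eqF// powR_gt0.
  rewrite powRM ?mulr_ge0 ?(ltW alpha0) ?(ltW (rgt0 _))//; congr (_ * _).
  by rewrite -powRD ?subrK// gt_eqF ?implybT.
- by move=> j /sP[v vF ->]; have [] := F'e _ vF.
- exact: measurableT_comp (measurable_poweR _) mg.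
- by move=> y _; exact: poweR_ge0.
- by move=> j t /sP[v vF ->]; have [_] := F'e _ vF; exact.
Qed.

(** Index 0 is the vertex common to all chains and index 1 is the vertex above [v] at the same level
    [m]: the first jump is horizontal, or trivial, and all others descend by one level. *)
Definition chain_vertex (m : int) (z : Z) (v : vertex) (i : nat) : vertex :=
  if i is k.+1 then net_vertex alpha S (m + k%:Z) v.1 else net_vertex alpha S m z.

(* A jump [i] levels below the top gains [alpha `^ (- (p - beta) * i)]: half of
   this gain pays for Hölder's inequality along the chain, and the other half for
   the sum over [i]. *)
Definition chain_ratio : R := alpha `^ (- ((p - beta) / 2)).

Definition chain_const : R :=
  (1 - chain_ratio `^ p^-1)^-1 `^ p * (level_const * alpha `^ (p - beta)) *
  (1 - chain_ratio)^-1.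

Lemma chain_ratio_gt0 : 0 < chain_ratio. Proof. exact: powR_gt0. Qed.

Lemma chain_ratio_lt1 : chain_ratio < 1.
Proof.
rewrite /chain_ratio powRN invf_lt1 ?powR_gt0//.
have e0 : 0 < (p - beta) / 2 by rewrite divr_gt0// subr_gt0 betap.
by have := gt0_ltr_powR e0 _ _ alpha1; rewrite powR1; apply; rewrite nnegrE ?ltW.
Qed.

Lemma chain_const_ge0 : 0 <= chain_const.
Proof.
have := chain_ratio_lt1 => k1.
have L0 := level_const_ge0.
by rewrite mulr_ge0 ?invr_ge0 ?subr_ge0 ?(ltW k1)// mulr_ge0 ?powR_ge0// mulr_ge0 ?powR_ge0.
Qed.

(** The jump of index [i] starts on level [m + i - 1], or on [m] for the first one; the factor
    [alpha] in the hypothesis pays for this shift. *)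
Lemma chain_level_ratio (m : int) (i : nat) (l : int) :
  r l <= alpha * r m * r i%:Z ->
  r l `^ (p - beta) <= alpha `^ (p - beta) * r m `^ (p - beta) * chain_ratio ^+ (2 * i).
Proof.
move=> lm; have bp : 0 <= p - beta by have := betap; lra.
have := ge0_ler_powR bp _ _ lm; rewrite !nnegrE !mulr_ge0 ?(ltW (rgt0 _)) ?(ltW alpha0)//.
move=> /(_ isT isT) /le_trans; apply.
rewrite !powRM ?mulr_ge0 ?(ltW (rgt0 _)) ?(ltW alpha0)// le_eqVlt; apply/orP; left; apply/eqP.
congr (_ * _); rewrite -powR_mulrn ?(ltW chain_ratio_gt0)// /chain_ratio -powRrM -powRN_int// -powRrM.
by congr (_ `^ _); rewrite natrM; field.
Qed.

Lemma chain_sum (m n : int) (z : Z) (F : seq vertex) : m <= n -> uniq F ->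
  (forall v, v \in F -> [/\ vertices S v, v.2 = n & mdist v.1 z <= 2 * r m]) ->
  (forall v w t, E v w -> t \in `[0, 1] -> m <= v.2 -> mdist v.1 z <= 3 * r m ->
     D (ec v w t)) ->
  (\sum_(v <- F) (vol nu (vb v) * `|P v - P (net_vertex alpha S m z)| `^ p)%:E <=
   (chain_const * r m `^ (p - beta))%:E * \int[mub]_(y in D) g y `^ p)%E.
Proof.
move=> mn uF FV Dnear; have p0 : 0 < p := lt_le_trans ltr01 p1.
pose N := `|n - m|%N; have nN : n = m + N%:Z.
  by rewrite /N gez0_abs ?subr_ge0// addrCA subrr addr0.
pose x i v := chain_vertex m z v i.
pose del i v := `|P (x i v) - P (x i.+1 v)|.
pose lev (i : nat) : int := if i is k.+1 then m + k%:Z else m.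
have xlev i v : (x i v).2 = lev i by case: i.
have k0 := chain_ratio_gt0; have k1 := chain_ratio_lt1.
set k := chain_ratio in k0 k1.
have kp0 : 0 < k `^ p^-1 by exact: powR_gt0.
have kp1 : k `^ p^-1 < 1.
  have pV0 : 0 < p^-1 by rewrite invr_gt0.
  by have := gt0_ltr_powR pV0 _ _ k1; rewrite powR1; apply; rewrite nnegrE ?ltW.
set Q := (1 - k `^ p^-1)^-1 `^ p.
have Q0 : 0 <= Q by exact: powR_ge0.
have chain v : v \in F -> vol nu (vb v) * `|P v - P (net_vertex alpha S m z)| `^ p <=
    \sum_(i < N.+1) (Q * k ^- i) * (vol nu (vb v) * del i v `^ p).
  move=> vF; have [Vv vn _] := FV _ vF.
  have tri : `|P v - P (net_vertex alpha S m z)| <= \sum_(i < N.+1) del i v.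
    (* The net point of level [n] above the base point of [v] is that base point, so the chain ends
       at [v] itself. *)
    have xN : x N.+1 v = v by rewrite /x /= -nN -vn (net_vertex_id alpha Vv).
    have -> : P v - P (net_vertex alpha S m z) = \sum_(i < N.+1) (P (x i.+1 v) - P (x i v)).
      rewrite -(big_mkord predT (fun i => P (x i.+1 v) - P (x i v))).
      by rewrite telescope_sumr// xN.
    apply: le_trans (ler_norm_sum _ _ _) _.
    by apply: ler_sum => i _; rewrite distrC.
  have := ge0_ler_powR (ltW p0) _ _ tri.
  have s0 : 0 <= \sum_(i < N.+1) del i v by rewrite sumr_ge0// => i _; exact: normr_ge0.
  rewrite !nnegrE normr_ge0 s0 => /(_ isT isT) tri'.
  have := powR_sum_geometric N.+1 p1 kp0 kp1 (fun i => normr_ge0 _ : 0 <= del i v).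
  move=> /(le_trans tri'){}tri'.
  have vv := vol_vball_gt0 alpha1 tau3 mm v.
  apply: le_trans (ler_wpM2l (ltW vv) tri') _.
  rewrite !mulr_sumr le_eqVlt; apply/orP; left; apply/eqP; apply: eq_bigr => i _.
  rewrite -/Q powR_root_expn//.
  by ring.
have lvl (i : 'I_N.+1) : (\sum_(v <- F) (vol nu (vb v) * del i v `^ p)%:E <=
   (level_const * r (lev i) `^ (p - beta))%:E * \int[mub]_(y in D) g y `^ p)%E.
  apply: (@level_sum n (lev i) (lev i.+1) F (fun v => (x i v, x i.+1 v)) uF).
  - by rewrite /= nN lerD2l lez_nat -ltnS.
  - move=> v vF; have [Vv vn vz] := FV _ vF; split => //.
      exact: (xlev i v).
    by have [] := net_ptP alpha1 maxS (m + i%:Z) v.1.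
  - move=> v vF; have [Vv vn vz] := FV _ vF.
    case: i => -[|i] iN; rewrite /x /=.
      rewrite addr0; have [->|ne] := pselect (net_vertex alpha S m z = net_vertex alpha S m v.1).
        by left.
      right; have [_ d1] := net_ptP alpha1 maxS m z; have [_ d2] := net_ptP alpha1 maxS m v.1.
      (* The net point above [v.1] is within three times the radius of [z], so [z] lies in both
         balls since [tau] exceeds 3. *)
      have e : E (net_vertex alpha S m z) (net_vertex alpha S m v.1).
        apply: (@edge_intro _ _ _ _ _ _ _ z) => //; try exact: vertices_net.
        + by rewrite /= subrr normr0.
        + by rewrite /=; have := tau3; have := rgt0 m; nra.
        + rewrite /=; have := metric_triangle (net_pt alpha S m v.1) v.1 z.
          by have := tau3; have := rgt0 m; nra.
      split => // t t01; apply: Dnear => //=.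
      by have := rgt0 m; lra.
    right; have e := net_edge alpha1 tau3 maxS (m + i%:Z) v.1.
    have -> : m + i.+1%:Z = m + i%:Z + 1 by rewrite -addn1 PoszD addrA.
    split => // t t01; apply: Dnear => //=; first by rewrite lerDl.
    have [_ d2] := net_ptP alpha1 maxS (m + i%:Z) v.1.
    have := metric_triangle (net_pt alpha S (m + i%:Z) v.1) v.1 z.
    have : r (m + i%:Z) <= r m by apply: ler_exprzN => //; rewrite lerDl.
    by lra.
have I0 : (0 <= \int[mub]_(y in D) g y `^ p)%E.
  by apply: integral_ge0 => y _; exact: poweR_ge0.
apply: (@le_trans _ _ (\sum_(i < N.+1) ((Q * k ^- i)%:E * \sum_(v <- F) (vol nu (vb v) * del i v `^ p)%:E))%E).
  under [leRHS]eq_bigr do rewrite sumEFin -EFinM mulr_sumr.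
  rewrite !sumEFin lee_fin exchange_big/= big_seq_cond [leRHS]big_seq_cond.
  by apply: ler_sum => v /andP[vF _]; exact: chain.
apply: (@le_trans _ _ (\sum_(i < N.+1) ((Q * k ^- i * (level_const * r (lev i) `^ (p - beta)))%:E *
    \int[mub]_(y in D) g y `^ p))%E).
  apply: lee_sum => i _; rewrite [X in (_ <= X * _)%E]EFinM -muleA lee_wpmul2l//.
  by rewrite lee_fin mulr_ge0// invr_ge0 exprn_ge0 ?(ltW k0).
have L0 := level_const_ge0.
rewrite -ge0_sume_distrl; last first.
  move=> i _; rewrite lee_fin mulr_ge0//; first by rewrite mulr_ge0// invr_ge0 exprn_ge0 ?(ltW k0).
  by rewrite mulr_ge0 ?powR_ge0.
rewrite lee_wpmul2r// sumEFin lee_fin.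
apply: (@le_trans _ _ (\sum_(i < N.+1)
    (Q * (level_const * alpha `^ (p - beta)) * r m `^ (p - beta)) * k ^+ i)).
  apply: ler_sum => i _.
  have levi : r (lev i) <= alpha * r m * r i%:Z.
    case: i => -[|i] iN /=.
      by rewrite oppr0 expr0z mulr1 ler_peMl ?(ltW alpha1) ?(ltW (rgt0 _)).
    have -> : - (m + i%:Z) = 1 + - m + - i.+1%:Z by rewrite -addn1 PoszD; ring.
    by rewrite !expfzDr ?gt_eqF// expr1z.
  have h := chain_level_ratio levi; rewrite -/k in h.
  have kE : k ^- i * k ^+ (2 * i) = k ^+ i.
    by rewrite mul2n -addnn exprD mulKf// expf_neq0// gt_eqF.
  rewrite -[in leRHS]kE.
  rewrite [leRHS](_ : _ = Q * k ^- i * (level_const * (alpha `^ (p - beta) * r m `^ (p - beta) * k ^+ (2 * i)))).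
    by rewrite !ler_wpM2l// mulr_ge0// invr_ge0 exprn_ge0 ?(ltW k0).
  by ring.
rewrite -mulr_sumr /chain_const -/k -/Q.
rewrite [leRHS]mulrAC ler_wpM2l//.
  by rewrite mulr_ge0 ?powR_ge0// mulr_ge0// mulr_ge0 ?powR_ge0.
exact: sum_geometric (ltW k0) k1.
Qed.

End chain.

(** * Deviation from the mean *)

Section deviation.
Context d (T : measurableType d) (R : realType) (mu : {measure set T -> \bar R}).
Variables (D : set T) (p : R) (f : T -> R).
Hypothesis p1 : 1 <= p.
Hypothesis mD : measurable D.
Hypothesis mf : measurable_fun D f.

Let p0 : 0 < p. Proof. exact: lt_le_trans ltr01 p1. Qed.

Lemma measurable_powR_dist a : measurable_fun D (fun x => (`|f x - a| `^ p)%:E).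
Proof.
apply/measurable_EFinP; apply: (@measurableT_comp _ _ _ _ _ _ (@powR R ^~ p)) => //.
by apply: measurableT_comp => //; exact: measurable_funB.
Qed.

Lemma deviation_shift a c :
  (\int[mu]_(x in D) (`|f x - c| `^ p)%:E <= (2 `^ p)%:E *
    (\int[mu]_(x in D) (`|f x - a| `^ p)%:E + (`|a - c| `^ p)%:E * mu D))%E.
Proof.
rewrite -integral_cst// -ge0_integralD//=.
- rewrite -ge0_integralZl_EFin ?powR_ge0//=.
  + apply: ge0_le_integral_nm => x _; first by rewrite lee_fin powR_ge0.
    rewrite -EFinD -EFinM lee_fin.
    apply: le_trans (powRD_le (ltW p0) (normr_ge0 _) (normr_ge0 _)).
    rewrite ge0_ler_powR ?nnegrE ?addr_ge0 ?(ltW p0)//.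
    by rewrite (_ : f x - c = (f x - a) + (a - c)) ?ler_normD//; ring.
  + by move=> x _; rewrite -EFinD lee_fin addr_ge0 ?powR_ge0.
  + by apply: emeasurable_funD => //; exact: measurable_powR_dist.
- exact: measurable_powR_dist.
Qed.

Variables (V : R).
Hypothesis DV : mu D = V%:E.
Hypothesis V0 : 0 < V.

Let dev_jensen a :
  ((\int[mu]_(x in D) `|(f x - a)%:E|) `^ p <=
   (2 `^ p * V `^ (p - 1))%:E * \int[mu]_(x in D) (`|f x - a| `^ p)%:E)%E.
Proof.
apply: (weak_jensen (u := fun x => `|(f x - a)%:E|%E)) => //.
apply: measurableT_comp => //; apply/measurable_EFinP.
exact: measurable_funB.
Qed.

Let integrable_sub a : (\int[mu]_(x in D) (`|f x - a| `^ p)%:E < +oo)%E ->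
  mu.-integrable D (fun x => (f x - a)%:E).
Proof.
move=> Jf; apply/integrableP; split.
  by apply/measurable_EFinP; exact: measurable_funB.
have := dev_jensen a; case: ltP => // ; rewrite leye_eq => /eqP ->.
rewrite poweRyr ?gt_eqF// leye_eq => /eqP h; suff : (+oo < +oo :> \bar R)%E by [].
by rewrite -{1}h lte_mul_pinfty// ?lee_fin ?mulr_ge0 ?powR_ge0.
Qed.

Let integralE a : (\int[mu]_(x in D) (`|f x - a| `^ p)%:E < +oo)%E ->
  (\int[mu]_(x in D) (f x)%:E = \int[mu]_(x in D) (f x - a)%:E + (a * V)%:E)%E.
Proof.
move=> Jf; rewrite EFinM -DV -integral_cst// -integralD//.
- by apply: eq_integral => x _; rewrite /= -EFinD subrK.
- exact: integrable_sub.
- apply/integrableP; split => //=; rewrite integral_cst// DV -EFinM; exact: ltry.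
Qed.

Lemma mean_fin_num a : (\int[mu]_(x in D) (`|f x - a| `^ p)%:E < +oo)%E ->
  mean mu D (EFin \o f) \is a fin_num.
Proof.
move=> Jf; rewrite /mean DV inver gt_eqF// fin_numM//= (integralE Jf) fin_numD.
by rewrite (integrable_fin_num mD (integrable_sub Jf)).
Qed.

(** Weak Jensen for the average of [f - a]; working with [f - a] gives integrability directly from
    the finiteness of the right-hand side. *)
Lemma mean_deviation a :
  ((V * `|a - fine (mean mu D (EFin \o f))| `^ p)%:E <=
   (2 `^ p)%:E * \int[mu]_(x in D) (`|f x - a| `^ p)%:E)%E.
Proof.
have [Jf|] := ltP (\int[mu]_(x in D) (`|f x - a| `^ p)%:E)%E +oo%E; last first.
  by rewrite leye_eq => /eqP ->; rewrite gt0_muley ?leey// lte_fin powR_gt0.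
have Vp : V * V `^ (p - 1) = V `^ p.
  have -> : V `^ p = V `^ 1 * V `^ (p - 1).
    by rewrite -powRD ?(gt_eqF V0) ?implybT//; congr (_ `^ _); ring.
  by rewrite powRr1 ?ltW.
have IntF := integrable_fin_num mD (integrable_sub Jf).
have -> : fine (mean mu D (EFin \o f)) = a + V^-1 * fine (\int[mu]_(x in D) (f x - a)%:E).
  rewrite /mean DV inver gt_eqF//= (integralE Jf) -(fineK IntF) -EFinD -EFinM /=.
  by field; rewrite gt_eqF.
set I := fine _; have IE : (\int[mu]_(x in D) (f x - a)%:E = I%:E)%E by rewrite fineK.
have le1 : ((`|I| `^ p)%:E <= (2 `^ p * V `^ (p - 1))%:E * \int[mu]_(x in D) (`|f x - a| `^ p)%:E)%E.
  apply: le_trans (dev_jensen a); rewrite -poweR_EFin; apply: lee_poweR; [exact: ltW|by rewrite lee_fin|].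
  rewrite -[leLHS]/(`|I%:E|)%E -IE; apply: le_abse_integral => //.
  by apply/measurable_EFinP; exact: measurable_funB.
have -> : V * `|a - (a + V^-1 * I)| `^ p = (V `^ (p - 1))^-1 * `|I| `^ p.
  rewrite opprD addNKr normrN normrM (ger0_norm (_ : 0 <= V^-1)) ?invr_ge0 ?(ltW V0)//.
  rewrite powRM ?invr_ge0 ?(ltW V0)// -powR_inv1 ?(ltW V0)// -powRrM mulN1r powRN.
  rewrite -Vp; field; rewrite !gt_eqF ?powR_gt0//.
rewrite EFinM; apply: le_trans (lee_wpmul2l _ le1) _.
  by rewrite lee_fin invr_ge0 powR_ge0.
rewrite muleA -EFinM (_ : (V `^ (p - 1))^-1 * _ = 2 `^ p)//.
by field; rewrite gt_eqF// powR_gt0.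
Qed.

(** Up to a factor the mean is the best constant. With [a] a value of [f], this relates the
    deviation from [P v] to the inner Besov integral. *)
Lemma mean_deviation_le a :
  (\int[mu]_(x in D) (`|f x - fine (mean mu D (EFin \o f))| `^ p)%:E <=
   (2 `^ p * (1 + 2 `^ p))%:E * \int[mu]_(x in D) (`|f x - a| `^ p)%:E)%E.
Proof.
apply: le_trans (deviation_shift a _) _; rewrite EFinM -muleA lee_wpmul2l ?lee_fin ?powR_ge0//.
rewrite EFinD ge0_muleDl ?lee_fin ?powR_ge0// mul1e leeD2l//.
by rewrite DV -EFinM mulrC; exact: mean_deviation.
Qed.

End deviation.

Lemma integral_cover_le d (T : measurableType d) (R : realType)
    (mu : {measure set T -> \bar R}) (I : eqType) (s : seq I) (D : I -> set T)
    (B : set T) (h : T -> \bar R) :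
  (forall i, measurable (D i)) -> measurable_fun setT h -> (forall x, 0 <= h x)%E ->
  (forall x, B x -> exists2 i, i \in s & D i x) ->
  (\int[mu]_(x in B) h x <= \sum_(i <- s) \int[mu]_(x in D i) h x)%E.
Proof.
move=> mD mh h0 Bs.
under [leRHS]eq_bigr do rewrite integral_mkcond.
rewrite -ge0_integral_sum//.
- rewrite integral_mkcond; apply: ge0_le_integral_nm => x _.
    by rewrite patchE; case: ifP.
  rewrite [leLHS]patchE; case: ifPn => [/set_mem/Bs[i si Dx]|_]; last first.
    by apply: sume_ge0 => i _; rewrite patchE; case: ifP.
  rewrite (big_rem i si)/= [in X in (_ <= X + _)%E]patchE mem_set// leeDl//.
  by apply: sume_ge0 => k _; rewrite patchE; case: ifP.
- by move=> i; apply/(measurable_restrictT _ (mD i)).1; exact: measurable_funTS.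
- by move=> i x _; rewrite patchE; case: ifP.
Qed.

(** * Besov functions at small scales *)

Section besov_levels.
Context {R : realType} {Z : completeMetricType R}.
Variables (alpha tau Cnu : R) (S : int -> set Z).
Variable nu : {outer_measure set Z -> \bar R}.
Hypothesis alpha1 : 1 < alpha.
Hypothesis tau3 : 3 < tau.
Hypothesis maxS : forall n : int, maximal_separated (alpha ^ (- n)) (S n).
Hypothesis mm : metric_measure nu.
Hypothesis dbl : doubling nu Cnu.
Variables (Y : completeMetricType R) (iota : (Z * int -> R) -> Y) (j : Z -> Y).
Hypothesis compl : uniformized_completion alpha tau S iota.
Hypothesis bdry : boundary_identification alpha S iota j.
Local Notation vertex := (Z * int)%type.
Local Notation r n := (alpha ^ (- n%R)).
Local Notation vb v := (vball alpha tau v).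
Local Notation dZ := (fun x y : Z => mdist (j x) (j y)).
Local Notation nuC := (nu : set (caratheodory_type nu) -> \bar R).

Let alpha0 : 0 < alpha. Proof. exact: lt_trans alpha1. Qed.
Let tau0 : 0 < tau. Proof. by have := tau3; lra. Qed.
Let rgt0 (n : int) : 0 < r n. Proof. exact: exprz_gt0. Qed.
Hint Resolve rgt0 : core.

Lemma lipJ_gt0 : 0 < lipJ alpha.
Proof. by rewrite mulr_gt0//; have := geom_ge1 alpha1; lra. Qed.

Lemma ball_sub_dball x (s : R) : ball x (s / lipJ alpha) `<=` dball dZ x s.
Proof.
move=> y; rewrite ballEmdist/= ltr_pdivlMr ?lipJ_gt0// mulrC.
exact: le_lt_trans (boundary_dist_le_dist alpha1 tau3 maxS compl bdry _ _).
Qed.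

Lemma dball_sub_ball x (s : R) : dball dZ x s `<=` ball x (lipB alpha tau * s).
Proof.
move=> y xy; rewrite ballEmdist/=.
apply: le_lt_trans (dist_le_boundary_dist alpha1 tau3 maxS compl bdry _ _) _.
by rewrite ltr_pM2l// (lipB_gt0 alpha1 tau3).
Qed.

Lemma nu_dball x (s : R) : 0 < s -> nu (dball dZ x s) = (vol nu (dball dZ x s))%:E.
Proof.
move=> s0; rewrite /vol fineK// ge0_fin_numE ?outer_measure_ge0//.
apply: le_lt_trans (nu_mono _ (@dball_sub_ball x s)) _.
by rewrite (volE mm) ?ltry// mulr_gt0// (lipB_gt0 alpha1 tau3).
Qed.

Lemma vol_dball x (s : R) : 0 < s ->
  vol nu (ball x (s / lipJ alpha)) <= vol nu (dball dZ x s) <= vol nu (ball x (lipB alpha tau * s)).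
Proof.
move=> s0; have B0 := lipB_gt0 alpha1 tau3; have J0 := lipJ_gt0.
rewrite -!lee_fin -nu_dball// -!(volE mm) ?mulr_gt0 ?invr_gt0//.
by rewrite !nu_mono//; [exact: dball_sub_ball|exact: ball_sub_dball].
Qed.

Lemma vol_dball_gt0 x (s : R) : 0 < s -> 0 < vol nu (dball dZ x s).
Proof.
move=> s0; have /andP[h _] := vol_dball x s0; apply: lt_le_trans h.
by rewrite (vol_gt0 mm)// divr_gt0// lipJ_gt0.
Qed.

Lemma measurable_vball v : measurable (vb v : set (caratheodory_type nu)).
Proof. exact: ball_cara mm _ _. Qed.

Variables (p theta : R) (f : Z -> R).
Hypothesis p1 : 1 <= p.
Hypothesis theta0 : 0 < p * theta.
Hypothesis mf : measurable_fun [set: caratheodory_type nu] (f : caratheodory_type nu -> R).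
Local Notation P := (extension_vertex alpha tau nu f).

Let p0 : 0 < p. Proof. exact: lt_le_trans ltr01 p1. Qed.

(** For [x] and [y] in [vball v], the ball around [x] in the boundary metric with radius the
    distance to [y] lies in the ball around [v.1] dilated by this factor relative to [vball v]. *)
Definition besov_ratio : R := 1 + 2 * lipB alpha tau * lipJ alpha.

(** An upper bound, on pairs of points of [vball v], of the denominator of the Besov integrand. *)
Definition besov_scale (v : vertex) : R :=
  (2 * lipJ alpha * (tau * r v.2)) `^ (p * theta) *
  (dbl_const Cnu besov_ratio * vol nu (vb v)).

Lemma besov_ratio_ge0 : 0 <= besov_ratio.
Proof. by have := lipB_gt0 alpha1 tau3; have := lipJ_gt0; rewrite /besov_ratio; nra. Qed.

Lemma besov_scale_gt0 v : 0 < besov_scale v.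
Proof.
have J0 := lipJ_gt0; have v0 := vol_vball_gt0 alpha1 tau3 mm v.
have d0 := dbl_const_gt0 Cnu besov_ratio.
apply: mulr_gt0; last exact: mulr_gt0.
by apply: powR_gt0; apply: mulr_gt0; apply: mulr_gt0.
Qed.

Lemma besov_inner_ge v y : vb v y ->
  ((besov_scale v)^-1%:E * \int[nuC]_(x in vb v) (`|f x - f y| `^ p)%:E <=
   \int[nuC]_x ((`|f x - f y| `^ p / dZ x y `^ (p * theta))%:E *
                (nu (dball dZ x (dZ x y)))^-1))%E.
Proof.
move=> vy; have mfv : measurable_fun (vb v : set (caratheodory_type nu)) f.
  exact: measurable_funTS.
rewrite -ge0_integralZl_EFin; last 4 first.
- exact: measurable_vball.
- by move=> x _; rewrite lee_fin powR_ge0.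
- by apply: measurable_powR_dist => //; exact: measurable_vball.
- by rewrite invr_ge0 ltW// besov_scale_gt0.
have int0 x : (0 <= (`|f x - f y| `^ p / dZ x y `^ (p * theta))%:E * (nu (dball dZ x (dZ x y)))^-1)%E.
  by rewrite mule_ge0 ?inve_ge0 ?outer_measure_ge0// lee_fin mulr_ge0 ?invr_ge0 ?powR_ge0.
apply: (@le_trans _ _ (\int[nuC]_(x in vb v) ((`|f x - f y| `^ p / dZ x y `^ (p * theta))%:E *
                (nu (dball dZ x (dZ x y)))^-1))%E); last first.
  exact: ge0_subset_integral_nm.
apply: ge0_le_integral_nm => x vx.
  by rewrite lee_fin mulr_ge0 ?powR_ge0// invr_ge0 ltW// besov_scale_gt0.
(* On the diagonal both integrands vanish, so the inverse volume of an empty ball does no harm. *)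
have [d0|d0] := eqVneq (dZ x y) 0.
  suff -> : x = y by rewrite subrr normr0 powR0 ?gt_eqF// mule0 mul0r mul0e.
  apply: mdist_positivity; apply/eqP; rewrite eq_le mdist_ge0 andbT.
  by have := dist_le_boundary_dist alpha1 tau3 maxS compl bdry x y; rewrite d0 mulr0.
have dgt0 : 0 < dZ x y by rewrite lt_neqAle eq_sym d0 mdist_ge0.
have Vgt0 := vol_dball_gt0 x dgt0.
rewrite nu_dball// inver gt_eqF// -EFinM lee_fin mulrC -mulrA ler_wpM2l ?powR_ge0//.
rewrite -invfM lef_pV2 ?posrE ?besov_scale_gt0 ?mulr_gt0 ?powR_gt0//.
have B0 := lipB_gt0 alpha1 tau3; have J0 := lipJ_gt0; have t0 : 0 < tau * r v.2 by rewrite mulr_gt0.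
move: vx vy; rewrite /vball !ballEmdist/= => vx vy.
have dle : dZ x y <= 2 * lipJ alpha * (tau * r v.2).
  apply: le_trans (boundary_dist_le_dist alpha1 tau3 maxS compl bdry _ _) _.
  have := metric_triangle x v.1 y; rewrite (metric_sym x v.1) => h.
  rewrite (_ : 2 * _ * _ = lipJ alpha * (2 * (tau * r v.2))); last by ring.
  by rewrite ler_wpM2l ?(ltW J0)//; lra.
rewrite /besov_scale ler_pM ?powR_ge0 ?(ltW Vgt0)//.
  have dle0 := le_trans (ltW dgt0) dle.
  by have := ge0_ler_powR (ltW theta0) (ltW dgt0) dle0 dle.
have /andP[_ h] := vol_dball x dgt0; apply: le_trans h _.
apply: (vol_doubling mm dbl) => //; first by rewrite mulr_gt0.
  exact: besov_ratio_ge0.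
rewrite /besov_ratio mulrDl mul1r lerD ?(ltW vx)//.
by apply: le_trans (ler_wpM2l (ltW B0) dle) _; rewrite le_eqVlt; apply/orP; left; apply/eqP; ring.
Qed.

Definition besov_const : R := 2 `^ p * (1 + 2 `^ p) *
  ((2 * lipJ alpha * tau) `^ (p * theta) *
   (dbl_const Cnu besov_ratio * dbl_const Cnu (2 * tau))).

Lemma besov_const_ge0 : 0 <= besov_const.
Proof.
have d1 := ltW (dbl_const_gt0 Cnu besov_ratio).
have d2 := ltW (dbl_const_gt0 Cnu (2 * tau)).
by rewrite mulr_ge0 ?mulr_ge0 ?addr_ge0 ?powR_ge0.
Qed.

(* For every [y] in [vb v] the inner integral of the Besov energy at [y] bounds
   the oscillation of [f] on [vb v]; as the balls of radius [r n / 2] around the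
   net are disjoint, the outer integral bounds the sum, without Fubini. *)
Lemma besov_level_sum (n : int) (F : seq vertex) : uniq F ->
  (forall v, v \in F -> vertices S v /\ v.2 = n) ->
  (\sum_(v <- F) \int[nuC]_(x in vb v) (`|f x - P v| `^ p)%:E <=
   (besov_const * r n `^ (p * theta))%:E * besov_energy nu dZ p theta f)%E.
Proof.
move=> uF Fn.
pose K : R := 2 `^ p * (1 + 2 `^ p).
have K0 : 0 < K by rewrite mulr_gt0 ?powR_gt0// addr_gt0 ?powR_gt0.
pose b : R := besov_const * r n `^ (p * theta).
have d1 := dbl_const_gt0 Cnu besov_ratio; have d2 := dbl_const_gt0 Cnu (2 * tau).
have J0 := lipJ_gt0.
have b0 : 0 < b.
  rewrite /b /besov_const -/K; apply: mulr_gt0; last exact: powR_gt0.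
  apply: mulr_gt0 => //; apply: mulr_gt0; last exact: mulr_gt0.
  by apply: powR_gt0; apply: mulr_gt0 => //; apply: mulr_gt0.
pose M v := (\int[nuC]_(x in vb v) (`|f x - P v| `^ p)%:E)%E.
have M0 v : (0 <= M v)%E by apply: integral_ge0 => x _; rewrite lee_fin powR_ge0.
pose h (v : vertex) : set (caratheodory_type nu) := ball v.1 (r v.2 / 2).
have r20 (v : vertex) : 0 < r v.2 / 2 by rewrite divr_gt0.
have hv v : h v `<=` vb v.
  apply: ball_sub; rewrite mdistxx add0r.
  by have := tau3; have := rgt0 v.2; nra.
have key : (\sum_(v <- F) ((besov_scale v)^-1 * K^-1)%:E * M v * nuC (h v) <=
    besov_energy nu dZ p theta f)%E.
  apply: (@sum_cst_le_integral _ _ _ nuC _ F h (fun v => ((besov_scale v)^-1 * K^-1)%:E * M v)%E) => //.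
  - by move=> v _; exact: ball_cara mm _ _.
  - move=> v w x vF wF vx wx; have [Vv vn] := Fn v vF; have [Vw wn] := Fn w wF.
    apply/eqP; rewrite [v]surjective_pairing [w]surjective_pairing xpair_eqE vn wn eqxx andbT.
    apply/eqP; apply: (vball_disjoint maxS (n := n) (w := x)).
    + by rewrite -vn.
    + by rewrite -wn.
    + by move: vx; rewrite /h vn.
    + by move: wx; rewrite /h wn.
  - by move=> v _; rewrite mule_ge0// lee_fin mulr_ge0 ?invr_ge0 ?(ltW K0) ?(ltW (besov_scale_gt0 _)).
  - move=> y _; apply: integral_ge0 => x _.
    by rewrite mule_ge0 ?inve_ge0 ?outer_measure_ge0// lee_fin mulr_ge0 ?invr_ge0 ?powR_ge0.
  - move=> v y vF /hv vy; apply: le_trans (besov_inner_ge vy).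
    rewrite EFinM -muleA lee_wpmul2l ?lee_fin ?invr_ge0 ?(ltW (besov_scale_gt0 _))//.
    rewrite lee_pdivrMl//.
    have mfv : measurable_fun (vb v : set (caratheodory_type nu)) f by exact: measurable_funTS.
    exact: (mean_deviation_le p1 (measurable_vball v) mfv (nu_vball alpha1 tau3 mm v)
       (vol_vball_gt0 alpha1 tau3 mm v) (f y)).
have : (\sum_(v <- F) b^-1%:E * M v <= besov_energy nu dZ p theta f)%E.
  apply: le_trans key; rewrite big_seq_cond [leRHS]big_seq_cond.
  apply: lee_sum => v /andP[vF _]; have [Vv vn] := Fn v vF.
  rewrite [leRHS]muleAC lee_wpmul2r// /h (volE mm)// -EFinM lee_fin.
  have vv := vol_vball_gt0 alpha1 tau3 mm v.
  have vle : vol nu (vb v) <= dbl_const Cnu (2 * tau) * vol nu (ball v.1 (r v.2 / 2)).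
    apply: (vol_doubling mm dbl) => //; first by rewrite mulr_gt0.
      by rewrite mulr_ge0// ltW.
    by rewrite mdistxx add0r le_eqVlt; apply/orP; left; apply/eqP; field.
  have sK : 0 < besov_scale v * K := mulr_gt0 (besov_scale_gt0 v) K0.
  rewrite -invfM ler_pdivlMl//.
  rewrite ler_pdivrMr//; apply: (@le_trans _ _ (besov_scale v * K / vol nu (vb v) * (dbl_const Cnu (2 * tau) * vol nu (ball v.1 (r v.2 / 2))))).
    rewrite -mulrA (ler_peMr (ltW sK))//.
    by rewrite mulrC ler_pdivlMr// mul1r.
  rewrite le_eqVlt; apply/orP; left; apply/eqP.
  rewrite /b /besov_const /besov_scale -/K vn.
  rewrite (_ : 2 * lipJ alpha * (tau * r n) = (2 * lipJ alpha * tau) * r n); last by ring.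
  have Jt : 0 <= 2 * lipJ alpha * tau by rewrite ltW// mulr_gt0// mulr_gt0.
  by rewrite (powRM _ Jt (ltW (rgt0 _))); field; rewrite gt_eqF.
rewrite -ge0_sume_distrr; last by move=> v _; exact: M0.
by rewrite lee_pdivrMl.
Qed.

(* Letting the level [n] tend to infinity replaces Lebesgue's differentiation
   theorem. *)
Lemma ball_deviation (m : int) (z : Z) (s c : R) (T : \bar R) : 0 < s ->
  lipB alpha tau * s <= r m -> (besov_energy nu dZ p theta f < +oo)%E ->
  (forall n F, m <= n -> uniq F ->
    (forall v, v \in F -> [/\ vertices S v, v.2 = n & mdist v.1 z <= 2 * r m]) ->
    (\sum_(v <- F) (vol nu (vb v) * `|P v - c| `^ p)%:E <= T)%E) ->
  (\int[nuC]_(x in dball dZ z s) (`|f x - c| `^ p)%:E <= (2 `^ p)%:E * T)%E.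
Proof.
move=> s0 sm Ef FT.
have E0 : (0 <= besov_energy nu dZ p theta f)%E.
  apply: integral_ge0 => y _; apply: integral_ge0 => x _.
  by rewrite mule_ge0 ?inve_ge0 ?outer_measure_ge0// lee_fin mulr_ge0 ?invr_ge0 ?powR_ge0.
pose e := fine (besov_energy nu dZ p theta f).
have eE : besov_energy nu dZ p theta f = e%:E by rewrite fineK// ge0_fin_numE.
have e0 : 0 <= e by rewrite fine_ge0.
have lev (n : int) : m <= n -> (\int[nuC]_(x in dball dZ z s) (`|f x - c| `^ p)%:E <=
    (2 `^ p)%:E * ((besov_const * r n `^ (p * theta))%:E * e%:E + T))%E.
  move=> mn; set W := [set v | vertices S v /\ v.2 = n /\ mdist z v.1 <= 2 * r m].
  have finW : finite_set W := finite_net alpha1 tau3 maxS mm dbl n z _.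
  pose F : seq vertex := finmap.enum_fset (fset_set W).
  have uF : uniq F by exact: finmap.fset_uniq.
  have FW v : v \in F = (v \in W) by rewrite in_fset_set.
  have FV v : v \in F -> [/\ vertices S v, v.2 = n & mdist v.1 z <= 2 * r m].
    by rewrite FW => /set_mem[? [? ?]]; rewrite metric_sym.
  apply: (@le_trans _ _ (\sum_(v <- F) \int[nuC]_(x in vb v) (`|f x - c| `^ p)%:E)%E).
    apply: (@integral_cover_le _ _ _ nuC) => //.
    - exact: measurable_vball.
    - exact: measurable_powR_dist.
    - move=> x /dball_sub_ball; rewrite ballEmdist/= => zx.
      have [Sx dx] := net_ptP alpha1 maxS n x.
      exists (net_vertex alpha S n x); last first.
        by rewrite /vball ballEmdist/=; have := tau3; have := rgt0 n; nra.
      rewrite FW; apply/mem_set; split; first exact: vertices_net.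
      split => //=; have := metric_triangle z x (net_pt alpha S n x).
      rewrite (metric_sym x); have := ler_exprzN alpha1 mn; lra.
  apply: (@le_trans _ _ (\sum_(v <- F) (2 `^ p)%:E * (\int[nuC]_(x in vb v) (`|f x - P v| `^ p)%:E
      + (vol nu (vb v) * `|P v - c| `^ p)%:E))%E).
    apply: lee_sum => v _; rewrite mulrC EFinM -(nu_vball alpha1 tau3 mm).
    apply: (@deviation_shift _ _ _ nuC _ _ _ p1 (measurable_vball v)).
    exact: measurable_funTS.
  have M0 v : (0 <= \int[nuC]_(x in vb v) (`|f x - P v| `^ p)%:E)%E.
    by apply: integral_ge0 => x _; rewrite lee_fin powR_ge0.
  have N0 v : (0 <= (vol nu (vb v) * `|P v - c| `^ p)%:E)%E.
    by rewrite lee_fin mulr_ge0 ?powR_ge0// ltW// (vol_vball_gt0 alpha1 tau3 mm).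
  rewrite -ge0_sume_distrr; last by move=> v _; exact: adde_ge0.
  rewrite lee_wpmul2l ?lee_fin ?powR_ge0// big_split/= leeD//.
    rewrite -eE; apply: besov_level_sum => // v /FV[]//.
  exact: FT mn uF FV.
have T0 : (0 <= T)%E.
  by apply: le_trans (FT m [::] (lexx _) isT _) => //; rewrite big_nil.
apply/lee_addgt0Pr => ep ep0.
pose A := 2 `^ p * (besov_const * e) + 1.
have A0 : 0 < A by rewrite ltr_wpDl// mulr_ge0 ?powR_ge0// mulr_ge0// besov_const_ge0.
have [N HN] : exists N : nat, forall n : nat, (N <= n)%N -> alpha ^ (- n%:Z) <= (ep / A) `^ (p * theta)^-1.
  by apply: exprz_small => //; rewrite powR_gt0// divr_gt0.
pose n : int := Num.max m N%:Z.
have rn : r n `^ (p * theta) <= ep / A.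
  have h : r n <= (ep / A) `^ (p * theta)^-1.
    apply: le_trans (HN N (leqnn _)); apply: ler_exprzN => //.
    by rewrite le_max lexx orbT.
  have := ge0_ler_powR (ltW theta0) _ _ h; rewrite !nnegrE powR_ge0 (ltW (rgt0 _)).
  move=> /(_ isT isT) /le_trans; apply.
  by rewrite -powRrM mulVf ?gt_eqF// powRr1// ltW// divr_gt0.
have mn : m <= n by rewrite le_max lexx.
apply: le_trans (lev n mn) _.
rewrite -EFinM muleDr// ?ge0_adde_def ?inE//.
rewrite addeC leeD2l// -EFinM lee_fin.
apply: (@le_trans _ _ (A * r n `^ (p * theta))).
  by rewrite /A mulrDl mul1r ler_wpDr ?powR_ge0// le_eqVlt; apply/orP; left; apply/eqP; ring.
by rewrite mulrC -ler_pdivlMr.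
Qed.

End besov_levels.

(** * Integrals over balls centered on the boundary *)

Section ball_mass.
Context {R : realType} {Z : completeMetricType R}.
Variables (alpha tau Cnu : R) (S : int -> set Z).
Variable nu : {outer_measure set Z -> \bar R}.
Hypothesis alpha1 : 1 < alpha.
Hypothesis tau3 : 3 < tau.
Hypothesis maxS : forall n : int, maximal_separated (alpha ^ (- n)) (S n).
Hypothesis mm : metric_measure nu.
Hypothesis dbl : doubling nu Cnu.
Variables (Y : completeMetricType R) (iota : (Z * int -> R) -> Y) (j : Z -> Y).
Hypothesis compl : uniformized_completion alpha tau S iota.
Hypothesis bdry : boundary_identification alpha S iota j.
Variable beta : R.
Hypothesis beta0 : 0 < beta.
Local Notation vertex := (Z * int)%type.
Local Notation E := (filling_edge alpha tau S).
Local Notation r n := (alpha ^ (- n%R)).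
Local Notation lam := (@lebesgue_measure R).
Local Notation Xp := (Xpart alpha tau S iota).
Local Notation vb v := (vball alpha tau v).
Local Notation ec := (edge_curve iota).
Local Notation mub := (mub alpha1 tau3 maxS mm dbl compl beta).

Let alpha0 : 0 < alpha. Proof. exact: lt_trans alpha1. Qed.
Let tau0 : 0 < tau. Proof. by have := tau3; lra. Qed.
Let rgt0 (n : int) : 0 < r n. Proof. exact: exprz_gt0. Qed.
Hint Resolve rgt0 : core.
Let vgt0 v : 0 < vol nu (vb v). Proof. exact: vol_vball_gt0 alpha1 tau3 mm v. Qed.

Definition edge_vol_const : R := dbl_const Cnu (2 * alpha + 1).

(* The neighbors of a vertex lie on three levels. *)
Definition degree_const : R :=
  edge_vol_const * (3 * (dbl_const Cnu (2 * tau) * dbl_const Cnu (1 + 2 * alpha))).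

Lemma neighbors_vol (v : vertex) (s : seq vertex) : uniq s ->
  (forall w, w \in s -> E v w) ->
  \sum_(w <- s) vol nu (vb w) <=
  3 * (dbl_const Cnu (2 * tau) * dbl_const Cnu (1 + 2 * alpha)) * vol nu (vb v).
Proof.
move=> us sE.
set B := dbl_const Cnu (2 * tau) * _.
have B0 : 0 <= B by rewrite mulr_ge0 ?(ltW (dbl_const_gt0 _ _)).
have -> : \sum_(w <- s) vol nu (vb w) = \sum_(w <- s) vol nu (vb w) * (fun=> 1 : R) w.2.
  by apply: eq_bigr => w _; rewrite mulr1.
rewrite (sum_by_key s snd (fun w => vol nu (vb w)) (fun=> 1)).
set L := undup _.
have lev l : \sum_(w <- s | w.2 == l) vol nu (vb w) <= B * vol nu (vb v).
  have [lv|nol] := pselect (exists2 w, w \in s & w.2 = l); last first.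
    rewrite big_seq_cond big1 => [|w /andP[ws /eqP wl]].
      by rewrite (mulr_ge0 B0)// ltW.
    by case: nol; exists w.
  have [w0 w0s w0l] := lv; have w0v := edge_radius alpha1 (sE _ w0s).
  rewrite w0l in w0v.
  rewrite -big_filter.
  apply: le_trans (net_sum_vol alpha1 tau3 maxS mm dbl (n := l) (u := v.1)
      (s := (1 + 2 * alpha) * (tau * r v.2)) _ _ _) _.
  - exact: filter_uniq.
  - by rewrite !mulr_gt0// addr_gt0// mulr_gt0.
  - move=> w; rewrite mem_filter => /andP[/eqP wl ws].
    have [Vv Vw _ _ [x []]] := sE _ ws; rewrite /vball !ballEmdist/= wl => vx wx.
    split => //; have := metric_triangle v.1 x w.1; rewrite (metric_sym x).
    have : tau * r l <= tau * (alpha * r v.2) by rewrite ler_wpM2l// ltW.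
    have : r l <= tau * r l by rewrite ler_peMl ?(ltW (rgt0 _))//; have := tau3; lra.
    set a := tau * r l in wx *; set b := tau * r v.2 in vx *.
    rewrite (_ : tau * (alpha * r v.2) = alpha * b); last by rewrite /b; ring.
    have : 0 <= alpha * b by rewrite !mulr_ge0// ltW.
    lra.
  - rewrite /B -mulrA ler_wpM2l ?(ltW (dbl_const_gt0 _ _))//.
    apply: (vol_doubling mm dbl) => //.
    + by rewrite !mulr_gt0// addr_gt0// mulr_gt0.
    + by rewrite mulr_gt0.
    + by rewrite addr_ge0// mulr_ge0// ltW.
    + by rewrite mdistxx add0r.
apply: (@le_trans _ _ (\sum_(l <- L) B * vol nu (vb v))).
  by apply: ler_sum => l _; rewrite mulr1; exact: lev.
rewrite big_const_seq count_predT iter_addr_0 -[leLHS]mulr_natl -[leRHS]mulrA.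
rewrite ler_wpM2r ?(mulr_ge0 B0) ?(ltW (vgt0 _))//.
rewrite ler_nat; apply: (@uniq_leq_size _ L [:: v.2 - 1; v.2; v.2 + 1]).
  exact: undup_uniq.
move=> l; rewrite mem_undup => /mapP[w ws ->].
have [_ _ _ h _] := sE _ ws; rewrite !inE.
have -> : w.2 = v.2 - (v.2 - w.2) by rewrite subKr.
move: (v.2 - w.2) h => [[|[|n]]|[|n]]// _; first by rewrite subr0 eqxx orbT.
  by rewrite eqxx.
by rewrite NegzE opprK eqxx !orbT.
Qed.

(** Every neighbor of [v] has at least the share [edge_vol_const^-1] of the volume of [v], while
    [neighbors_vol] bounds the sum of their volumes. *)
Lemma degree_le (v : vertex) (s : seq (vertex * vertex)) : uniq s ->
  (forall e, e \in s -> E e.1 e.2) -> \sum_(e <- s | e.1 == v) 1 <= degree_const.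
Proof.
move=> us sE; rewrite -big_filter.
set t := [seq e <- s | e.1 == v].
have tE e : e \in t -> e.1 = v /\ E v e.2.
  by rewrite mem_filter => /andP[/eqP <- /sE].
rewrite -(big_map snd predT (fun=> 1 : R)).
have uw : uniq [seq e.2 | e <- t].
  rewrite map_inj_in_uniq ?filter_uniq// => -[a b] [a' b'] /tE[/= -> _] /tE[/= -> _].
  by move=> ->.
have wE w : w \in [seq e.2 | e <- t] -> E v w by move=> /mapP[e /tE[_ h] ->].
rewrite -(ler_pM2r (vgt0 v)) /degree_const -mulrA.
apply: le_trans (ler_wpM2l _ (neighbors_vol uw wE)); last exact/ltW/dbl_const_gt0.
rewrite mulr_suml mulr_sumr big_seq_cond [leRHS]big_seq_cond; apply: ler_sum => w /andP[ws _].
by rewrite mul1r (vol_edge alpha1 tau3 mm dbl (wE _ ws)).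
Qed.

Lemma sum_fst_le (phi : vertex -> R) (M : R) (s : seq (vertex * vertex)) :
  (forall v, 0 <= phi v) -> uniq s -> (forall e, e \in s -> E e.1 e.2) ->
  (forall F, uniq F -> \sum_(v <- F) phi v <= M) ->
  \sum_(e <- s) phi e.1 <= degree_const * M.
Proof.
move=> phi0 us sE FM.
have d0 : 0 <= degree_const.
  rewrite mulr_ge0 ?(ltW (dbl_const_gt0 _ _))// mulr_ge0//.
  by rewrite mulr_ge0 ?(ltW (dbl_const_gt0 _ _)).
have -> : \sum_(e <- s) phi e.1 = \sum_(e <- s) 1 * phi e.1.
  by apply: eq_bigr => e _; rewrite mul1r.
rewrite (sum_by_key s fst (fun=> 1)).
apply: (@le_trans _ _ (\sum_(v <- undup [seq e.1 | e <- s]) degree_const * phi v)).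
  by apply: ler_sum => v _; rewrite ler_wpM2r//; exact: degree_le.
by rewrite -mulr_sumr ler_wpM2l//; exact: FM (undup_uniq _).
Qed.

Lemma sum_edge_le (phi : vertex -> R) (M : R) (s : seq (vertex * vertex)) :
  (forall v, 0 <= phi v) -> uniq s -> (forall e, e \in s -> E e.1 e.2) ->
  (forall F, uniq F -> \sum_(v <- F) phi v <= M) ->
  \sum_(e <- s) (phi e.1 + phi e.2) <= 2 * degree_const * M.
Proof.
move=> phi0 us sE FM; rewrite big_split/= -mulrA mulr2n mulrDl mul1r lerD//.
  exact: sum_fst_le.
pose swap (e : vertex * vertex) := (e.2, e.1).
have -> : \sum_(e <- s) phi e.2 = \sum_(e <- map swap s) phi e.1 by rewrite big_map.
apply: sum_fst_le => //.
  by rewrite map_inj_uniq// => -[a b] [a' b'] [-> ->].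
by move=> _ /mapP[e es ->]; apply: filling_edgeC; exact: sE.
Qed.

Definition level_ratio : R := alpha `^ (- beta).

Lemma level_ratio_lt1 : level_ratio < 1.
Proof.
rewrite /level_ratio powRN invf_lt1 ?powR_gt0//.
by have := gt0_ltr_powR beta0 _ _ alpha1; rewrite powR1; apply; rewrite nnegrE ?ltW.
Qed.

(** * Weighted sums over the vertices near a ball *)

Section weights.
Variables (m : int) (z : Z) (a : vertex -> R) (T : R).
Hypothesis a0 : forall v, 0 <= a v.
Hypothesis aT : forall n F, m <= n -> uniq F ->
  (forall v, v \in F -> [/\ vertices S v, v.2 = n & mdist v.1 z <= 2 * r m]) ->
  \sum_(v <- F) vol nu (vb v) * a v <= T.

Definition near_vertex (v : vertex) : Prop :=
  [/\ vertices S v, m <= v.2 & mdist v.1 z <= 2 * r m].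

Definition vertex_mass (v : vertex) : R :=
  if `[< near_vertex v >] then r v.2 `^ beta * (vol nu (vb v) * a v) else 0.

Lemma vertex_mass_ge0 v : 0 <= vertex_mass v.
Proof.
by rewrite /vertex_mass; case: ifP => // _; rewrite mulr_ge0 ?powR_ge0// mulr_ge0// ltW.
Qed.

(** On the level [m + k] the weight is [level_ratio ^+ k] times that of level [m] and the volume sum
    is at most [T]; the levels then form a geometric series. *)
Lemma vertex_mass_sum F : uniq F ->
  \sum_(v <- F) vertex_mass v <= r m `^ beta * T * (1 - level_ratio)^-1.
Proof.
move=> uF; have T0 : 0 <= T by apply: le_trans (aT (lexx m) (_ : uniq [::]) _); rewrite ?big_nil.
pose F' := [seq v <- F | `[< near_vertex v >]].
have F'W v : v \in F' -> near_vertex v by rewrite mem_filter => /andP[/asboolP].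
have -> : \sum_(v <- F) vertex_mass v =
    \sum_(v <- F') (r v.2 `^ beta * (vol nu (vb v) * a v)) * (fun=> 1 : R) `|v.2 - m|%N.
  rewrite big_filter [RHS]big_mkcond; apply: eq_bigr => v _.
  by rewrite /vertex_mass; case: ifP; rewrite ?mulr1.
rewrite (sum_by_key F' (fun v => `|v.2 - m|%N) _ (fun=> 1)).
have k1 := level_ratio_lt1; have k0 : 0 <= level_ratio by exact: powR_ge0.
apply: (@le_trans _ _ (\sum_(k <- undup [seq `|v.2 - m|%N | v <- F']) r m `^ beta * T * level_ratio ^+ k)).
  apply: ler_sum => k _; rewrite mulr1 -big_filter.
  set F'' := [seq i <- F' | _].
  have F''P v : v \in F'' -> [/\ vertices S v, v.2 = m + k%:Z & mdist v.1 z <= 2 * r m].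
    rewrite mem_filter => /andP[/eqP kv /F'W[Vv mv vz]]; split => //.
    by rewrite -kv gez0_abs ?subr_ge0// addrCA subrr addr0.
  have rk : r (m + k%:Z) `^ beta = r m `^ beta * level_ratio ^+ k.
    rewrite -powR_mulrn// /level_ratio -!powRN_int// -!powRrM -powRD ?(gt_eqF alpha0) ?implybT//.
    by congr (_ `^ _); rewrite intrD; ring.
  apply: (@le_trans _ _ (\sum_(v <- F'') r (m + k%:Z) `^ beta * (vol nu (vb v) * a v))).
    rewrite le_eqVlt; apply/orP; left; apply/eqP; apply: eq_big_seq => v /F''P[_ -> _].
    by [].
  rewrite -mulr_sumr rk [leRHS]mulrAC ler_wpM2l ?mulr_ge0 ?powR_ge0 ?exprn_ge0//.
  by apply: (aT (n := m + k%:Z)) F''P; rewrite ?lerDl ?filter_uniq.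
rewrite -mulr_sumr ler_wpM2l ?mulr_ge0 ?powR_ge0//.
exact: sum_geometric_uniq (undup_uniq _).
Qed.

(** The factors are the density on an edge, the ratio of the radii of its ends, the ratio of their
    volumes, the number of ordered edges at a vertex, counted from either end, and the geometric
    series over the levels. *)
Definition upper_const : R :=
  alpha `^ beta * alpha `^ beta * (1 + edge_vol_const) *
  (2 * degree_const * (1 - level_ratio)^-1).

Lemma near_edge v w t (s : R) : lipH alpha * s <= r m ->
  lipC alpha tau * s <= 2 * r m -> E v w -> t \in `[0, 1] ->
  mdist (j z) (ec v w t) < s -> near_vertex v.
Proof.
move=> hs cs vw t01 near; have [Vv _ _ _ _] := vw.
have [h1 h2] := edge_near_boundary alpha1 tau3 maxS compl bdry vw t01 near.
split => //; last exact: le_trans h2 cs.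
rewrite leNgt; apply/negP; move=> vm.
have : r m <= r (v.2 + 1) by apply: ler_exprzN => //; rewrite lezD1.
have := exprzNS alpha1 v.2; have := rgt0 (v.2 + 1).
have := le_trans h1 hs; have := alpha1; nra.
Qed.

(** Used twice: with [a] equal to 1 for the mass of a ball, and with the p-th power of the distance
    from [P v] to a constant for the deviation of the extension. *)
Lemma ball_integral_le (s : R) (G : borel_type Y -> \bar R) : lipH alpha * s <= r m ->
  lipC alpha tau * s <= 2 * r m ->
  measurable_fun (ball (j z) s `&` Xp : set (borel_type Y)) G ->
  (forall y, 0 <= G y)%E ->
  (forall v w t, E v w -> t \in `[0, 1] -> (G (ec v w t) <= (a v + a w)%:E)%E) ->
  (\int[mub]_(y in ball (j z) s `&` Xp) G y <= (upper_const * (r m `^ beta * T))%:E)%E.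
Proof.
move=> hs cs mG G0 Ga.
have mD : measurable (ball (j z) s `&` Xp : set (borel_type Y)).
  have mX := measurable_Xpart alpha1 tau3 maxS mm dbl compl.
  apply: measurableI => //.
  by apply: sub_sigma_algebra; exact: open_mball.
apply: le_trans (mub_integral_le alpha1 tau3 maxS mm dbl compl beta0 mD mG (fun y _ => G0 y)) _.
pose K := alpha `^ beta * alpha `^ beta * (1 + edge_vol_const).
have ev1 : 1 <= edge_vol_const by exact: dbl_const_ge1.
have ab1 : 1 <= alpha `^ beta.
  by have := ge0_ler_powR (ltW beta0) _ _ (ltW alpha1); rewrite powR1; apply; rewrite nnegrE ?ltW.
have K0 : 0 <= K by rewrite mulr_ge0 ?mulr_ge0 ?powR_ge0// addr_ge0// (le_trans ler01).
have term e : edges alpha tau S e ->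
    ((alpha `^ beta * edge_mass alpha tau nu beta e)%:E *
     \int[lam]_(t in `[0%R, 1%R]%classic `&` ec e.1 e.2 @^-1` (ball (j z) s `&` Xp)) G (ec e.1 e.2 t)
     <= (K * (vertex_mass e.1 + vertex_mass e.2))%:E)%E.
  move=> Ee.
  have [[t0 [/= t001 [zt0 _]]]|no] := pselect (exists t, `[0%R, 1%R]%classic t /\ (ball (j z) s `&` Xp) (ec e.1 e.2 t)); last first.
    rewrite (_ : _ `&` _ = set0); last first.
      by apply/seteqP; split => // t [t01 Dt]; case: no; exists t.
    by rewrite integral_set0 mule0 lee_fin mulr_ge0// addr_ge0 ?vertex_mass_ge0.
  have n1 : near_vertex e.1.
    by apply: (near_edge hs cs Ee t001); move: zt0; rewrite ballEmdist.
  (* The same point read on the reversed edge. *)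
  have n2 : near_vertex e.2.
    have t01' : 1 - t0 \in `[0, 1].
      by move: t001; rewrite /= !in_itv/= => /andP[h1 h2]; apply/andP; split; lra.
    apply: (near_edge hs cs (filling_edgeC Ee) t01').
    rewrite /edge_curve -edge_ptC ; move: zt0; rewrite ballEmdist/=.
    by rewrite /edge_curve.
  have intle : (\int[lam]_(t in `[0%R, 1%R]%classic `&` ec e.1 e.2 @^-1` (ball (j z) s `&` Xp)) G (ec e.1 e.2 t)
      <= (a e.1 + a e.2)%:E)%E.
    apply: (@le_trans _ _ (\int[lam]_(t in `[0%R, 1%R]) (cst (a e.1 + a e.2)%:E) t)%E).
      apply: (@le_trans _ _ (\int[lam]_(t in `[0%R, 1%R]%classic `&`
          ec e.1 e.2 @^-1` (ball (j z) s `&` Xp)) (cst (a e.1 + a e.2)%:E) t)%E).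
        by apply: ge0_le_integral_nm => t [t01 _] //; exact: Ga.
      by apply: ge0_subset_integral_nm => [t _|t []//]; rewrite lee_fin addr_ge0.
    rewrite integral_cst//; have := @lebesgue_measure_itv R `[0, 1]%R.
    by rewrite /= lte_fin ltr01 -EFinB subr0 => ->; rewrite mule1.
  apply: le_trans (lee_wpmul2l _ intle) _.
    by rewrite lee_fin mulr_ge0 ?powR_ge0 ?edge_mass_ge0.
  rewrite -EFinM lee_fin edge_massE// /vertex_mass !asboolT//.
  rewrite /edge_weight.
  have v1 := vgt0 e.1; have v2 := vgt0 e.2.
  have e12 : vol nu (vb e.2) <= edge_vol_const * vol nu (vb e.1).
    by have := vol_edge alpha1 tau3 mm dbl (filling_edgeC Ee).
  have e21 : vol nu (vb e.1) <= edge_vol_const * vol nu (vb e.2).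
    by have := vol_edge alpha1 tau3 mm dbl Ee.
  have r12 : r e.1.2 `^ beta <= alpha `^ beta * r e.2.2 `^ beta.
    rewrite -powRM ?(ltW alpha0) ?(ltW (rgt0 _))//.
    have h := edge_radius alpha1 (filling_edgeC Ee).
    by have := ge0_ler_powR (ltW beta0) (ltW (rgt0 _)) (le_trans (ltW (rgt0 _)) h) h.
  have r11 : r e.1.2 `^ beta <= alpha `^ beta * r e.1.2 `^ beta.
    by rewrite ler_peMl ?powR_ge0.
  rewrite /K -!mulrA ler_wpM2l ?powR_ge0//.
  rewrite mulrCA mulrDr mulrDr mulrCA [_ * (_ * a e.1)]mulrA.
  have p1 : r e.1.2 `^ beta * ((vol nu (vb e.1) + vol nu (vb e.2)) * a e.1) <=
      alpha `^ beta * ((1 + edge_vol_const) * (r e.1.2 `^ beta * (vol nu (vb e.1) * a e.1))).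
    rewrite [leRHS](_ : _ = (alpha `^ beta * r e.1.2 `^ beta) * ((vol nu (vb e.1) + edge_vol_const * vol nu (vb e.1)) * a e.1)); last by ring.
    rewrite ler_pM ?powR_ge0 ?mulr_ge0 ?addr_ge0 ?(ltW v1) ?(ltW v2)//.
    by rewrite ler_wpM2r// lerD2l.
  have p2 : r e.1.2 `^ beta * ((vol nu (vb e.1) + vol nu (vb e.2)) * a e.2) <=
      alpha `^ beta * ((1 + edge_vol_const) * (r e.2.2 `^ beta * (vol nu (vb e.2) * a e.2))).
    rewrite [leRHS](_ : _ = (alpha `^ beta * r e.2.2 `^ beta) * ((edge_vol_const * vol nu (vb e.2) + vol nu (vb e.2)) * a e.2)); last by ring.
    rewrite ler_pM ?powR_ge0 ?mulr_ge0 ?addr_ge0 ?(ltW v1) ?(ltW v2)//.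
    by rewrite ler_wpM2r// lerD2r.
  move: p1 p2; lra.
apply: ge_ereal_sup => _ [/= F [finF FE] <-].
rewrite fsbig_finite//=; set q : seq (vertex * vertex) := finmap.enum_fset _.
have uq : uniq q by exact: finmap.fset_uniq.
have qE e : e \in q -> edges alpha tau S e by rewrite in_fset_set// => /set_mem/FE.
apply: (@le_trans _ _ (\sum_(e <- q) (K * (vertex_mass e.1 + vertex_mass e.2))%:E)%E).
  rewrite big_seq_cond [leRHS]big_seq_cond; apply: lee_sum => e /andP[eq _].
  exact: term (qE _ eq).
rewrite sumEFin lee_fin -mulr_sumr /upper_const -/K -mulrA ler_wpM2l//.
apply: le_trans (sum_edge_le vertex_mass_ge0 uq qE vertex_mass_sum) _.
by rewrite le_eqVlt; apply/orP; left; apply/eqP; ring.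
Qed.

End weights.
End ball_mass.

(** * Mass of balls centered on the boundary *)

Section scales.
Context {R : realType} {Z : completeMetricType R}.
Variables (alpha tau Cnu : R) (S : int -> set Z).
Variable nu : {outer_measure set Z -> \bar R}.
Hypothesis alpha1 : 1 < alpha.
Hypothesis tau3 : 3 < tau.
Hypothesis maxS : forall n : int, maximal_separated (alpha ^ (- n)) (S n).
Hypothesis mm : metric_measure nu.
Hypothesis dbl : doubling nu Cnu.
Variables (Y : completeMetricType R) (iota : (Z * int -> R) -> Y) (j : Z -> Y).
Hypothesis compl : uniformized_completion alpha tau S iota.
Hypothesis bdry : boundary_identification alpha S iota j.
Variable beta : R.
Hypothesis beta0 : 0 < beta.
Local Notation vertex := (Z * int)%type.
Local Notation E := (filling_edge alpha tau S).
Local Notation r n := (alpha ^ (- n%R)).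
Local Notation lam := (@lebesgue_measure R).
Local Notation Xp := (Xpart alpha tau S iota).
Local Notation vb v := (vball alpha tau v).
Local Notation ec := (edge_curve iota).
Local Notation mub := (mub alpha1 tau3 maxS mm dbl compl beta).

Let alpha0 : 0 < alpha. Proof. exact: lt_trans alpha1. Qed.
Let tau0 : 0 < tau. Proof. by have := tau3; lra. Qed.
Let rgt0 (n : int) : 0 < r n. Proof. exact: exprz_gt0. Qed.
Hint Resolve rgt0 : core.

(** A sum rather than a maximum of the required multiples; the final 1 makes the level dominate the
    radius itself. *)
Definition top_scale : R := lipB alpha tau + lipH alpha + lipC alpha tau + 1.

Definition edge_reach : R := alpha + geom alpha + 3 * lipJ alpha.

Lemma lipH_gt0 : 0 < lipH alpha.
Proof. by rewrite !mulr_gt0 ?exprn_gt0 ?subr_gt0. Qed.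

Lemma lipC_gt0 : 0 < lipC alpha tau.
Proof. by rewrite addr_gt0 ?(lipB_gt0 alpha1 tau3)// !mulr_gt0 ?lipH_gt0 ?exprn_gt0 ?subr_gt0. Qed.

Lemma top_scale_gt0 : 0 < top_scale.
Proof.
rewrite /top_scale.
by have := lipB_gt0 alpha1 tau3; have := lipH_gt0; have := lipC_gt0; lra.
Qed.

Lemma edge_reach_gt0 : 0 < edge_reach.
Proof. by rewrite /edge_reach; have := geom_ge1 alpha1; have := lipJ_gt0 alpha1; have := alpha0; lra. Qed.

(* At a level [m] given by this lemma, an edge that meets the ball of radius [s]
   around [j z] has its ends close to [z] and at levels at least [m]. *)
Lemma top_level (s : R) : 0 < s -> exists m : int,
  [/\ lipB alpha tau * s <= r m, lipH alpha * s <= r m, lipC alpha tau * s <= 2 * r m,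
      s <= r m & r m < alpha * top_scale * s].
Proof.
move=> s0; have [m /andP[h1 h2]] := exprz_scale alpha1 (mulr_gt0 top_scale_gt0 s0).
have B0 := mulr_gt0 (lipB_gt0 alpha1 tau3) s0; have H0 := mulr_gt0 lipH_gt0 s0.
have C0 := mulr_gt0 lipC_gt0 s0.
have ts : top_scale * s = lipB alpha tau * s + lipH alpha * s + lipC alpha tau * s + s.
  by rewrite /top_scale; ring.
rewrite -mulrA in h2 *; exists m; split; last exact: h2.
all: rewrite ts in h1; lra.
Qed.

Lemma near_vol_sum (m n : int) z (F : seq vertex) : m <= n -> uniq F ->
  (forall v, v \in F -> [/\ vertices S v, v.2 = n & mdist v.1 z <= 2 * r m]) ->
  \sum_(v <- F) vol nu (vb v) * (fun=> 1) v <=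
  dbl_const Cnu (2 * tau) * vol nu (ball z (3 * r m)).
Proof.
move=> mn uF FV; under eq_bigr do rewrite mulr1.
apply: (net_sum_vol alpha1 tau3 maxS mm dbl (n := n)) => //; first exact: mulr_gt0.
move=> v /FV[Vv vn vz]; split => //; rewrite metric_sym.
by have := ler_exprzN alpha1 mn; have := rgt0 n; lra.
Qed.

Definition mass_upper : R := upper_const alpha tau Cnu beta *
  ((alpha * top_scale) `^ beta *
   (dbl_const Cnu (2 * tau) * dbl_const Cnu (3 * (alpha * top_scale)))).

Lemma upper_const_ge0 : 0 <= upper_const alpha tau Cnu beta.
Proof.
have d1 := dbl_const_gt0 Cnu; have k1 := level_ratio_lt1 alpha1 beta0.
rewrite /upper_const /degree_const /edge_vol_const.
apply: mulr_ge0; first by rewrite mulr_ge0 ?mulr_ge0 ?powR_ge0// addr_ge0// ltW.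
apply: mulr_ge0; last by rewrite invr_ge0 subr_ge0 ltW.
by do ![apply: mulr_ge0 => //; try exact: ltW].
Qed.

Lemma mub_full (A : set (borel_type Y)) : measurable A -> mub A = mub (A `&` Xp).
Proof.
move=> mA; have mX := measurable_Xpart alpha1 tau3 maxS mm dbl compl.
have := integral_full_measure A (cst 1%E) mX (mub_boundary alpha1 tau3 maxS mm dbl compl beta).
by rewrite !integral_cst ?mul1e//; exact: measurableI.
Qed.

Lemma measurable_yball (y : Y) (s : R) : measurable (ball y s : set (borel_type Y)).
Proof. by apply: sub_sigma_algebra; exact: open_mball. Qed.

Lemma mub_ball_le z (s : R) : 0 < s ->
  (mub (ball (j z) s) <= (mass_upper * (s `^ beta * vol nu (ball z s)))%:E)%E.
Proof.
move=> s0; have [m [_ hs cs sm ms]] := top_level s0.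
have mX := measurable_Xpart alpha1 tau3 maxS mm dbl compl.
have mD : measurable (ball (j z) s `&` Xp : set (borel_type Y)).
  by apply: measurableI => //; exact: measurable_yball.
rewrite mub_full; last exact: measurable_yball.
rewrite -[leLHS]mul1e -integral_cst//.
have ub := ball_integral_le alpha1 tau3 maxS mm dbl compl bdry beta0
  (fun _ => ler01) (fun n F => @near_vol_sum m n z F) hs cs (G := cst 1%E).
apply: le_trans (ub _ _ _) _ => //.
  by move=> v w t _ _; rewrite lee_fin lerDl.
rewrite lee_fin /mass_upper -[leRHS]mulrA ler_wpM2l ?upper_const_ge0//.
have L0 := mulr_gt0 alpha0 top_scale_gt0; have r0 := rgt0 m.
have d1 := dbl_const_gt0 Cnu (2 * tau); have d2 := dbl_const_gt0 Cnu (3 * (alpha * top_scale)).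
have p1 : r m `^ beta <= (alpha * top_scale) `^ beta * s `^ beta.
  rewrite -powRM ?(ltW L0) ?(ltW s0)//.
  by have := ge0_ler_powR (ltW beta0) (ltW r0) (le_trans (ltW r0) (ltW ms)) (ltW ms).
have p2 : vol nu (ball z (3 * r m)) <= dbl_const Cnu (3 * (alpha * top_scale)) * vol nu (ball z s).
  apply: (vol_doubling mm dbl) => //; first by rewrite mulr_gt0.
    by rewrite mulr_ge0// ltW.
  by rewrite mdistxx add0r -mulrA ler_wpM2l// ltW.
rewrite [leRHS](_ : _ = ((alpha * top_scale) `^ beta * s `^ beta) *
    (dbl_const Cnu (2 * tau) * (dbl_const Cnu (3 * (alpha * top_scale)) * vol nu (ball z s)))); last by ring.
have v0 := vol_gt0 mm z (mulr_gt0 (ltr0n R 3) r0).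
by rewrite ler_pM ?powR_ge0 ?(mulr_ge0 (ltW d1)) ?(ltW v0)// ler_wpM2l// ltW.
Qed.

(** [alpha] pays for rounding to a level, and the 1 makes the inclusion in the open ball strict. *)
Definition bottom_scale : R := alpha * (edge_reach + 1).

Definition mass_lower : R := alpha `^ (- beta) *
  (bottom_scale^-1 `^ beta * (dbl_const Cnu (1 + bottom_scale))^-1).

Lemma bottom_scale_gt0 : 0 < bottom_scale.
Proof. by rewrite mulr_gt0// addr_gt0// edge_reach_gt0. Qed.

Lemma mass_lower_gt0 : 0 < mass_lower.
Proof.
rewrite mulr_gt0 ?powR_gt0// mulr_gt0 ?invr_gt0 ?dbl_const_gt0//.
by rewrite powR_gt0// invr_gt0 bottom_scale_gt0.
Qed.

(** A single edge suffices: the vertical one above [z] at scale [s / bottom_scale] lies in the ball,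
    and by doubling its mass is comparable to the claimed bound. *)
Lemma mub_ball_ge z (s : R) : 0 < s ->
  ((mass_lower * (s `^ beta * vol nu (ball z s)))%:E <= mub (ball (j z) s))%E.
Proof.
move=> s0; have b0 := bottom_scale_gt0; have e0 := edge_reach_gt0.
have [k /andP[h1 h2]] := exprz_scale alpha1 (divr_gt0 s0 b0).
pose u := net_vertex alpha S k z; pose w := net_vertex alpha S (k + 1) z.
have uw : E u w := net_edge alpha1 tau3 maxS k z.
have [_ uz] := net_ptP alpha1 maxS k z.
have reach : edge_reach * r k < s.
  have h3 : (edge_reach + 1) * r k < s.
    have e1 := addr_gt0 e0 ltr01.
    rewrite mulrC -(ltr_pdivlMr _ _ e1); apply: lt_le_trans h2 _.
    rewrite le_eqVlt; apply/orP; left; apply/eqP; rewrite /bottom_scale; field.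
    by rewrite (gt_eqF e1) gt_eqF.
  by apply: le_lt_trans h3; rewrite ler_wpM2r ?(ltW (rgt0 _))// lerDl.
have inD t : t \in `[0, 1] -> ball (j z) s (ec u w t).
  move=> t01; rewrite ballEmdist/=.
  apply: le_lt_trans (edge_inside alpha1 tau3 maxS compl bdry uw t01 (lexx k) _) reach.
  by have := rgt0 k; rewrite /=; lra.
have one : (\int[lam]_(t in `[0%R, 1%R]) (cst 1 : Y -> \bar R) (ec u w t) = 1)%E.
  transitivity (\int[lam]_(t in `[0%R, 1%R]) (cst 1 t))%E; first by [].
  rewrite integral_cst//; have := @lebesgue_measure_itv R `[0, 1]%R.
  by rewrite /= lte_fin ltr01 -EFinB subr0 => ->; rewrite mule1.
rewrite -[leRHS]mul1e -integral_cst; last exact: measurable_yball.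
apply: le_trans (mub_integral_ge alpha1 tau3 maxS mm dbl compl beta0 (s := [:: (u, w)])
  (G := cst 1%E) isT _ (measurable_yball _ _) _ _ _) => //.
- have v0 := vol_vball_gt0 alpha1 tau3 mm u; have v1 := vol_vball_gt0 alpha1 tau3 mm w.
  rewrite big_seq1 one mule1 lee_fin edge_massE// /mass_lower -mulrA ler_wpM2l ?powR_ge0//.
  have d0 := dbl_const_gt0 Cnu (1 + bottom_scale).
  have sk : s <= bottom_scale * r k by rewrite mulrC -ler_pdivrMr.
  have p1 : bottom_scale^-1 `^ beta * s `^ beta <= r k `^ beta.
    rewrite -powRM ?invr_ge0 ?(ltW b0) ?(ltW s0)//.
    have x0 : 0 <= s / bottom_scale by rewrite ltW// divr_gt0.
    rewrite mulrC.
    by have := ge0_ler_powR (ltW beta0) x0 (ltW (rgt0 k)) h1.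
  have p2 : (dbl_const Cnu (1 + bottom_scale))^-1 * vol nu (ball z s) <= edge_weight alpha tau nu (u, w).
    rewrite ler_pdivrMl//; apply: (@le_trans _ _ (dbl_const Cnu (1 + bottom_scale) * vol nu (vb u))).
      apply: (vol_doubling mm dbl) => //; first by rewrite mulr_gt0.
        by rewrite addr_ge0// ltW.
      rewrite /= mulrDl mul1r; apply: lerD.
        by apply: le_trans (ltW uz) _; rewrite ler_peMl ?(ltW (rgt0 _))//; have := tau3; lra.
      apply: le_trans sk _; rewrite ler_wpM2l ?(ltW b0)//.
      by rewrite ler_peMl ?(ltW (rgt0 _))//; have := tau3; lra.
    by rewrite ler_wpM2l ?(ltW d0)// /edge_weight/= lerDl ltW.
  rewrite [leLHS](_ : _ = (bottom_scale^-1 `^ beta * s `^ beta) *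
    ((dbl_const Cnu (1 + bottom_scale))^-1 * vol nu (ball z s))); last by ring.
  rewrite ler_pM ?mulr_ge0 ?powR_ge0 ?invr_ge0 ?(ltW d0)//.
  exact/ltW/(vol_gt0 mm).
- by move=> e; rewrite inE => /eqP ->.
- by move=> e t; rewrite inE => /eqP -> /=; exact: inD.
Qed.

End scales.

(** * The Poincare inequality *)

Lemma powR_max_le (R : realType) (a b e : R) :
  Num.max a b `^ e <= a `^ e + b `^ e.
Proof. by have [_|_] := leP a b; rewrite ?lerDl ?lerDr powR_ge0. Qed.

Section poincare.
Context {R : realType} {Z : completeMetricType R}.
Variables (alpha tau Cnu : R) (S : int -> set Z).
Variable nu : {outer_measure set Z -> \bar R}.
Hypothesis alpha1 : 1 < alpha.
Hypothesis tau3 : 3 < tau.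
Hypothesis maxS : forall n : int, maximal_separated (alpha ^ (- n)) (S n).
Hypothesis mm : metric_measure nu.
Hypothesis dbl : doubling nu Cnu.
Variables (Y : completeMetricType R) (iota : (Z * int -> R) -> Y) (j : Z -> Y).
Hypothesis compl : uniformized_completion alpha tau S iota.
Hypothesis bdry : boundary_identification alpha S iota j.
Variables (beta p : R).
Hypothesis p1 : 1 <= p.
Hypothesis beta0 : 0 < beta.
Hypothesis betap : beta < p.
Local Notation vertex := (Z * int)%type.
Local Notation E := (filling_edge alpha tau S).
Local Notation r n := (alpha ^ (- n%R)).
Local Notation Xp := (Xpart alpha tau S iota).
Local Notation vb v := (vball alpha tau v).
Local Notation ec := (edge_curve iota).
Local Notation mub := (mub alpha1 tau3 maxS mm dbl compl beta).
Local Notation dZ := (fun x y : Z => mdist (j x) (j y)).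
Local Notation nuC := (nu : set (caratheodory_type nu) -> \bar R).

Let alpha0 : 0 < alpha. Proof. exact: lt_trans alpha1. Qed.
Let rgt0 (n : int) : 0 < r n. Proof. exact: exprz_gt0. Qed.
Let p0 : 0 < p. Proof. exact: lt_le_trans ltr01 p1. Qed.
Hint Resolve rgt0 : core.

(** The edges of the chains reach [edge_reach] times the radius of the top level, which is below
    [alpha * top_scale * s]; the 1 gives strictness and a constant that is at least 1. *)
Definition dilation : R := edge_reach alpha * (alpha * top_scale alpha tau) + 1.

Lemma dilation_ge1 : 1 <= dilation.
Proof.
rewrite lerDr mulr_ge0 ?mulr_ge0 ?(ltW alpha0) ?(ltW (top_scale_gt0 alpha1 tau3))//.
exact/ltW/edge_reach_gt0.
Qed.

Definition mass_ratio (c : R) : R :=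
  mass_upper alpha tau Cnu beta * (dilation `^ beta * dbl_const Cnu c).

(** The first summand in the inner parentheses bounds the deviation of [f] from [c], the second the
    distance from [c] to the mean of the extension; the final 1 makes the constant positive. *)
Definition poincare_const : R :=
  2 `^ p * (2 `^ p * chain_const alpha tau Cnu beta p *
  ((alpha * top_scale alpha tau) `^ (p - beta) * mass_ratio (dilation * lipJ alpha) +
   upper_const alpha tau Cnu beta * (alpha * top_scale alpha tau) `^ p *
   (mass_ratio dilation / mass_lower alpha Cnu beta))) + 1.

Lemma mass_upper_ge0 : 0 <= mass_upper alpha tau Cnu beta.
Proof.
rewrite mulr_ge0 ?upper_const_ge0// mulr_ge0 ?powR_ge0// mulr_ge0// ltW//; exact: dbl_const_gt0.
Qed.

Lemma mass_ratio_ge0 c : 0 <= mass_ratio c.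
Proof.
rewrite (mulr_ge0 mass_upper_ge0)// mulr_ge0 ?powR_ge0// ltW//; exact: dbl_const_gt0.
Qed.

Lemma poincare_const_gt0 : 0 < poincare_const.
Proof.
have c1 := chain_const_ge0 tau Cnu alpha1 betap; have c2 := upper_const_ge0 tau Cnu alpha1 beta0.
have c3 := mass_lower_gt0 Cnu alpha1 beta.
rewrite ltr_wpDl// mulr_ge0 ?powR_ge0// mulr_ge0//.
  by rewrite mulr_ge0 ?powR_ge0.
rewrite addr_ge0// mulr_ge0 ?powR_ge0 ?mass_ratio_ge0//.
  by rewrite mulr_ge0 ?powR_ge0.
by rewrite mulr_ge0 ?mass_ratio_ge0// invr_ge0 ltW.
Qed.

Lemma mub_dilated_le (c t : R) x z (s : R) : 0 < s -> 0 < t -> 0 <= c ->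
  mdist x z + dilation * s <= c * t ->
  (mub (ball (j z) (dilation * s)) <= (mass_ratio c * (s `^ beta * vol nu (ball x t)))%:E)%E.
Proof.
move=> s0 t0 c0 xz; have D0 := lt_le_trans ltr01 dilation_ge1.
have Ds := mulr_gt0 D0 s0.
apply: le_trans (mub_ball_le alpha1 tau3 maxS mm dbl compl bdry beta0 z Ds) _.
rewrite lee_fin /mass_ratio -mulrA ler_wpM2l ?mass_upper_ge0//.
rewrite (powRM _ (ltW D0) (ltW s0)).
rewrite [leRHS](_ : _ = dilation `^ beta * s `^ beta * (dbl_const Cnu c * vol nu (ball x t))); last by ring.
by rewrite ler_wpM2l ?mulr_ge0 ?powR_ge0// (vol_doubling mm dbl).
Qed.

(** The final bookkeeping, in real numbers. [N] is the volume of the ball, [V] and [W] are the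
    masses of the ball in [Y] and of its dilation, [X] and [A] are the integrals of the deviation of
    [f] from the mean and from [c], [q] is the p-th power of the distance between these two
    constants, [t] is the radius of the top level, and [I] is the integral of the p-th power of
    [g]. *)
Lemma poincare_arith (A N V W X q s t K I a b u : R) :
  0 < N -> 0 < V -> 0 < W -> 0 < s -> 0 < t -> 0 <= K -> 0 <= I -> 0 <= u ->
  X <= 2 `^ p * (A + q * N) ->
  A <= 2 `^ p * (K * t `^ (p - beta) * I) ->
  V * q <= 2 `^ p * (u * (t `^ beta * (K * t `^ (p - beta) * I))) ->
  t <= (alpha * top_scale alpha tau) * s ->
  W <= a * (s `^ beta * N) -> W <= b * V ->
  N^-1 * X <= (2 `^ p * (2 `^ p * K *
    ((alpha * top_scale alpha tau) `^ (p - beta) * a +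
     u * (alpha * top_scale alpha tau) `^ p * b)) + 1) * s `^ p * (W^-1 * I).
Proof.
set L := alpha * _; move=> N0 V0 W0 s0 t0 K0 I0 u0 hX hA hq ts Wa Wb.
have L0 : 0 <= L by rewrite -(pmulr_lge0 _ s0) (le_trans (ltW t0)).
have Ls e : 0 <= e -> t `^ e <= L `^ e * s `^ e.
  move=> e0; rewrite -(powRM _ L0 (ltW s0)).
  by have := ge0_ler_powR e0 (ltW t0) (mulr_ge0 L0 (ltW s0)) ts.
have split_s : s `^ p = s `^ (p - beta) * s `^ beta.
  by rewrite -powRD ?subrK// (gt_eqF s0) implybT.
have split_t : t `^ p = t `^ beta * t `^ (p - beta).
  by rewrite mulrC -powRD ?subrK// (gt_eqF t0) implybT.
have pb : 0 <= p - beta by rewrite subr_ge0 ltW.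
set y := 2 `^ p in hX hA hq *; have y0 : 0 <= y by exact: powR_ge0.
have WI : 0 <= W^-1 * I by rewrite mulr_ge0// invr_ge0 ltW.
have hN : N^-1 <= a * s `^ beta * W^-1.
  by rewrite ler_pdivlMr// mulrC ler_pdivrMr// -mulrA.
have hV : V^-1 <= b * W^-1.
  by rewrite ler_pdivlMr// ler_pdivrMl// mulrC.
have h1 : N^-1 * A <= y * K * (L `^ (p - beta) * a) * s `^ p * (W^-1 * I).
  apply: (@le_trans _ _ (N^-1 * (y * (K * (L `^ (p - beta) * s `^ (p - beta)) * I)))).
    rewrite ler_wpM2l ?invr_ge0 ?(ltW N0)//; apply: le_trans hA _.
    by rewrite ler_wpM2l// ler_wpM2r// ler_wpM2l// Ls.
  apply: (@le_trans _ _ (a * s `^ beta * W^-1 * (y * (K * (L `^ (p - beta) * s `^ (p - beta)) * I)))).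
    by rewrite ler_wpM2r// !mulr_ge0 ?powR_ge0.
  by rewrite split_s le_eqVlt; apply/orP; left; apply/eqP; ring.
have h2 : q <= y * K * (u * L `^ p * b) * s `^ p * (W^-1 * I).
  have hq' : q <= V^-1 * (y * (u * (t `^ p * (K * I)))).
    rewrite ler_pdivlMl//; apply: le_trans hq _.
    by rewrite split_t le_eqVlt; apply/orP; left; apply/eqP; ring.
  apply: le_trans hq' _.
  apply: (@le_trans _ _ (V^-1 * (y * (u * (L `^ p * s `^ p * (K * I)))))).
    rewrite ler_wpM2l ?invr_ge0 ?(ltW V0)// ler_wpM2l// ler_wpM2l// ler_wpM2r ?mulr_ge0//.
    by rewrite Ls// ltW.
  apply: (@le_trans _ _ (b * W^-1 * (y * (u * (L `^ p * s `^ p * (K * I)))))).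
    by rewrite ler_wpM2r// !mulr_ge0 ?powR_ge0.
  by rewrite le_eqVlt; apply/orP; left; apply/eqP; ring.
apply: (@le_trans _ _ (y * (N^-1 * A + q))).
  rewrite [leRHS](_ : _ = N^-1 * (y * (A + q * N))); last by field; rewrite gt_eqF.
  by rewrite ler_wpM2l// invr_ge0 ltW.
rewrite -mulrA mulrDl mul1r ler_wpDr ?mulr_ge0 ?powR_ge0 ?invr_ge0 ?(ltW W0)//.
rewrite -!mulrA ler_wpM2l//.
apply: le_trans (lerD h1 h2) _.
by rewrite le_eqVlt; apply/orP; left; apply/eqP; ring.
Qed.

Lemma dball_cara z (s : R) : nu.-cara.-measurable (dball dZ z s).
Proof.
apply: (open_cara mm); apply: (open_lipschitz_lt (K := lipJ alpha)).
  exact/ltW/lipJ_gt0.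
move=> x y; apply: le_trans (boundary_dist_le_dist alpha1 tau3 maxS compl bdry x y).
rewrite ler_norml; have := metric_triangle (j z) (j x) (j y).
have := metric_triangle (j z) (j y) (j x); rewrite (metric_sym (j y) (j x)); lra.
Qed.

Lemma poincare (z : Z) (s : R) (f : Z -> R) (g : Y -> \bar R) : 0 < s ->
  besov_space nu dZ p (1 - beta / p) f ->
  let Pf := extension alpha tau S iota nu beta f in
  upper_gradient (ball (j z) (dilation * s)) g Pf ->
  (\int[mub]_(y in ball (j z) (dilation * s)) g y `^ p < +oo)%E ->
  (mean nuC (dball dZ z s)
     (fun x => `|(f x)%:E - mean mub (ball (j z) s) Pf| `^ p)
   <= poincare_const%:E * (s `^ p)%:E *
      mean mub (ball (j z) (dilation * s)) (fun y => g y `^ p))%E.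
Proof.
move=> s0 [mf _ fE] Pf ug Ifin.
have D1 := dilation_ge1; have D0 := lt_le_trans ltr01 D1.
have theta0 : 0 < p * (1 - beta / p).
  by rewrite (_ : p * _ = p - beta) ?subr_gt0//; field; rewrite gt_eqF.
have [m [Bs Hs Cs sm ms]] := top_level alpha1 tau3 s0.
pose c := extension_vertex alpha tau nu f (net_vertex alpha S m z).
pose P := extension_vertex alpha tau nu f.
pose D : set (borel_type Y) := ball (j z) (dilation * s).
have I0 : (0 <= \int[mub]_(y in D) g y `^ p)%E.
  by apply: integral_ge0 => y _; exact: poweR_ge0.
pose I := fine (\int[mub]_(y in D) g y `^ p)%E.
have IE : (\int[mub]_(y in D) g y `^ p = I%:E)%E by rewrite fineK// ge0_fin_numE.
have I0' : 0 <= I by rewrite fine_ge0.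
have er := edge_reach_gt0 alpha1 (R := R).
have Dnear v w t : E v w -> t \in `[0, 1] -> m <= v.2 -> mdist v.1 z <= 3 * r m -> D (ec v w t).
  move=> vw t01 mv vz; rewrite /D ballEmdist/=.
  apply: le_lt_trans (edge_inside alpha1 tau3 maxS compl bdry vw t01 mv vz) _.
  rewrite -/(edge_reach alpha).
  rewrite (_ : dilation * s = edge_reach alpha * (alpha * top_scale alpha tau * s) + s).
    by rewrite ltr_pwDr// ler_wpM2l ?(ltW er)// ltW.
  by rewrite /dilation; ring.
have chain n F : m <= n -> uniq F ->
    (forall v, v \in F -> [/\ vertices S v, v.2 = n & mdist v.1 z <= 2 * r m]) ->
    (\sum_(v <- F) (vol nu (vb v) * `|P v - c| `^ p)%:E <=
     (chain_const alpha tau Cnu beta p * r m `^ (p - beta) * I)%:E)%E.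
  move=> mn uF FV; rewrite EFinM -IE.
  have H := chain_sum alpha1 tau3 maxS mm dbl compl p1 beta0 betap (open_mball (j z) (dilation * s)) ug mn uF FV Dnear.
  exact: H.
set T := chain_const alpha tau Cnu beta p * r m `^ (p - beta) * I in chain.
have devB := ball_deviation alpha1 tau3 maxS mm dbl compl bdry p1 theta0 mf s0 Bs fE chain.
pose F y := fine (Pf y).
pose A : set (borel_type Y) := ball (j z) s `&` Xp.
have mX := measurable_Xpart alpha1 tau3 maxS mm dbl compl.
have mA : measurable A by apply: measurableI => //; exact: measurable_yball.
have mF : measurable_fun A (F : borel_type Y -> R).
  apply: measurableT_comp => //; apply: measurable_funS (measurable_extension alpha1 tau3 maxS mm dbl compl beta f) => //.
  by move=> y [].
have mG := measurable_powR_dist p mF c.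
have chainR n F' : m <= n -> uniq F' ->
    (forall v, v \in F' -> [/\ vertices S v, v.2 = n & mdist v.1 z <= 2 * r m]) ->
    \sum_(v <- F') vol nu (vb v) * (fun v => `|P v - c| `^ p) v <= T.
  by move=> mn uF FV; rewrite -lee_fin -sumEFin; exact: chain mn uF FV.
have devA : (\int[mub]_(y in A) (`|F y - c| `^ p)%:E <=
    (upper_const alpha tau Cnu beta * (r m `^ beta * T))%:E)%E.
  apply: (ball_integral_le alpha1 tau3 maxS mm dbl compl bdry beta0 _ chainR Hs Cs mG).
  - by move=> v; exact: powR_ge0.
  - by move=> y; rewrite lee_fin powR_ge0.
  - move=> v w t vw t01; rewrite lee_fin.
    have Xt : Xp (ec v w t) by exists (edge_pt v w t) => //; exact: filling_edge_pt.
    have := extension_edge_between nu alpha1 tau3 maxS compl beta f c vw t01.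
    rewrite (extension_Xpart nu alpha1 tau3 maxS compl beta f Xt) -EFinB /= lee_fin -/(F _) => h.
    apply: le_trans (ge0_ler_powR (ltW p0) (normr_ge0 _) (le_trans (normr_ge0 _) h) h) _.
    exact: powR_max_le.
pose N := vol nu (dball dZ z s).
have N0 : 0 < N := vol_dball_gt0 alpha1 tau3 maxS mm compl bdry z s0.
have NE : nu (dball dZ z s) = N%:E := nu_dball alpha1 tau3 maxS mm compl bdry z s0.
have low := mub_ball_ge alpha1 tau3 maxS mm dbl compl bdry beta0 z s0.
have up := mub_ball_le alpha1 tau3 maxS mm dbl compl bdry beta0 z s0.
have vz := vol_gt0 mm z s0.
have ml := mass_lower_gt0 Cnu alpha1 beta.
pose V := fine (mub (ball (j z) s)).
have VE : mub (ball (j z) s) = V%:E.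
  by rewrite /V fineK// ge0_fin_numE ?measure_ge0// (le_lt_trans up) ?ltry.
have V0 : 0 < V.
  rewrite -lte_fin -VE; apply: lt_le_trans low.
  by rewrite lte_fin (mulr_gt0 ml)// mulr_gt0// powR_gt0.
have AV : mub A = V%:E by rewrite -VE [RHS]mub_full//; exact: measurable_yball.
(* The boundary is a null set, so the upper limits that define the extension there do not affect its
   mean. *)
have meanE : mean mub (ball (j z) s) Pf = mean mub A (EFin \o F).
  rewrite /mean VE AV; congr (_ * _)%E.
  rewrite (integral_full_measure _ _ mX (mub_boundary alpha1 tau3 maxS mm dbl compl beta)).
  apply: eq_integral => y /set_mem[_ Xy].
  by rewrite /= -(extension_Xpart nu alpha1 tau3 maxS compl beta f Xy).
have mfin : mean mub A (EFin \o F) \is a fin_num.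
  by apply: (mean_fin_num p1 mA mF AV V0 (a := c)); apply: le_lt_trans devA (ltry _).
pose M := fine (mean mub A (EFin \o F)).
have ME : mean mub (ball (j z) s) Pf = M%:E by rewrite meanE /M fineK.
have devM := le_trans (mean_deviation p1 mA mF AV V0 c) (lee_wpmul2l _ devA).
rewrite lee_fin powR_ge0 -EFinM lee_fin in devM; have {devM} hq := devM isT.
have mB : measurable (dball dZ z s : set (caratheodory_type nu)) by exact: dball_cara.
have mfB : measurable_fun (dball dZ z s : set (caratheodory_type nu)) f by exact: measurable_funTS.
have shift : (\int[nuC]_(x in dball dZ z s) (`|f x - M| `^ p)%:E <= (2 `^ p)%:E *
    (\int[nuC]_(x in dball dZ z s) (`|f x - c| `^ p)%:E + (`|c - M| `^ p)%:E * N%:E))%E.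
  by rewrite -NE; exact (@deviation_shift _ _ _ nuC _ _ _ p1 mB mfB c M).
pose W := fine (mub D).
have upD := mub_dilated_le s0 s0 (ltW D0) (_ : mdist z z + dilation * s <= dilation * s).
rewrite mdistxx add0r in upD; have {}upD := upD (lexx _).
have J0 := lipJ_gt0 alpha1.
(* [N] is a volume for the boundary metric, while doubling holds for the original one; the original
   ball of radius [s / lipJ alpha] is contained in [dball]. *)
have upN := mub_dilated_le (c := dilation * lipJ alpha) (t := s / lipJ alpha) (x := z) (z := z) s0.
rewrite mdistxx add0r in upN.
have {}upN := upN (divr_gt0 s0 J0) (mulr_ge0 (ltW D0) (ltW J0)).
rewrite (_ : dilation * lipJ alpha * (s / lipJ alpha) = dilation * s) in upN; last first.
  by field; rewrite gt_eqF.
have {}upN := upN (lexx _).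
have WE : mub D = W%:E.
  by rewrite /W fineK// ge0_fin_numE ?measure_ge0// (le_lt_trans upD) ?ltry.
have VW : V <= W.
  have mb t : (ball (j z) t : set (borel_type Y)) \in measurable.
    by apply/mem_set; exact: measurable_yball.
  rewrite -lee_fin -VE -WE; apply: (le_measure mub (mb s) (mb (dilation * s))).
  by apply: le_ball; rewrite ler_peMl// ltW.
have W0 : 0 < W by exact: lt_le_trans V0 VW.
rewrite WE lee_fin in upD; rewrite WE lee_fin in upN.
pose X := fine (\int[nuC]_(x in dball dZ z s) (`|f x - M| `^ p)%:E)%E.
have X0 : (0 <= \int[nuC]_(x in dball dZ z s) (`|f x - M| `^ p)%:E)%E.
  by apply: integral_ge0 => x _; rewrite lee_fin powR_ge0.
have AfinB : (0 <= \int[nuC]_(x in dball dZ z s) (`|f x - c| `^ p)%:E)%E.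
  by apply: integral_ge0 => x _; rewrite lee_fin powR_ge0.
pose Ac := fine (\int[nuC]_(x in dball dZ z s) (`|f x - c| `^ p)%:E)%E.
have AcE : (\int[nuC]_(x in dball dZ z s) (`|f x - c| `^ p)%:E)%E = Ac%:E.
  by rewrite /Ac fineK// ge0_fin_numE// (le_lt_trans devB)// -EFinM ltry.
rewrite AcE -EFinM lee_fin in devB.
rewrite AcE -(EFinM (`|c - M| `^ p)) -EFinD -EFinM in shift.
have XE : (\int[nuC]_(x in dball dZ z s) (`|f x - M| `^ p)%:E)%E = X%:E.
  by rewrite /X fineK// ge0_fin_numE//; apply: le_lt_trans shift (ltry _).
rewrite XE lee_fin in shift.
rewrite ME /mean NE WE IE !inver !gt_eqF//.
rewrite (_ : (fun x => _) = (fun x => (`|f x - M| `^ p)%:E)); last first.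
  by apply/funext => x.
rewrite XE -!EFinM lee_fin.
apply: (poincare_arith N0 V0 W0 s0 (rgt0 m) _ I0' _ shift devB hq (ltW ms)).
- exact: chain_const_ge0.
- exact: upper_const_ge0.
- apply: le_trans upN _; rewrite ler_wpM2l ?mass_ratio_ge0// ler_wpM2l ?powR_ge0//.
  by have /andP[] := vol_dball alpha1 tau3 maxS mm compl bdry z s0.
- apply: le_trans upD _; rewrite -mulrA ler_wpM2l ?mass_ratio_ge0//.
  by rewrite ler_pdivlMl// -lee_fin -VE.
Qed.

End poincare.

Theorem proposition6p8 (R : realType) (alpha tau : R) (halpha : 1 < alpha)
    (htau : Num.max 3 (alpha / (alpha - 1)) < tau) :
  exists2 C : R, 1 <= C &
  forall (Cnu beta p : R), 1 <= p -> 0 < beta < p ->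
  exists2 C1 : R, 0 < C1 &
  forall (Z : completeMetricType R) (nu : {outer_measure set Z -> \bar R})
    (S : int -> set Z) (Y : completeMetricType R)
    (iota : (Z * int -> R) -> Y) (j : Z -> Y),
  metric_measure nu -> doubling nu Cnu ->
  (forall n : int, maximal_separated (alpha ^ (- n)) (S n)) ->
  uniformized_completion alpha tau S iota ->
  boundary_identification alpha S iota j ->
  let d := fun x y : Z => mdist (j x) (j y) in
  let mu := mu_beta alpha tau S iota nu beta in
  forall (z : Z) (r : R), 0 < r ->
  let B := dball d z r in
  let hatB (k : R) : set Y := ball (j z) (k * r) in
  forall f : Z -> R, besov_space nu d p (1 - beta / p) f ->
  let Pf := extension alpha tau S iota nu beta f in
  forall g : Y -> \bar R, upper_gradient (hatB C) g Pf ->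
  (\int[mu]_(y in hatB C) g y `^ p < +oo)%E ->
  (mean (nu : set (caratheodory_type nu) -> \bar R) B
     (fun x => `|(f x)%:E - mean mu (hatB 1%R) Pf| `^ p)
   <= C1%:E * (r `^ p)%:E * mean mu (hatB C) (fun y => g y `^ p))%E.
Proof.
have tau3 : 3 < tau by apply: le_lt_trans htau; rewrite le_max lexx.
exists (dilation alpha tau); first exact: dilation_ge1.
move=> Cnu beta p p1 /andP[beta0 betap].
exists (poincare_const alpha tau Cnu beta p); first exact: poincare_const_gt0.
move=> Z nu S Y iota j mm dbl maxS compl bdry d mu z s s0 B hatB f Bf Pf g ug Ifin.
rewrite /hatB mul1r.
exact: (@poincare _ _ _ _ _ _ _ halpha tau3 maxS mm dbl _ _ _ compl bdry
  _ _ p1 beta0 betap _ _ _ _ s0 Bf ug Ifin).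
Qed.
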